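(* Assume the standing setting described in the context. Let $J$ be an index set with $I^+\subseteq J\subseteq I$, and assume that $C(A_j)<\infty$ for all $j\in J$. Then the $(\boldsymbol A,\boldsymbol a,g,\chi,J)$-problem is solvable, i.e. there exists $\tilde{\boldsymbol\lambda}\in\mathcal E^+(\boldsymbol A,\boldsymbol a,g,J)$ with $G_\chi(\tilde{\boldsymbol\lambda})=G_\chi(\boldsymbol A,\boldsymbol a,g,J)$, and the class $\mathfrak S_\chi(\boldsymbol A,\boldsymbol a,g,J)$ of all its solutions is compact in the vague topology (componentwise vague topology on vector measures).
   Context: Standing setting. $\mathrm X$ is a noncompact locally compact Hausdorff space; $\mathfrak M$ is the space of real Radon measures on $\mathrm X$ with the vague topology (pointwise convergence on continuous compactly supported functions); $S(\nu)$ is the support of $\nu$; $\nu$ is bounded if $|\nu|(\mathrm X)<\infty$. The kernel $\kappa:\mathrm X\times\mathrm X\to[0,\infty]$ is lower semicontinuous and symmetric; $\kappa(\nu,\nu_1)=\int\kappa(x,y)\,d(\nu\otimes\nu_1)(x,y)$ is the mutual energy and $\kappa(x,\nu)=\int\kappa(x,y)\,d\nu(y)$ the potential; $\mathcal E$ is the set of $\nu\in\mathfrak M$ for which $\kappa(\nu,\nu)$ is well defined and finite. It is assumed that: (a) $\kappa$ is strictly positive definite: $\kappa(\nu,\nu)\ge0$ whenever defined, and $\|\nu\|:=\kappa(\nu,\nu)^{1/2}$ is a norm on the pre-Hilbert space $\mathcal E$ (inner product $\kappa(\nu,\nu_1)$); ''strong'' refers to this norm; (b) $\kappa$ is consistent: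 every strong Cauchy net in $\mathcal E^+:=\{\nu\in\mathcal E:\nu\ge0\}$ converges strongly to each of its vague cluster points; (c) $\kappa(x,y)$ is finite and continuous for $x\neq y$; (d) for every $\varepsilon>0$ and compact $K\subset\mathrm X$ there is a compact $K'$ with $\kappa(x,y)<\varepsilon$ for $x\in K$, $y\notin K'$; (e) generalized maximum principle with a constant $h\ge1$: for every compactly supported $\nu\ge0$ with $M:=\sup_{x\in S(\nu)}\kappa(x,\nu)<\infty$, one has $\kappa(x,\nu)\le hM$ for all $x\in\mathrm X$. A measure $\nu\ge0$ is concentrated on $E$ if $\mathrm X\setminus E$ is locally $\nu$-negligible; $\mathcal E^+_E$ is the set of elements of $\mathcal E^+$ concentrated on $E$. Interior capacity: $C(E)=1/\inf\{\kappa(\nu,\nu):\nu\in\mathcal E^+_E,\ \nu(E)=1\}$ (infimum over $\varnothing$ is $+\infty$); ''n.e.'' means except on a set of interior capacity zero. Condenser: $I^+,I^-$ are disjoint countable index sets ($I^-$ may be empty), $I=I^+\cup I^-$; each $A_i$, $i\in I$, is a nonempty closed subset of $\mathrm X$; every compact set meets only finitely many $A_i$; $A_i\cap A_j=\varnothing$ for $i\in I^+$, $j\in I^-$. Put $\alpha_i=+1$ for $i\in I^+$, $\alpha_i=-1$ for $i\in I^-$, $A^\pm=\bigcup_{i\in I^\pm}A_i$, $A=\bigcup_{i\in I}A_i$. It is assumed that $\sup_{(x,y)\in A^+\times A^-}\kappa(x,y)<\infty$. A vector measure is $\boldsymbol\mu=(\mu^i)_{i\in I}$ with $\mu^i\ge0$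 concentrated on $A_i$; $R\boldsymbol\mu:=\sum_{i\in I}\alpha_i\mu^i$ (a signed Radon measure); its energy is $\kappa(\boldsymbol\mu,\boldsymbol\mu)=\sum_{i,j\in I}\alpha_i\alpha_j\kappa(\mu^i,\mu^j)$; $\mathcal E^+(\boldsymbol A)$ is the set of vector measures with finite energy, with seminorm distance $\|\boldsymbol\mu_1-\boldsymbol\mu_2\|_{\mathcal E^+(\boldsymbol A)}:=\|R\boldsymbol\mu_1-R\boldsymbol\mu_2\|$. External field: a bounded signed measure $\chi\in\mathcal E$ with $S(\chi^+)\cap A^-=\varnothing$, $S(\chi^-)\cap A^+=\varnothing$; for $\boldsymbol\mu\in\mathcal E^+(\boldsymbol A)$, $G_\chi(\boldsymbol\mu):=\kappa(\boldsymbol\mu,\boldsymbol\mu)+2\sum_{i\in I}\alpha_i\int\kappa(x,\chi)\,d\mu^i(x)=\|R\boldsymbol\mu\|^2+2\kappa(\chi,R\boldsymbol\mu)$. Normalization: $g$ is continuous on $A$ with $g_{\inf}:=\inf_A g>0$, and for each $i\in I$ either $g|_{A_i}$ is bounded or there are $r_i>1$ and $\nu_i\in\mathcal E$ with $g(x)^{r_i}\le\kappa(x,\nu_i)$ for n.e. $x\in A_i$. $\boldsymbol a=(a_i)_{i\in I}$ with $a_i>0$ and $|\boldsymbol a|:=\sum_i a_i<\infty$. For $I^+\subseteq J\subseteq I$: $\mathcal E^+(\boldsymbol A,\boldsymbol a,g,J):=\{\boldsymbol\mu\in\mathcal E^+(\boldsymbol A):\int g\,d\mu^i=a_i\ \forall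 i\in J\}$, $G_\chi(\boldsymbol A,\boldsymbol a,g,J):=\inf$ of $G_\chi$ over this class; the $(\boldsymbol A,\boldsymbol a,g,\chi,J)$-problem asks for a minimizer in this class, and $\mathfrak S_\chi(\boldsymbol A,\boldsymbol a,g,J)$ denotes the set of minimizers. For $J=I$ the symbol $J$ is dropped. It is assumed that $G_\chi(\boldsymbol A,\boldsymbol a,g)<\infty$. *)

(* Defs.v *)
(* Radon measures are treated a la Bourbaki, as
   linear functionals on the space C_c(X) of continuous compactly supported
   real functions; the vague topology is then the pointwise topology on C_c. *)
From HB Require Import structures.
From mathcomp Require Import all_boot all_order all_algebra.
From mathcomp Require Import all_classical all_reals all_analysis.
Set Implicit Arguments. Unset Strict Implicit. Unset Printing Implicit Defensive.
Import Order.TTheory GRing.Theory Num.Theory numFieldNormedType.Exports.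
Local Open Scope classical_set_scope.
Local Open Scope ring_scope.

Section Radon.
Variables (R : realType) (X : topologicalType).

Record Cc := MkCc {
  ccf :> X -> R ;
  ccf_cont : continuous ccf ;
  ccf_csupp : compact (closure [set x | ccf x != 0]) }.

(* (real) Radon measures are elements of this type satisfying [radon];
   it carries the product (= vague) topology *)
Definition meas := {ptws Cc -> R}.

Definition mopp (nu : meas) : meas := fun f => - nu f.
Definition msub (mu nu : meas) : meas := fun f => mu f - nu f.

Definition radon (nu : meas) :=
  (forall (f g h : Cc) (a b : R), (forall x, h x = a * f x + b * g x) ->
     nu h = a * nu f + b * nu g) /\
  (forall K : set X, compact K -> exists M : R, forall (f : Cc) (c : R),
     (forall x, ~ K x -> f x = 0) -> (forall x, `|f x| <= c) -> `|nu f| <= M * c).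

Definition posradon (nu : meas) :=
  radon nu /\ forall f : Cc, (forall x, 0 <= f x) -> 0 <= nu f.

(* upper integral of a function F >= 0 (l.s.c. in all uses) with respect
   to the positive part nu^+ of nu:  sup { nu(f) : f in C_c, 0 <= f <= F }.
   For positive nu this is the usual upper integral; the negative part is
   [upint (mopp nu)]. *)
Definition upint (nu : meas) (F : X -> \bar R) : \bar R :=
  ereal_sup [set (nu f)%:E | f in [set f : Cc |
     (forall x, 0 <= f x) /\ (forall x, ((f x)%:E <= F x)%E)]].

Definition jpart (nu : meas) (s : bool) : meas := if s then nu else mopp nu.

Variable kappa : X -> X -> \bar R.

Definition pot (nu : meas) (x : X) : \bar R :=
  (upint nu (kappa x) - upint (mopp nu) (kappa x))%E.

(* mutual energy of the Jordan parts nu^s, mu^t (Fubini/iterated form) *)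
Definition penergy (nu mu : meas) (s t : bool) : \bar R :=
  upint (jpart nu s) (fun x => upint (jpart mu t) (kappa x)).

Definition menergy (nu mu : meas) : \bar R :=
  (penergy nu mu true true + penergy nu mu false false
   - (penergy nu mu true false + penergy nu mu false true))%E.

Definition energy (nu : meas) : \bar R := menergy nu nu.

Definition energy_defined (nu : meas) :=
  ~ ((penergy nu nu true true + penergy nu nu false false = +oo)%E /\
     (penergy nu nu true false + penergy nu nu false true = +oo)%E).

(* nu belongs to \mathcal E: kappa(nu,nu) well defined and finite *)
Definition finE (nu : meas) :=
  radon nu /\ forall s t, penergy nu nu s t \is a fin_num.

Definition finEp (nu : meas) := posradon nu /\ finE nu.

Definition snorm (nu : meas) : R := Num.sqrt (fine (energy nu)).

(* total mass (of the positive part) *)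
Definition mass (nu : meas) : \bar R := upint nu (fun _ => 1%E).

(* support of the positive part nu^+ (= S(nu) when nu >= 0):
   complement of the largest open set on which nu^+ vanishes *)
Definition supp_pos (nu : meas) : set X :=
  [set x | forall U : set X, open U -> U x ->
     exists f : Cc, (forall y, 0 <= f y) /\ (forall y, ~ U y -> f y = 0) /\
       0 < nu f].

(* N is nu-negligible (outer measure zero), nu >= 0 *)
Definition negligible (nu : meas) (N : set X) :=
  forall e : R, 0 < e -> exists U : set X, open U /\ N `<=` U /\
    forall f : Cc, (forall x, 0 <= f x <= 1) -> (forall x, ~ U x -> f x = 0) ->
      nu f <= e.

Definition loc_negligible (nu : meas) (N : set X) :=
  forall K : set X, compact K -> negligible nu (N `&` K).

Definition concentrated (nu : meas) (E : set X) := loc_negligible nu (~` E).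

Definition cap_inf (E : set X) : \bar R :=
  ereal_inf [set energy nu | nu in [set nu | finEp nu /\ concentrated nu E /\
                                           mass nu = 1%E]].

Definition capacity (E : set X) : \bar R :=
  match cap_inf E with
  | +oo%E => 0%E
  | r%:E => if r == 0 then +oo%E else (r^-1)%:E
  | -oo%E => +oo%E
  end.

Definition kernel_basic :=
  (forall x y, (0 <= kappa x y)%E) /\
  (forall x y, kappa x y = kappa y x) /\
  (forall p : X * X, forall a : \bar R, (a < kappa p.1 p.2)%E ->
      \forall q \near p, (a < kappa q.1 q.2)%E).

Definition strictly_pd :=
  (forall nu, radon nu -> energy_defined nu -> (0 <= energy nu)%E) /\
  (forall nu, finE nu -> energy nu = 0%E -> forall f : Cc, nu f = 0).

(* (b) consistency, with nets expressed by filters *)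
Definition consistent :=
  forall (F : set_system meas), ProperFilter F -> F finEp ->
    (forall e : R, 0 < e -> exists2 B, F B &
        forall mu nu, B mu -> B nu -> finE (msub mu nu) /\ snorm (msub mu nu) < e) ->
    forall mu0 : meas, cluster F mu0 ->
      forall e : R, 0 < e -> exists2 B, F B &
        forall mu, B mu -> finE (msub mu mu0) /\ snorm (msub mu mu0) < e.

Definition offdiag_cont :=
  forall x y : X, x <> y -> kappa x y \is a fin_num /\
    {for (x, y), continuous (fun p : X * X => kappa p.1 p.2)}.

Definition vanish_at_infty :=
  forall e : R, 0 < e -> forall K : set X, compact K ->
    exists2 K' : set X, compact K' &
      forall x y, K x -> ~ K' y -> (kappa x y < e%:E)%E.

Definition gen_max_principle (h : R) :=
  forall nu : meas, posradon nu -> compact (supp_pos nu) ->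
    forall M : R, 0 <= M -> (forall x, supp_pos nu x -> (pot nu x <= M%:E)%E) ->
      forall x, (pot nu x <= (h * M)%:E)%E.

Variables (I : countType) (Ip : set I) (A : I -> set X).

Definition condenser :=
  (exists i, Ip i) /\
  (forall i, A i !=set0 /\ closed (A i)) /\
  (forall K : set X, compact K -> finite_set [set i | A i `&` K !=set0]) /\
  (forall i j, Ip i -> ~ Ip j -> A i `&` A j = set0) /\
  (exists c : R, forall i j x y, Ip i -> ~ Ip j -> A i x -> A j y ->
      (kappa x y <= c%:E)%E).

Definition vmeas := {ptws I -> meas}.

(* sum over S of the (locally finitely many nonzero) mu^i(f) *)
Definition lsum (S : set I) (mu : vmeas) (f : Cc) : R :=
  fine (\esum_(i in S) (Num.max (mu i f) 0)%:E) -
  fine (\esum_(i in S) (Num.max (- mu i f) 0)%:E).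

Definition Rmu (mu : vmeas) : meas := fun f => lsum Ip mu f - lsum (~` Ip) mu f.

Definition is_vmeas (mu : vmeas) :=
  forall i, posradon (mu i) /\ concentrated (mu i) (A i).

Definition Ep_A (mu : vmeas) := is_vmeas mu /\ finE (Rmu mu).

Variable chi : meas.

Definition Gchi (mu : vmeas) : \bar R :=
  (energy (Rmu mu) + 2%:E * menergy chi (Rmu mu))%E.

Variable g : X -> R.

(* int g d mu for mu >= 0 concentrated on the closed set A_i *)
Definition gint (nu : meas) (i : I) : \bar R :=
  ereal_sup [set (nu f)%:E | f in [set f : Cc |
     (forall x, 0 <= f x) /\ (forall x, A i x -> f x <= g x)]].

Variable a : I -> R.

Definition Ep_Aag (J : set I) (mu : vmeas) :=
  Ep_A mu /\ forall j, J j -> gint (mu j) j = (a j)%:E.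

Definition Gchi_inf (J : set I) : \bar R := ereal_inf (Gchi @` Ep_Aag J).

Definition solutions (J : set I) : set vmeas :=
  [set mu | Ep_Aag J mu /\ Gchi mu = Gchi_inf J].

End Radon.

(* Main.v *)
Require Import Defs.
From HB Require Import structures.
From mathcomp Require Import all_boot all_order all_algebra.
From mathcomp Require Import all_classical all_reals all_analysis.
From mathcomp Require Import ring lra.
Set Implicit Arguments. Unset Strict Implicit. Unset Printing Implicit Defensive.
Import Order.TTheory GRing.Theory Num.Theory numFieldNormedType.Exports.
Local Open Scope classical_set_scope.
Local Open Scope ring_scope.

(** Write mu^+ and mu^- for the sums of the positive and negative components
    of a vector measure mu, so that R mu = mu^+ - mu^-, and recall that
    G(mu) = |R mu + chi|^2 - |chi|^2 is convex.

    A bound on G bounds the energies of mu^+ and mu^- separately: the mass m of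
    mu^+ is prescribed up to a constant and kappa <= c on A^+ x A^-, so deleting
    the part of mu^- carried by the set where its potential exceeds 2cm does not
    increase |mu^+ - mu^-|, and by the maximum principle what is left has a
    bounded potential, hence a bounded mutual energy with mu^+.

    Minimizing sequences make R mu Cauchy, but not mu^+ and mu^-.  Among the
    almost minimizers one therefore selects those that almost minimize
    |mu^+|^2 + |mu^-|^2; by the parallelogram identity both parts then form
    Cauchy filters, and consistency upgrades a vague cluster point to a strong
    limit.

    The constraints int g d mu^j = a_j survive in the vague limit because no
    mass escapes: otherwise there would be unit masses on A_j of bounded energy
    tending vaguely to 0, and by the same selection argument also some tending
    strongly to 0, contradicting C(A_j) < oo.

    All minimizers share the same R mu, which gives vague compactness. *)

(** * The space C_c(X) *)

(** The obstacle is mu^-: indices outside J carry no constraint, so its total mass is not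
    controlled, and the bound c on A^+ x A^- alone says nothing about the mutual energy of mu^+ and
    mu^-. The threshold 2cm is twice the bound cm of the potential of mu^+ on A^-: on the deleted
    part the interaction with mu^+ is at most half of the interaction with mu^-, so the self-energy
    lost outweighs the attraction lost. The two parts have to be made Cauchy separately because
    consistency speaks of positive measures only.

    Since measures are functionals on C_c, the only integrals are upper integrals of l.s.c.
    functions against positive measures. A Dini argument over directed families of minorants
    supplies their additivity, and signed measures are always reduced to differences of positive
    ones. *)

Class lch (X : topologicalType) : Prop := Lch {
  lch_hausdorff : hausdorff_space X;
  lch_compact : locally_compact [set: X] }.

Section CcOperations.
Variables (R : realType) (X : topologicalType).
Context {lcX : lch X}.
Implicit Types f g h : Cc R X.

Definition csupp (F : X -> R) :=
  exists2 K, compact K & forall x, ~ K x -> F x = 0.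

Lemma csupp_compact F : csupp F -> compact (closure [set x | F x != 0]).
Proof.
move=> [K cK fK]; apply: (subclosed_compact _ cK); first exact: closed_closure.
have : closed K by apply: compact_closed => //; exact: lch_hausdorff.
rewrite closure_id => ->; apply: closureS => x /= fx.
by apply: contrapT => /fK fx0; rewrite fx0 eqxx in fx.
Qed.

Lemma csupp_cc f : csupp f.
Proof.
exists (closure [set x | f x != 0]); first exact: ccf_csupp.
move=> x nx; apply: contrapT => /eqP fx; apply: nx; exact: subset_closure.
Qed.

Lemma csupp_op2 (op : R -> R -> R) f g : op 0 0 = 0 ->
  csupp (fun x => op (f x) (g x)).
Proof.
move=> op0; have [K cK fK] := csupp_cc f; have [L cL gL] := csupp_cc g.
exists (K `|` L); first exact: compactU.
by move=> x /not_orP[/fK -> /gL ->].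
Qed.

Lemma zero_csupp : compact (closure [set x : X | (0 : R) != 0]).
Proof.
rewrite (_ : [set x | _] = set0) ?closure0; first exact: compact0.
by apply/seteqP; split => x //=; rewrite eqxx.
Qed.

Definition cc0 : Cc R X := MkCc (fun=> cvg_cst 0) zero_csupp.

(* junk value [cc0] when [F] is not in C_c *)
Definition toCc (F : X -> R) : Cc R X :=
  match pselect (continuous F /\ compact (closure [set x | F x != 0])) with
  | left h => MkCc h.1 h.2
  | right _ => cc0
  end.

Lemma toCcE F : continuous F -> csupp F -> ccf (toCc F) = F.
Proof.
move=> cF /csupp_compact sF; rewrite /toCc.
by case: pselect => // -[]; split.
Qed.

Definition ccL (a : R) f (b : R) g := toCc (fun x => a * f x + b * g x).
Definition ccM f g := toCc (fun x => f x * g x).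
Definition ccmax f g := toCc (fun x => Num.max (f x) (g x)).
Definition ccmin f g := toCc (fun x => Num.min (f x) (g x)).
(** The part (f - t)^+ above the level t, so that f - [cctr f t] is min (f, t). Intended for t >= 0:
    below 0 compact support may fail, and [toCc] then returns [cc0]. *)
Definition cctr f (t : R) := toCc (fun x => Num.max (f x - t) 0).

Lemma ccLE a f b g x : ccL a f b g x = a * f x + b * g x.
Proof.
rewrite /ccL toCcE //; last by apply: (@csupp_op2 (fun u v => a * u + b * v)); rewrite !mulr0 addr0.
move=> y; apply: (@continuousD _ _ _ (fun x => a * f x) (fun x => b * g x));
  by (apply: continuousM; [exact: cst_continuous|exact: ccf_cont]).
Qed.

Lemma ccME f g x : ccM f g x = f x * g x.
Proof.
rewrite /ccM toCcE //; last by apply: (@csupp_op2 *%R); rewrite mulr0.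
by move=> y; apply: continuousM; exact: ccf_cont.
Qed.

Lemma ccmaxE f g x : ccmax f g x = Num.max (f x) (g x).
Proof.
rewrite /ccmax toCcE //; last by apply: (@csupp_op2 Num.max); rewrite maxxx.
by move=> y; apply: continuous_max; exact: ccf_cont.
Qed.

Lemma ccminE f g x : ccmin f g x = Num.min (f x) (g x).
Proof.
rewrite /ccmin toCcE //; last by apply: (@csupp_op2 Num.min); rewrite minxx.
by move=> y; apply: continuous_min; exact: ccf_cont.
Qed.

Lemma cctrE f t x : 0 <= t -> cctr f t x = Num.max (f x - t) 0.
Proof.
move=> t0; rewrite /cctr toCcE //; last first.
  apply: (@csupp_op2 (fun u _ => Num.max (u - t) 0) f f).
  by rewrite sub0r; apply/max_idPr; rewrite oppr_le0.
move=> y; apply: (@continuous_max _ _ (fun y => f y - t) (fun=> 0));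
  last exact: cst_continuous.
by apply: continuousB; [exact: ccf_cont|exact: cst_continuous].
Qed.

Definition ccpos f := ccmax f cc0.
Definition ccabs f := ccmax f (ccL (-1) f 0 f).

Lemma ccposE f x : ccpos f x = Num.max (f x) 0.
Proof. by rewrite ccmaxE. Qed.

Lemma ccabsE f x : ccabs f x = `|f x|.
Proof. by rewrite ccmaxE ccLE mul0r addr0 mulN1r maxrN. Qed.

Lemma cc_bounded f : exists2 c : R, 0 < c & forall x, `|f x| <= c.
Proof.
have [K cK fK] := csupp_cc f.
have : \forall c \near +oo, K `<=` [set x | `|f x| <= c].
  apply: (compact_near_coveringP K).1 => // x Kx.
  have := @ccf_cont _ _ f x => /cvgr_dist_le /(_ 1 ltr01) nf.
  near=> y c; rewrite /= -[f y](subKr (f x)).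
  apply: (le_trans (ler_normB _ _)); apply: (@le_trans _ _ (`|f x| + 1)).
    by rewrite lerD2l; near: y.
  by near: c; apply: nbhs_pinfty_ge; rewrite num_real.
move=> [M [_ Mc]]; exists (Num.max (M + 1) 1).
  by rewrite lt_max ltr01 orbT.
move=> x; have [Kx|/fK ->] := pselect (K x); last first.
  by rewrite normr0 le_max ler01 orbT.
by apply: Mc Kx; rewrite lt_max ltrDl ltr01.
Unshelve. all: by end_near. Qed.

Lemma cc_bump (U : set X) x : open U -> U x -> exists f : Cc R X,
  [/\ forall y, 0 <= f y <= 1, f x = 1 & forall y, ~ U y -> f y = 0].
Proof.
move=> oU Ux; have [V] := @lch_compact X lcX x I.
rewrite within_interior ?interiorT// => Vx [cV clV].
(* The separation takes place inside the compact set V, which gives 1 - f a compact support. *)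
have : nbhs x (U `&` V) by apply: filterI => //; exact: open_nbhs_nbhs.
rewrite nbhsE => -[W [oW Wx] WUV].
have sW := @locally_compact_completely_regular X R
  (@lch_compact X lcX) (@lch_hausdorff X lcX) x
  (~` W) (open_closedC oW) (fun nW => nW Wx).
have [f [cf f01 fx fW]] := (@uniform_separatorP X R _ _).1 sW.
have fE y : 0 <= f y <= 1.
  have /f01 : range f (f y) by exists y.
  by rewrite /= in_itv.
have c1f : continuous (fun y => 1 - f y).
  by move=> y; apply: continuousB; [exact: cst_continuous|exact: cf].
have f1 y : ~ W y -> f y = 1 by move=> nWy; apply: fW; exists y.
have s1f : csupp (fun y => 1 - f y).
  exists V => // y nVy; rewrite f1 ?subrr//.
  by move=> /WUV[].
exists (toCc (fun y => 1 - f y)); rewrite toCcE //; split.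
- by move=> y; have /andP[? ?] := fE y; apply/andP; split; lra.
- by rewrite (_ : f x = 0) ?subr0//; apply: fx; exists x.
- by move=> y nUy; rewrite f1 ?subrr// => /WUV[].
Qed.

(** Directedness merges the finitely many local choices into one: the tails of S form a filter, and
    compactness is applied along it. The local hypothesis is relative to K because k may be
    continuous on K only, as g is on the sets A i. *)
Lemma dini_directed (S : set (Cc R X)) (K : set X) (k : X -> R) :
  compact K -> S !=set0 ->
  (forall f g, S f -> S g -> exists h, [/\ S h, forall x, f x <= h x &
     forall x, g x <= h x]) ->
  (forall x, K x -> exists2 f, S f & \forall y \near x, K y -> k y < f y) ->
  exists2 f, S f & forall x, K x -> k x < f x.
Proof.
move=> cK [f0 Sf0] dS Sk.
pose F := filter_from S (fun f => [set g | S g /\ forall x, f x <= g x]).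
have FF : Filter F.
  apply: filter_from_filter; first by exists f0.
  move=> f g Sf Sg; have [h [Sh fh gh]] := dS _ _ Sf Sg; exists h => //.
  move=> u /= [Su hu]; split; split => // x;
    by [exact: le_trans (fh _) (hu _)|exact: le_trans (gh _) (hu _)].
have : F [set f : Cc R X | K `<=` [set x | K x -> k x < f x]].
  apply: ((compact_near_coveringP K).1 cK _ F
    (fun (f : Cc R X) x => K x -> k x < f x)) => x Kx.
  have [f Sf kf] := Sk x Kx; near=> y g => Ky.
  have [_ fg] : S g /\ forall x, f x <= g x.
    by near: g; exists f.
  by apply: lt_le_trans (fg y); exact: (near kf y).
case=> f Sf SfK; exists f => // x Kx.
by apply: (SfK f) => //; split.
Unshelve. all: by end_near. Qed.

Lemma bump_compact (U K : set X) : open U -> compact K -> K `<=` U ->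
  exists f : Cc R X, [/\ forall y, 0 <= f y <= 1, forall x, K x -> f x = 1 &
    forall y, ~ U y -> f y = 0].
Proof.
move=> oU cK KU.
pose S := [set f : Cc R X | (forall y, 0 <= f y <= 1) /\
  forall y, ~ U y -> f y = 0].
have [|f g|x Kx|f [f01 fU] fK] := @dini_directed S K (fun=> 2^-1) cK.
- by exists cc0; split => // y; rewrite lexx ler01.
- move=> [f01 fU] [g01 gU]; exists (ccmax f g); split.
  + split=> [y|y nUy]; rewrite ccmaxE; last by rewrite fU// gU// maxxx.
    have /andP[f0 f1] := f01 y; have /andP[g0 g1] := g01 y.
    by rewrite le_max f0 ge_max f1 g1.
  + by move=> x; rewrite ccmaxE le_max lexx.
  + by move=> x; rewrite ccmaxE le_max lexx orbT.
- have [f [f01 fx fU]] := cc_bump oU (KU _ Kx); exists f => //.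
  have /cvgr_gt /(_ 2^-1) := @ccf_cont _ _ f x.
  rewrite fx invf_lt1// ltr1n => /(_ isT); exact: filterS.
(* As f > 1/2 on K, min (2f, 1) is 1 there; it is written 2f - (2f - 1)^+. *)
- exists (ccL 1 (ccL 2 f 0 f) (-1) (cctr (ccL 2 f 0 f) 1)).
  have E y : ccL 1 (ccL 2 f 0 f) (-1) (cctr (ccL 2 f 0 f) 1) y =
      Num.min (2 * f y) 1.
    by rewrite ccLE ccLE cctrE// ccLE; case: (lerP (2 * f y) 1) => ?;
      case: (lerP (2 * f y + 0 * f y - 1) 0) => ?; lra.
  split.
  + move=> y; rewrite E; have /andP[? ?] := f01 y.
    by rewrite le_min ge_min lexx ler01 orbT mulr_ge0.
  + move=> x /fK fx; rewrite E; apply/min_idPr; lra.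
  + move=> y /fU fy; rewrite E fy mulr0; apply/min_idPl; lra.
Qed.

(** With this cutoff a uniform error d on the support of f costs only [d * nu u], which is finite
    even when nu has infinite mass. *)
Lemma bump_support f : exists2 u : Cc R X, forall y, 0 <= u y <= 1 &
  forall x, f x != 0 -> u x = 1.
Proof.
have [K cK fK] := csupp_cc f.
have [u [u01 uK _]] := bump_compact openT cK (@subsetT _ K).
exists u => // x fx; apply: uK; apply: contrapT => /fK fx0.
by rewrite fx0 eqxx in fx.
Qed.

End CcOperations.

(** * Positive linear functionals on C_c(X) *)

Section Functionals.
Variables (R : realType) (X : topologicalType).
Context {lcX : lch X}.
Implicit Types (f g h u v w : Cc R X) (mu nu : meas R X) (A : set X) (a b c : R).

Lemma radonE nu f g h a b : radon nu ->
  (forall x, h x = a * f x + b * g x) -> nu h = a * nu f + b * nu g.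
Proof. by move=> [lin _]; exact: lin. Qed.

Lemma radonL nu f g a b : radon nu -> nu (ccL a f b g) = a * nu f + b * nu g.
Proof. by move=> rnu; apply: radonE => // x; rewrite ccLE. Qed.

Lemma radonZ nu f h a : radon nu -> (forall x, h x = a * f x) ->
  nu h = a * nu f.
Proof.
move=> rnu hE; rewrite (@radonE nu f f h a 0) ?mul0r ?addr0// => x.
by rewrite hE mul0r addr0.
Qed.

Lemma radon_ext nu f h : radon nu -> (forall x, h x = f x) -> nu h = nu f.
Proof.
by move=> rnu hE; rewrite (@radonZ nu f h 1) ?mul1r// => x; rewrite mul1r.
Qed.

Lemma radon_eq0 nu f : radon nu -> (forall x, f x = 0) -> nu f = 0.
Proof.
by move=> rnu f0; rewrite (@radonZ nu f f 0) ?mul0r// => x; rewrite f0 mul0r.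
Qed.

Lemma radon_sum nu (T : Type) (s : seq T) (a : T -> R) (F : T -> Cc R X) h :
  radon nu -> (forall x, h x = \sum_(i <- s) a i * F i x) ->
  nu h = \sum_(i <- s) a i * nu (F i).
Proof.
move=> rnu; elim: s h => [|i s IH] h hE.
  by rewrite big_nil radon_eq0// => x; rewrite hE big_nil.
pose h' := ccL 1 h (- a i) (F i).
have h'E x : h' x = \sum_(j <- s) a j * F j x.
  by rewrite ccLE hE big_cons mul1r mulNr addrAC subrr add0r.
rewrite big_cons -(IH h')// (@radonE nu (F i) h' h (a i) 1)// ?mul1r// => x.
by rewrite hE big_cons h'E mul1r.
Qed.

Lemma pos_radon nu : posradon nu -> radon nu. Proof. by case. Qed.

Lemma pos_ge0 nu f : posradon nu -> (forall x, 0 <= f x) -> 0 <= nu f.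
Proof. by move=> [_ pnu]; exact: pnu. Qed.

(** For closed A and positive nu this is [concentrated] ([concentratedP]), in a form that is linear
    in nu and passes directly to vague limits. *)
Definition carried nu A := forall f, (forall x, A x -> f x = 0) -> nu f = 0.

Lemma carriedT nu : radon nu -> carried nu setT.
Proof. by move=> rnu f f0; apply: radon_eq0 => // x; exact: f0. Qed.

(** The excess (f - g)^+ vanishes on A, so nu does not see it. *)
Lemma pos_le_on nu A f g : posradon nu -> carried nu A ->
  (forall x, A x -> f x <= g x) -> nu f <= nu g.
Proof.
move=> pnu cA fg; have rnu := pos_radon pnu.
pose d := cctr (ccL 1 f (-1) g) 0.
have d0 : nu d = 0.
  apply: cA => x /fg fgx; rewrite cctrE// ccLE; apply/max_idPr; lra.
pose w := ccL 1 (ccL 1 g (-1) f) 1 d.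
have : 0 <= nu w.
  apply: pos_ge0 => // x; rewrite ccLE cctrE// !ccLE.
  set t := _ - 0; have : t <= Num.max t 0 by rewrite le_max lexx.
  by rewrite /t; lra.
by rewrite radonL// radonL// d0; lra.
Qed.

Lemma pos_le nu f g : posradon nu -> (forall x, f x <= g x) -> nu f <= nu g.
Proof.
by move=> pnu fg; apply: (pos_le_on pnu (carriedT (pos_radon pnu))) => x _.
Qed.

(** The local bound in [radon] comes from positivity: if f vanishes off K then |f| <= c u for a
    cutoff u equal to 1 on K. *)
Lemma posradon_intro nu :
  (forall f g h a b, (forall x, h x = a * f x + b * g x) ->
     nu h = a * nu f + b * nu g) ->
  (forall f, (forall x, 0 <= f x) -> 0 <= nu f) -> posradon nu.
Proof.
move=> lin pos; split => //; split => // K cK.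
have [u [u01 uK _]] := @bump_compact R X _ setT K openT cK (@subsetT _ K).
exists (nu u) => f c fK fc; rewrite ler_norml.
have fu x : `|f x| <= c * u x.
  have /andP[u0 u1] := u01 x; have [Kx|nKx] := pselect (K x).
    by rewrite uK// mulr1.
  rewrite fK// normr0 mulr_ge0//.
  exact: le_trans (normr_ge0 _) (fc x).
have p1 : 0 <= nu (ccL c u 1 f).
  by apply: pos => x; rewrite ccLE; have := fu x; rewrite ler_norml; lra.
have p2 : 0 <= nu (ccL c u (-1) f).
  by apply: pos => x; rewrite ccLE; have := fu x; rewrite ler_norml; lra.
rewrite (lin u f _ c 1) in p1; last by move=> x; rewrite ccLE.
rewrite (lin u f _ c (-1)) in p2; last by move=> x; rewrite ccLE.
by apply/andP; split; lra.
Qed.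

Lemma pos_extend (T : Cc R X -> R) :
  (forall f, (forall x, 0 <= f x) -> 0 <= T f) ->
  (forall f g h, (forall x, 0 <= f x) -> (forall x, 0 <= g x) ->
     (forall x, h x = f x + g x) -> T h = T f + T g) ->
  (forall (a : R) f h, 0 <= a -> (forall x, 0 <= f x) ->
     (forall x, h x = a * f x) -> T h = a * T f) ->
  exists nu : meas R X, posradon nu /\ forall f, (forall x, 0 <= f x) ->
    nu f = T f.
Proof.
move=> T0 TD TZ.
pose neg f := ccpos (ccL (-1) f 0 f).
have negE f x : neg f x = Num.max (- f x) 0.
  by rewrite ccposE ccLE mul0r addr0 mulN1r.
have pos0 f x : 0 <= ccpos f x by rewrite ccposE le_max lexx orbT.
have neg0 f x : 0 <= neg f x by rewrite negE le_max lexx orbT.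
pose nu : meas R X := fun f => T (ccpos f) - T (neg f).
(* The value does not depend on how f is written as a difference of positive functions, since f^+ +
   v = f^- + u. *)
have key f u v : (forall x, 0 <= u x) -> (forall x, 0 <= v x) ->
    (forall x, f x = u x - v x) -> nu f = T u - T v.
  move=> u0 v0 fE; rewrite /nu.
  have : T (ccpos f) + T v = T (neg f) + T u.
    rewrite -(TD (ccpos f) v (ccL 1 (ccpos f) 1 v))//; last first.
      by move=> x; rewrite ccLE !mul1r.
    apply: TD => // x; rewrite ccLE ccposE negE fE.
    by case: lerP => ?; case: lerP => ?; lra.
  by lra.
exists nu; split; last first.
  move=> f f0; rewrite (key f f (@cc0 R X))//; last by move=> x; rewrite subr0.
  rewrite (TZ 0 (@cc0 R X) (@cc0 R X))//; last by move=> x; rewrite mul0r.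
  by rewrite mul0r subr0.
have nuZ a f h : 0 <= a -> (forall x, h x = a * f x) -> nu h = a * nu f.
  move=> a0 hE; rewrite (key h (ccL a (ccpos f) 0 f) (ccL a (neg f) 0 f)).
  - have -> : T (ccL a (ccpos f) 0 f) = a * T (ccpos f).
      by apply: TZ => // x; rewrite ccLE mul0r addr0.
    have -> : T (ccL a (neg f) 0 f) = a * T (neg f).
      by apply: TZ => // x; rewrite ccLE mul0r addr0.
    by rewrite /nu; ring.
  - by move=> x; rewrite ccLE mul0r addr0 mulr_ge0.
  - by move=> x; rewrite ccLE mul0r addr0 mulr_ge0.
  - move=> x; rewrite hE !ccLE ccposE negE.
    rewrite !mul0r !addr0 -mulrBr; congr (_ * _).
    by case: lerP => ?; case: lerP => ?; lra.
have nuN f h : (forall x, h x = - f x) -> nu h = - nu f.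
  move=> hE; rewrite (key h (neg f) (ccpos f)) ?opprB// => x.
  by rewrite hE ccposE negE; case: lerP => ?; case: lerP => ?; lra.
have nuD f g h : (forall x, h x = f x + g x) -> nu h = nu f + nu g.
  move=> hE.
  rewrite (key h (ccL 1 (ccpos f) 1 (ccpos g)) (ccL 1 (neg f) 1 (neg g))).
  - have -> : T (ccL 1 (ccpos f) 1 (ccpos g)) = T (ccpos f) + T (ccpos g).
      by apply: TD => // x; rewrite ccLE !mul1r.
    have -> : T (ccL 1 (neg f) 1 (neg g)) = T (neg f) + T (neg g).
      by apply: TD => // x; rewrite ccLE !mul1r.
    by rewrite /nu; ring.
  - by move=> x; rewrite ccLE !mul1r addr_ge0.
  - by move=> x; rewrite ccLE !mul1r addr_ge0.
  - move=> x; rewrite hE !ccLE !negE !ccposE.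
    by case: lerP => ?; case: lerP => ?; case: lerP => ?; case: lerP => ?; lra.
have nuZ' a f h : (forall x, h x = a * f x) -> nu h = a * nu f.
  move=> hE; have [a0|a0] := lerP 0 a; first exact: nuZ.
  rewrite (nuN (ccL (- a) f 0 f)); last first.
    by move=> x; rewrite hE ccLE; ring.
  rewrite (nuZ (- a) f); [by ring|by lra|].
  by move=> x; rewrite ccLE; ring.
apply: posradon_intro => [f g h a b hE|f f0].
  rewrite (nuD (ccL a f 0 f) (ccL b g 0 g)); last first.
    by move=> x; rewrite hE !ccLE !mul0r !addr0.
  rewrite (nuZ' a f (ccL a f 0 f)); last by move=> x; rewrite ccLE mul0r addr0.
  by rewrite (nuZ' b g (ccL b g 0 g))// => x; rewrite ccLE mul0r addr0.
rewrite (key f f (@cc0 R X))//; last by move=> x; rewrite subr0.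
rewrite (TZ 0 (@cc0 R X) (@cc0 R X))//; last by move=> x; rewrite mul0r.
by rewrite mul0r subr0 T0.
Qed.

Lemma concentratedP nu A : posradon nu -> closed A ->
  concentrated nu A <-> carried nu A.
Proof.
move=> pnu clA; split=> [cA f fA|cA K cK e e0]; last first.
  exists (~` A); split; first exact: closed_openC.
  split; first by move=> x [].
  move=> f _ fA; rewrite cA ?(ltW e0)// => x Ax; apply: fA => /=.
  exact.
have rnu := pos_radon pnu.
have [c c0 fc] := cc_bounded f.
suff absf : nu (ccabs f) <= 0.
  apply/eqP; rewrite eq_le; apply/andP; split.
    apply: le_trans absf; apply: pos_le => // x; rewrite ccabsE; exact: ler_norm.
  have : nu (ccL (-1) f 0 f) <= nu (ccabs f).
    apply: pos_le => // x; rewrite ccabsE ccLE -normrN mul0r addr0 mulN1r.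
    exact: ler_norm.
  by rewrite radonL//; lra.
apply/ler_addgt0Pr => e e0; rewrite add0r.
(* The compact set is the support of f: |f| / c vanishes off A-complement and off the support, hence
   off U, and is an admissible test function. *)
have [U [oU [NU Ue]]] := cA _
  (@ccf_csupp _ _ f) (e / c) (divr_gt0 e0 c0).
pose w := ccL c^-1 (ccabs f) 0 f.
have -> : nu (ccabs f) = c * nu w.
  by apply: radonZ => // x; rewrite ccLE mul0r addr0 mulrA divff ?gt_eqF// mul1r.
rewrite -ler_pdivlMl// mulrC; apply: Ue => x.
  rewrite ccLE mul0r addr0 ccabsE mulr_ge0// ?invr_ge0 ?(ltW c0)//=.
  by rewrite mulrC ler_pdivrMr// mul1r.
move=> nUx; rewrite ccLE mul0r addr0 ccabsE.
have [Ax|nAx] := pselect (A x); first by rewrite fA// normr0 mulr0.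
have [->|fx] := eqVneq (f x) 0; first by rewrite normr0 mulr0.
by exfalso; apply: nUx; apply: NU; split => //; exact: subset_closure.
Qed.

End Functionals.

(** * Upper integrals of lower semicontinuous functions *)

Section UpperIntegral.
Variables (R : realType) (X : topologicalType).
Context {lcX : lch X}.
Implicit Types (f g h u v w : Cc R X) (mu nu : meas R X) (A : set X) (a b c : R).
Implicit Types (F G : X -> \bar R).

Lemma upint_ub nu F f : (forall x, 0 <= f x) -> (forall x, ((f x)%:E <= F x)%E) ->
  ((nu f)%:E <= upint nu F)%E.
Proof. by move=> f0 fF; apply: ereal_sup_ubound; exists f. Qed.

Lemma upint_le nu F (M : \bar R) : (forall f, (forall x, 0 <= f x) ->
  (forall x, ((f x)%:E <= F x)%E) -> ((nu f)%:E <= M)%E) -> (upint nu F <= M)%E.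
Proof. by move=> H; apply: ge_ereal_sup => _ [f [f0 fF] <-]; exact: H. Qed.

Lemma upint_ge0 nu F : radon nu -> (forall x, 0 <= F x)%E -> (0 <= upint nu F)%E.
Proof.
move=> rnu F0; have -> : 0%E = (nu (@cc0 R X))%:E by rewrite radon_eq0.
by apply: upint_ub => // x; rewrite F0.
Qed.

Lemma upint_mono nu F G : (forall x, F x <= G x)%E -> (upint nu F <= upint nu G)%E.
Proof.
move=> FG; apply: upint_le => f f0 fF; apply: upint_ub => // x.
exact: le_trans (fF x) (FG x).
Qed.

Lemma upint_le_meas mu nu F : (forall f, (forall x, 0 <= f x) -> mu f <= nu f) ->
  (upint mu F <= upint nu F)%E.
Proof.
move=> mn; apply: upint_le => f f0 fF.
by apply: (@le_trans _ _ (nu f)%:E); [rewrite lee_fin; exact: mn|exact: upint_ub].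
Qed.

Lemma upint_cc nu f : posradon nu -> (forall x, 0 <= f x) ->
  upint nu (fun x => (f x)%:E) = (nu f)%:E.
Proof.
move=> pnu f0; apply/eqP; rewrite eq_le; apply/andP; split; last exact: upint_ub.
by apply: upint_le => g g0 gf; rewrite lee_fin; apply: pos_le.
Qed.

Lemma upint_eq0 nu F : radon nu -> (forall x, F x = 0)%E -> upint nu F = 0%E.
Proof.
move=> rnu F0; apply/eqP; rewrite eq_le upint_ge0// ?andbT; last first.
  by move=> x; rewrite F0.
apply: upint_le => f f0 fF; rewrite radon_eq0// => x.
by apply/eqP; rewrite eq_le f0 andbT -lee_fin; have := fF x; rewrite F0.
Qed.

(** Monotone convergence for directed families: by Dini, a minorant k of F is exceeded on its
    support within A, up to d, by a single member of S. Additivity of upper integrals follows by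
    choosing S suitably. *)
Lemma upint_dir nu A (S : set (Cc R X)) F (M : \bar R) :
  posradon nu -> closed A -> carried nu A -> S !=set0 ->
  (forall f, S f -> forall x, 0 <= f x) ->
  (forall f g, S f -> S g -> exists h, [/\ S h, forall x, f x <= h x &
     forall x, g x <= h x]) ->
  (forall x (r : R), A x -> (r%:E < F x)%E -> exists2 f, S f & r < f x) ->
  (forall f, S f -> ((nu f)%:E <= M)%E) -> (upint nu F <= M)%E.
Proof.
move=> pnu clA cA S0 Spos dS SF SM; apply: upint_le => k k0 kF.
have [u u01 uk] := bump_support k.
have nu0 : 0 <= nu u by apply: pos_ge0 => // x; have /andP[] := u01 x.
apply/lee_addgt0Pr => e e0; pose d := e / (1 + nu u).
have d0 : 0 < d by rewrite divr_gt0// ltr_pwDl.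
pose K := closure [set x | k x != 0] `&` A.
have cK : compact K by apply: compact_closedI => //; exact: ccf_csupp.
have [x [_ Ax]|f Sf kf] := @dini_directed R X S K (fun x => k x - d) cK S0 dS.
  have [|f Sf kf] := SF x (k x - d) Ax.
    by apply: lt_le_trans (kF x); rewrite lte_fin; lra.
  exists f => //.
  have cfk : {for x, continuous (fun y => f y - k y)}.
    by apply: continuousB; exact: ccf_cont.
  have /cvgr_gt /(_ (- d)) := cfk.
  have dfk : - d < f x - k x by lra.
  move=> /(_ dfk); apply: filterS => y ? _; lra.
apply: (@le_trans _ _ ((nu f)%:E + (d * nu u)%:E)%E); last first.
  apply: leeD; first exact: SM.
  rewrite lee_fin /d mulrAC ler_pdivrMr ?ltr_pwDl// ler_wpM2l ?(ltW e0)//; lra.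
rewrite -EFinD lee_fin -[nu f]mul1r -radonL; last exact: pos_radon.
apply: (pos_le_on pnu cA) => x Ax; rewrite ccLE mul1r.
have /andP[ux0 ux1] := u01 x; have fx0 := Spos _ Sf x.
have [->|kx] := eqVneq (k x) 0; first by rewrite addr_ge0// mulr_ge0// ltW.
rewrite uk// mulr1; have := kf x; rewrite /K => kfx; apply: ltW.
by rewrite -ltrBlDr; apply: kfx; split => //; exact: subset_closure.
Qed.

(** Take a bump of height s supported in the open set where F > s, with r < s < F x. *)
Lemma lsc_approx F x (r : R) : lower_semicontinuous F -> (forall y, 0 <= F y)%E ->
  (r%:E < F x)%E -> exists2 f : Cc R X, (forall y, 0 <= f y) /\
    (forall y, ((f y)%:E <= F y)%E) & r < f x.
Proof.
move=> lF F0 rF; have [r0|r0] := ltrP r 0.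
  by exists (@cc0 R X) => //; split.
have [s rs sF] : exists2 s : R, r < s & (s%:E < F x)%E.
  move: rF; case: (F x) => [t||]//.
  - by rewrite lte_fin => rt; exists ((r + t) / 2); rewrite ?lte_fin; lra.
  - by move=> _; exists (r + 1); rewrite ?ltry//; lra.
have oU : open [set y | (s%:E < F y)%E]
  by exact: ((lower_semicontinuousP F).1 lF s).
have [f [f01 fx fU]] := @cc_bump R X _ _ x oU sF.
have s0 : 0 <= s by lra.
exists (ccL s f 0 f); last by rewrite ccLE fx; lra.
split=> y; rewrite ccLE mul0r addr0; have /andP[fy0 fy1] := f01 y.
  exact: mulr_ge0.
have [Uy|nUy] := pselect ((s%:E < F y)%E); last by rewrite fU// mulr0.
apply: le_trans (ltW Uy); rewrite lee_fin -[leRHS]mulr1.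
exact: ler_wpM2l.
Qed.

Definition minorants F : set (Cc R X) :=
  [set f | (forall x, 0 <= f x) /\ forall x, ((f x)%:E <= F x)%E].

Lemma minorants_neq0 F : (forall y, 0 <= F y)%E -> minorants F !=set0.
Proof. by move=> F0; exists (@cc0 R X); split. Qed.

Lemma minorants_max F f g : minorants F f -> minorants F g ->
  exists h, [/\ minorants F h, forall x, f x <= h x & forall x, g x <= h x].
Proof.
move=> [f0 fF] [g0 gF]; exists (ccmax f g); split.
- split=> x; rewrite ccmaxE; first by rewrite le_max f0.
  by case: lerP.
- by move=> x; rewrite ccmaxE le_max lexx.
- by move=> x; rewrite ccmaxE le_max lexx orbT.
Qed.

Lemma upint_le_on nu A F G : posradon nu -> closed A -> carried nu A ->
  lower_semicontinuous G -> (forall x, 0 <= G x)%E ->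
  (forall x, A x -> (F x <= G x)%E) -> (upint nu F <= upint nu G)%E.
Proof.
move=> pnu clA cA lG G0 FG.
apply: (@upint_dir nu A (minorants G)) => //.
- exact: minorants_neq0.
- by move=> f [].
- exact: minorants_max.
- move=> x r Ax rF; have [f Gf rf] := lsc_approx lG G0 (lt_le_trans rF (FG x Ax)).
  by exists f.
- by move=> f [f0 fG]; exact: upint_ub.
Qed.

Lemma sup_addr_le (T : Type) (S S' : set T) (p q : T -> R) (M : \bar R) :
  S !=set0 -> S' !=set0 ->
  (forall s t, S s -> S' t -> ((p s + q t)%:E <= M)%E) ->
  (ereal_sup [set (p s)%:E | s in S] + ereal_sup [set (q t)%:E | t in S'] <= M)%E.
Proof.
move=> [s0 Ss0] [t0 S't0] H; case: M H => [M||] H; last 2 first.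
- by rewrite leey.
- by have := H _ _ Ss0 S't0; rewrite leeNy_eq.
have H1 s : S s ->
    (ereal_sup [set (q t)%:E | t in S'] <= (M - p s)%:E)%E.
  move=> Ss; apply: ge_ereal_sup => _ [t S't <-].
  by rewrite lee_fin; have := H _ _ Ss S't; rewrite lee_fin; lra.
have q0 : ((q t0)%:E <= ereal_sup [set (q t)%:E | t in S'])%E.
  by apply: ereal_sup_ubound; exists t0.
move: H1 q0; case: (ereal_sup [set (q t)%:E | t in S']) => [b||] H1 q0.
- rewrite -leeBrDr//; apply: ge_ereal_sup => _ [s Ss <-].
  by have := H1 s Ss; rewrite -EFinB !lee_fin; lra.
- by have := H1 _ Ss0; rewrite leye_eq.
- by rewrite leeNy_eq in q0.
Qed.

Lemma elt_split (r : R) (s t : \bar R) : (0 <= s)%E -> (0 <= t)%E ->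
  (r%:E < s + t)%E -> exists p q : R, [/\ (p%:E < s)%E, (q%:E < t)%E & r <= p + q].
Proof.
case: s => [s||]//; case: t => [t||]// s0 t0.
- rewrite -EFinD lte_fin => rst; exists (s - (s + t - r) / 2), (t - (s + t - r) / 2).
  by split; rewrite ?lte_fin; lra.
- move=> _; exists (s - 1), (r - s + 1).
  by split; rewrite ?ltry ?lte_fin//; lra.
- move=> _; exists (r - t + 1), (t - 1).
  by split; rewrite ?ltry ?lte_fin//; lra.
- by move=> _; exists r, 0; split; rewrite ?ltry//; lra.
Qed.

Lemma upintD nu F G : posradon nu ->
  lower_semicontinuous F -> (forall x, 0 <= F x)%E ->
  lower_semicontinuous G -> (forall x, 0 <= G x)%E ->
  upint nu (fun x => F x + G x)%E = (upint nu F + upint nu G)%E.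
Proof.
move=> pnu lF F0 lG G0; apply/eqP; rewrite eq_le; apply/andP; split; last first.
  apply: sup_addr_le; [exact: minorants_neq0|exact: minorants_neq0|].
  move=> f g [f0 fF] [g0 gG].
  have -> : nu f + nu g = nu (ccL 1 f 1 g).
    by rewrite radonL ?mul1r//; exact: pos_radon.
  apply: upint_ub => x; rewrite ccLE !mul1r; first exact: addr_ge0.
  by rewrite EFinD leeD.
pose S := [set ccL 1 f 1 g | f in minorants F & g in minorants G].
have rnu := pos_radon pnu.
apply: (@upint_dir nu setT S) => //.
- exact: carriedT.
- have [f Ff] := minorants_neq0 F0; have [g Gg] := minorants_neq0 G0.
  by exists (ccL 1 f 1 g); exists f => //; exists g.
- by move=> _ [f [f0 _] [g [g0 _] <-]] x; rewrite ccLE !mul1r addr_ge0.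
- move=> _ _ [f Ff [g Gg <-]] [f' Ff' [g' Gg' <-]].
  have [k [Fk fk f'k]] := minorants_max Ff Ff'.
  have [l [Gl gl g'l]] := minorants_max Gg Gg'.
  exists (ccL 1 k 1 l); split; first by exists k => //; exists l.
  + by move=> x; rewrite !ccLE !mul1r lerD.
  + by move=> x; rewrite !ccLE !mul1r lerD.
- move=> x r _ /(elt_split (F0 x) (G0 x))[p [q [pF qG rpq]]].
  have [f Ff pf] := lsc_approx lF F0 pF; have [g Gg qg] := lsc_approx lG G0 qG.
  exists (ccL 1 f 1 g); first by exists f => //; exists g.
  by rewrite ccLE; lra.
- move=> _ [f [f0 fF] [g [g0 gG] <-]]; rewrite radonL// !mul1r EFinD.
  by apply: leeD; exact: upint_ub.
Qed.

Definition madd mu nu : meas R X := fun f => mu f + nu f.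
Definition mscal c nu : meas R X := fun f => c * nu f.
(** The measure with density u with respect to nu. *)
Definition mmul u nu : meas R X := fun f => nu (ccM u f).

Lemma posradon_madd mu nu : posradon mu -> posradon nu -> posradon (madd mu nu).
Proof.
move=> pmu pnu; apply: posradon_intro.
  move=> f g h a b hE; rewrite /madd (radonE (pos_radon pmu) hE).
  by rewrite (radonE (pos_radon pnu) hE); ring.
by move=> f f0; rewrite addr_ge0// pos_ge0.
Qed.

Lemma posradon_mscal c nu : 0 <= c -> posradon nu -> posradon (mscal c nu).
Proof.
move=> c0 pnu; apply: posradon_intro.
  by move=> f g h a b hE; rewrite /mscal (radonE (pos_radon pnu) hE); ring.
by move=> f f0; rewrite mulr_ge0// pos_ge0.
Qed.

Lemma posradon_mmul u nu : (forall x, 0 <= u x) -> posradon nu ->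
  posradon (mmul u nu).
Proof.
move=> u0 pnu; apply: posradon_intro.
  move=> f g h a b hE; rewrite /mmul; apply: radonE; first exact: pos_radon.
  by move=> x; rewrite !ccME hE; ring.
by move=> f f0; apply: (@pos_ge0 _ _ nu) => // x; rewrite ccME mulr_ge0.
Qed.

Lemma upint_madd mu nu F : posradon mu -> posradon nu -> (forall x, 0 <= F x)%E ->
  upint (madd mu nu) F = (upint mu F + upint nu F)%E.
Proof.
move=> pmu pnu F0; apply/eqP; rewrite eq_le; apply/andP; split.
  by apply: upint_le => f f0 fF; rewrite EFinD leeD// upint_ub.
apply: sup_addr_le; [exact: minorants_neq0|exact: minorants_neq0|].
move=> f g Ff Fg; have [h [[h0 hF] fh gh]] := minorants_max Ff Fg.
apply: (@le_trans _ _ (madd mu nu h)%:E); last exact: upint_ub.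
by rewrite lee_fin; apply: lerD; exact: pos_le.
Qed.

Lemma upint_mscal c nu F : 0 <= c -> posradon nu -> (forall x, 0 <= F x)%E ->
  upint (mscal c nu) F = (c%:E * upint nu F)%E.
Proof.
move=> c0 pnu F0; have rnu := pos_radon pnu.
have le_scale d mu : posradon mu -> 0 <= d ->
    (upint (mscal d mu) F <= d%:E * upint mu F)%E.
  move=> pmu d0; apply: upint_le => f f0 fF.
  by rewrite /mscal EFinM lee_wpmul2l ?lee_fin// upint_ub.
apply/eqP; rewrite eq_le le_scale//=.
have [->|cn0] := eqVneq c 0.
  by rewrite mul0e upint_ge0//; apply: pos_radon; exact: posradon_mscal.
have cp : 0 < c by rewrite lt_neqAle eq_sym cn0.
have := le_scale c^-1 (mscal c nu) (posradon_mscal c0 pnu).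
rewrite invr_ge0 => /(_ c0).
have -> : mscal c^-1 (mscal c nu) = nu.
  by apply/funext => f; rewrite /mscal mulrA mulVf ?mul1r.
move=> /(lee_wpmul2l _); move=> /(_ c%:E); rewrite lee_fin => /(_ c0).
by rewrite muleA -EFinM divff// mul1e.
Qed.

Lemma upint_mmul u nu F : posradon nu -> (forall x, 0 <= u x) ->
  lower_semicontinuous F -> (forall x, 0 <= F x)%E ->
  upint (mmul u nu) F = upint nu (fun x => (u x)%:E * F x)%E.
Proof.
move=> pnu u0 lF F0; apply/eqP; rewrite eq_le; apply/andP; split.
  apply: upint_le => f f0 fF; apply: upint_ub => x; rewrite ccME.
    exact: mulr_ge0.
  by rewrite EFinM lee_wpmul2l ?lee_fin.
apply: (@upint_dir nu setT (ccM u @` minorants F)) => //.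
- exact/carriedT/pos_radon.
- by have [f Ff] := minorants_neq0 F0; exists (ccM u f); exists f.
- by move=> _ [f [f0 _] <-] x; rewrite ccME mulr_ge0.
- move=> _ _ [f Ff <-] [g Fg <-].
  have [h [Fh fh gh]] := minorants_max Ff Fg.
  exists (ccM u h); split; first by exists h.
  + by move=> x; rewrite !ccME ler_wpM2l.
  + by move=> x; rewrite !ccME ler_wpM2l.
- move=> x r _; have [->|ux] := eqVneq (u x) 0.
    rewrite mul0e lte_fin => r0; have [f Ff] := minorants_neq0 F0.
    exists (ccM u f); first by exists f.
    by rewrite ccME; apply: lt_le_trans r0 _; rewrite mulr_ge0//; case: Ff.
  have up : 0 < u x by rewrite lt_neqAle eq_sym ux u0.
  rewrite muleC -lte_pdivrMr// => rF; have [f Ff rf] := lsc_approx lF F0 rF.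
  exists (ccM u f); first by exists f.
  by rewrite ccME mulrC -ltr_pdivrMr.
- by move=> _ [f [f0 fF] <-]; apply: (@upint_ub (mmul u nu)).
Qed.

End UpperIntegral.

(** * Restriction to closed sets and the positive part of a signed measure *)

Section RestrictionPositivePart.
Variables (R : realType) (X : topologicalType).
Context {lcX : lch X}.
Implicit Types (f g h u v w : Cc R X) (mu nu : meas R X) (A D U : set X).
Implicit Types (F G : X -> \bar R) (a b c : R).

Lemma upintZ nu c F : radon nu -> 0 <= c -> (forall x, 0 <= F x)%E ->
  upint nu (fun x => c%:E * F x)%E = (c%:E * upint nu F)%E.
Proof.
move=> rnu c0 F0.
have [->|cn0] := eqVneq c 0.
  by rewrite mul0e; apply: upint_eq0 => // x; rewrite mul0e.
have cp : 0 < c by rewrite lt_neqAle eq_sym cn0.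
have leZ d G : 0 < d -> (d%:E * upint nu G <= upint nu (fun x => d%:E * G x))%E.
  move=> d0; rewrite -lee_pdivlMl//; apply: upint_le => f f0 fG.
  rewrite lee_pdivlMl// -EFinM -(@radonZ _ _ nu f (ccL d f 0 f))//; last first.
    by move=> x; rewrite ccLE mul0r addr0.
  apply: upint_ub => x; rewrite ccLE mul0r addr0; first by rewrite mulr_ge0// ltW.
  by rewrite EFinM lee_wpmul2l// lee_fin ltW.
apply/eqP; rewrite eq_le leZ// andbT.
have ci : 0 < c^-1 by rewrite invr_gt0.
have := leZ _ (fun x => c%:E * F x)%E ci.
rewrite [X in (_ <= X)%E -> _](_ : _ = upint nu F); last first.
  by congr upint; apply/funext => x; rewrite muleA -EFinM mulVf// mul1e.
by rewrite lee_pdivrMl.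
Qed.

Lemma lsc_cc f : lower_semicontinuous (fun x => (f x)%:E).
Proof.
move=> x a; rewrite lte_fin => afx.
have /cvgr_gt /(_ a afx) := @ccf_cont _ _ f x.
by move=> n; exists [set y | a < f y].
Qed.

Definition rst U F : X -> \bar R := fun x => if `[< U x >] then F x else 0%E.

Lemma rst_ge0 U F : (forall x, 0 <= F x)%E -> forall x, (0 <= rst U F x)%E.
Proof. by move=> F0 x; rewrite /rst; case: ifP. Qed.

Lemma lsc_rst U F : open U -> lower_semicontinuous F -> (forall x, 0 <= F x)%E ->
  lower_semicontinuous (rst U F).
Proof.
move=> oU lF F0 x a; rewrite {1}/rst; case: asboolP => [Ux aF|nUx a0].
  have [V Vx VF] := lF x a aF; exists (V `&` U).
    by apply: filterI => //; exact: open_nbhs_nbhs.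
  by move=> y [Vy Uy]; rewrite /rst; case: asboolP => // _; exact: VF.
exists setT; first exact: filterT.
by move=> y _; apply: lt_le_trans (rst_ge0 _ F0 y).
Qed.

(** Multiplying by the indicator of an open set preserves lower semicontinuity, so the restriction
    to the complement of D is built first, as an upper integral; the restriction to D is the
    difference. *)
Lemma restrict_closed nu D : posradon nu -> closed D -> exists nuU nuD,
  [/\ posradon nuU, posradon nuD, nu = madd nuU nuD, carried nuD D &
    forall f, (forall x, 0 <= f x) ->
      (nuU f)%:E = upint nu (rst (~` D) (fun x => (f x)%:E))].
Proof.
move=> pnu clD; have oU : open (~` D) by exact: closed_openC.
have rnu := pos_radon pnu.
pose I f := upint nu (rst (~` D) (fun x => (f x)%:E)).
have I0 f : (forall x, 0 <= f x) -> (0 <= I f)%E.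
  by move=> f0; apply: upint_ge0 => //; apply: rst_ge0 => x; rewrite lee_fin.
have Ile f : (forall x, 0 <= f x) -> (I f <= (nu f)%:E)%E.
  move=> f0; rewrite -upint_cc//; apply: upint_mono => x.
  by rewrite /rst; case: ifP; rewrite lee_fin.
have Ifin f : (forall x, 0 <= f x) -> I f \is a fin_num.
  move=> f0; rewrite ge0_fin_numE ?I0//; apply: le_lt_trans (Ile _ f0) (ltry _).
have [|f g h f0 g0 hE|a f h a0 f0 hE|nuU [pU UE]] :=
    @pos_extend R X _ (fun f => fine (I f)).
- by move=> f f0; apply: fine_ge0; exact: I0.
- rewrite -fineD ?Ifin//; congr fine; rewrite /I -upintD//.
  + congr upint; apply/funext => x; rewrite /rst.
    by case: ifP => _; rewrite ?hE ?adde0// EFinD.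
  + by apply: lsc_rst => //; exact: lsc_cc.
  + by apply: rst_ge0 => x; rewrite lee_fin.
  + by apply: lsc_rst => //; exact: lsc_cc.
  + by apply: rst_ge0 => x; rewrite lee_fin.
- rewrite -[a in RHS]/(fine a%:E) -fineM ?Ifin//; congr fine; rewrite /I -upintZ//.
  + congr upint; apply/funext => x; rewrite /rst.
    by case: ifP => _; rewrite ?hE ?mule0// EFinM.
  + by apply: rst_ge0 => x; rewrite lee_fin.
have UE' f : (forall x, 0 <= f x) -> (nuU f)%:E = I f.
  by move=> f0; rewrite UE// fineK// Ifin.
exists nuU, (fun f => nu f - nuU f); split => //.
- apply: posradon_intro => [f g h a b hE|f f0].
    by rewrite (radonE rnu hE) (radonE (pos_radon pU) hE); ring.
  by rewrite subr_ge0 -lee_fin UE'// Ile.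
- by apply/funext => f; rewrite /madd addrC subrK.
- pose nuD : meas R X := fun f => nu f - nuU f.
  have pD : posradon nuD.
    apply: posradon_intro => [f g h a b hE|f f0]; rewrite /nuD.
      by rewrite (radonE rnu hE) (radonE (pos_radon pU) hE); ring.
    by rewrite subr_ge0 -lee_fin UE'// Ile.
  have cpos f : (forall x, 0 <= f x) -> (forall x, D x -> f x = 0) -> nuD f = 0.
    move=> f0 fD; rewrite /nuD; apply/eqP; rewrite subr_eq0; apply/eqP.
    apply: EFin_inj; rewrite UE'// /I -upint_cc//; congr upint.
    apply/funext => x; rewrite /rst; case: asboolP => // /contrapT Dx.
    by rewrite fD.
  move=> f fD; rewrite -/(nuD f).
  rewrite (@radonE _ _ nuD (ccpos f) (ccpos (ccL (-1) f 0 f)) f 1 (-1)).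
  + rewrite cpos ?cpos ?mulr0 ?addr0// => x; rewrite ccposE ?le_max ?lexx ?orbT//.
      by move=> Dx; rewrite ccLE fD// !mulr0 addr0 maxxx.
    by move=> Dx; rewrite fD// maxxx.
  + exact: pos_radon.
  + move=> x; rewrite !ccposE ccLE; case: lerP => ?; case: lerP => ?; lra.
Qed.

(** Riesz: f |-> sup { sg g : 0 <= g <= f } is additive on the positive cone. Upper integrals
    against a signed measure, as they occur in the energy, thereby become upper integrals against a
    positive one. *)
Lemma pospart (sg : meas R X) : radon sg -> exists s : meas R X,
  [/\ posradon s, forall F, upint sg F = upint s F &
    forall f, (forall x, 0 <= f x) -> sg f <= s f].
Proof.
move=> rs; pose I f := upint sg (fun x => (f x)%:E).
have I0 f : (forall x, 0 <= f x) -> (0 <= I f)%E.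
  by move=> f0; apply: upint_ge0 => // x; rewrite lee_fin.
have Ifin f : (forall x, 0 <= f x) -> I f \is a fin_num.
  move=> f0; rewrite ge0_fin_numE ?I0//.
  have [K cK fK] := csupp_cc f; have [M HM] := rs.2 K cK.
  have [c c0 fc] := cc_bounded f.
  apply: (@le_lt_trans _ _ (M * c)%:E); last exact: ltry.
  apply: upint_le => g g0 gf; rewrite lee_fin; apply: le_trans (ler_norm _) _.
  apply: HM => x; first move=> nKx.
    apply/eqP; rewrite eq_le g0 andbT -(fK x nKx) -lee_fin; exact: gf.
  rewrite ger0_norm//; apply: le_trans (fc x); rewrite ger0_norm// -lee_fin.
  exact: gf.
have [|f g h f0 g0 hE|a f h a0 f0 hE|s [ps sE]] :=
    @pos_extend R X _ (fun f => fine (I f)).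
- by move=> f f0; apply: fine_ge0; exact: I0.
- have h0 x : 0 <= h x by rewrite hE addr_ge0.
  apply: EFin_inj; rewrite EFinD !fineK ?Ifin//.
  apply/eqP; rewrite eq_le; apply/andP; split; last first.
    apply: sup_addr_le; [exact: minorants_neq0|exact: minorants_neq0|].
    move=> k l [k0 kf] [l0 lg]; rewrite -[sg k]mul1r -[sg l]mul1r -radonL//.
    apply: upint_ub => x; rewrite ccLE !mul1r; first exact: addr_ge0.
    by rewrite hE !EFinD leeD.
  apply: upint_le => k k0 kh.
  (* Riesz decomposition: a k between 0 and f + g is the sum of min (k, f) <= f and a remainder
     between 0 and g. *)
  pose k1 := ccmin k f; pose k2 := ccL 1 k (-1) k1.
  rewrite (@radonE _ _ sg k1 k2 k 1 1)//; last first.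
    by move=> x; rewrite ccLE; ring.
  rewrite !mul1r EFinD; apply: leeD; apply: upint_ub => x.
  + by rewrite ccminE le_min k0 f0.
  + by rewrite lee_fin ccminE ge_min lexx orbT.
  + by rewrite ccLE ccminE; case: (lerP (k x) (f x)) => ?; lra.
  + rewrite lee_fin ccLE ccminE; have := kh x; rewrite lee_fin hE => ?.
    by have := g0 x; case: (lerP (k x) (f x)) => ?; lra.
- apply: EFin_inj; rewrite EFinM !fineK ?Ifin//; last first.
    by move=> x; rewrite hE mulr_ge0.
  rewrite -upintZ//; congr upint; apply/funext => x; by rewrite hE EFinM.
have sE' f : (forall x, 0 <= f x) -> (s f)%:E = I f.
  by move=> f0; rewrite sE// fineK// Ifin.
exists s; split => //.
- move=> F; apply/eqP; rewrite eq_le; apply/andP; split.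
    apply: upint_le_meas => f f0; rewrite -lee_fin sE'//.
    exact: upint_ub.
  apply: upint_le => f f0 fF; rewrite sE'//; exact: upint_mono.
- by move=> f f0; rewrite -lee_fin sE'//; exact: upint_ub.
Qed.

End RestrictionPositivePart.

(** * Potentials and Fubini's theorem *)

Lemma finite_subcover (X : topologicalType) (K : set X) (V : X -> set X) :
  compact K -> (forall x, K x -> nbhs x (V x)) ->
  exists s : seq X, forall z, K z -> exists2 i, i \in s & V i z.
Proof.
move=> cK KV.
pose F := filter_from setT (fun s : seq X => [set t : seq X | {subset s <= t}]).
have FF : Filter F.
  apply: filter_from_filter; first by exists [::].
  move=> s t _ _; exists (s ++ t) => // r str.
  by split=> x xs; apply: str; rewrite mem_cat xs ?orbT.
have : F [set s : seq X | K `<=` [set z | exists2 i, i \in s & V i z]].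
  apply: ((compact_near_coveringP K).1 cK _ F
    (fun (s : seq X) z => exists2 i, i \in s & V i z)) => x Kx.
  exists (V x, [set t : seq X | {subset [:: x] <= t}]).
    by split => /=; [exact: KV|exists [:: x]].
  by move=> [z t] /= [Vz xt]; exists x => //; apply: xt; rewrite inE.
by move=> [s _ sK]; exists s; exact: sK.
Qed.

Section Potential.
Variables (R : realType) (X : topologicalType).
Context {lcX : lch X}.
Implicit Types (f g h u v w : Cc R X) (mu nu p q : meas R X).
Variable kappa : X -> X -> \bar R.
Hypothesis hk : kernel_basic kappa.

(** For positive measures [kpot] is [pot], and [en] is the only part of the energy that does not
    vanish. *)
Definition kpot nu x := upint nu (kappa x).
Definition en p q := upint p (kpot q).

Let k0 x y : (0 <= kappa x y)%E. Proof. by have [] := hk. Qed.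
Let ksym x y : kappa x y = kappa y x. Proof. by have [_ []] := hk. Qed.

Lemma kpot_ge0 nu x : radon nu -> (0 <= kpot nu x)%E.
Proof. by move=> rnu; apply: upint_ge0. Qed.

(** A minorant of kappa x, lowered by d, stays below kappa z for all z near x, because kappa is
    jointly l.s.c. and the minorant has compact support. Besides the lower semicontinuity of
    potentials this gives one g for a whole neighbourhood, which the exchange of integrals needs. *)
Lemma kpot_local nu x (r : R) : posradon nu -> (r%:E < kpot nu x)%E ->
  exists g, [/\ forall y, 0 <= g y,
    \forall z \near x, forall y, ((g y)%:E <= kappa z y)%E & r < nu g].
Proof.
move=> pnu /ereal_sup_gt[_ [g0 [g0p g0k] <-]]; rewrite lte_fin => rg0.
have [u u01 ug] := bump_support g0.
have nu0 : 0 <= nu u by apply: pos_ge0 => // y; have /andP[] := u01 y.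
have nu1 : 0 < 1 + nu u by rewrite ltr_pwDl.
(* Chosen so that the loss d nu(u) is smaller than the margin nu(g0) - r. *)
pose d := (nu g0 - r) / (1 + nu u).
have d0 : 0 < d by rewrite divr_gt0// subr_gt0.
exists (cctr g0 d); split.
- by move=> y; rewrite cctrE ?(ltW d0)// le_max lexx orbT.
- pose K := closure [set y | g0 y != 0].
  have : \forall z \near x, K `<=` [set y | ((g0 y - d)%:E < kappa z y)%E].
    apply: (compact_near_coveringP K).1; first exact: ccf_csupp.
    move=> y Ky; have [_ [_ klsc]] := hk.
    have lt1 : ((g0 y - d / 2)%:E < kappa (x, y).1 (x, y).2)%E.
      by apply: lt_le_trans (g0k y); rewrite lte_fin; lra.
    have [[V W] /= [Vx Wy] VW] := klsc (x, y) _ lt1.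
    have /cvgr_lt /(_ (g0 y + d / 2)) := @ccf_cont _ _ g0 y.
    have lt2 : g0 y < g0 y + d / 2 by lra.
    move=> /(_ lt2) W'.
    exists (W `&` [set t | g0 t < g0 y + d / 2], V); first by split; [exact: filterI|].
    move=> [y' x'] /= [[Wy' lt3] Vx'].
    by apply: le_lt_trans (VW (x', y') (conj Vx' Wy')); rewrite lee_fin; lra.
  apply: filterS => z Kz y; rewrite cctrE ?(ltW d0)//.
  have [->|gy] := eqVneq (g0 y) 0.
    rewrite (_ : Num.max _ _ = 0)//; apply/max_idPr; lra.
  case: lerP => // _; apply: ltW; apply: Kz; exact: subset_closure.
- have : nu (ccL 1 g0 (- d) u) <= nu (cctr g0 d).
    apply: pos_le => // y; rewrite ccLE cctrE ?(ltW d0)//.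
    have /andP[uy0 _] := u01 y.
    have [->|gy] := eqVneq (g0 y) 0.
      by rewrite le_max; apply/orP; right; rewrite mulr0 add0r mulNr oppr_le0 mulr_ge0// ltW.
    by rewrite ug// le_max; apply/orP; left; lra.
  rewrite radonL; last exact: pos_radon.
  apply: lt_le_trans; rewrite mul1r mulNr ltrBrDr -ltrBrDl.
  rewrite /d mulrAC ltr_pdivrMr// ltr_pM2l ?subr_gt0//; lra.
Qed.

Lemma lsc_kpot nu : posradon nu -> lower_semicontinuous (kpot nu).
Proof.
move=> pnu x a /(kpot_local pnu)[g [g0 gk ag]].
exists [set z | forall y, ((g y)%:E <= kappa z y)%E] => // z gz.
apply: (@lt_le_trans _ _ (nu g)%:E); first by rewrite lte_fin.
exact: upint_ub.
Qed.

Lemma cc_sum (T : Type) (s : seq T) (a : T -> R) (F : T -> Cc R X) :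
  exists w, forall x, w x = \sum_(i <- s) a i * F i x.
Proof.
elim: s => [|i s [w wE]]; first by exists (@cc0 R X) => x; rewrite big_nil.
by exists (ccL (a i) (F i) 1 w) => x; rewrite big_cons ccLE wE mul1r.
Qed.

(* A partition of unity replaces the kernel by a finite sum of products, for
   which the order of integration does not matter. *)
Lemma en_le_sym p q : posradon p -> posradon q -> (en p q <= en q p)%E.
Proof.
move=> pp pq; have rp := pos_radon pp; have rq := pos_radon pq.
apply: upint_le => f f0 fk.
have [u u01 uf] := bump_support f.
have pu0 : 0 <= p u by apply: pos_ge0 => // y; have /andP[] := u01 y.
apply/lee_addgt0Pr => e e0; pose d := e / (1 + p u).
have d0 : 0 < d by rewrite divr_gt0// ltr_pwDl.
(* Where its second factor lives, the first factor of the pair lies below the kernel and has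
   q-integral greater than f - d. *)
have loc x : exists gh : Cc R X * Cc R X, [/\ forall y, 0 <= gh.1 y,
    forall y, 0 <= gh.2 y <= 1, gh.2 x = 1 &
    forall z, gh.2 z != 0 -> (forall y, ((gh.1 y)%:E <= kappa z y)%E) /\
      f z - d < q gh.1].
  have [|g [g0 gk qg]] := @kpot_local q x (f x - d / 2) pq.
    by apply: lt_le_trans (fk x); rewrite lte_fin; lra.
  have nf : \forall z \near x, f z < f x + d / 2.
    have /cvgr_lt /(_ (f x + d / 2)) := @ccf_cont _ _ f x; apply; lra.
  have : nbhs x ([set z | forall y, ((g y)%:E <= kappa z y)%E] `&`
      [set z | f z < f x + d / 2]) by exact: filterI.
  rewrite nbhsE => -[W [oW Wx] WP].
  have [h [h01 hx hW]] := @cc_bump R X _ W x oW Wx.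
  exists (g, h); split => //= z hz.
  have /WP[? /= ?] : W z by apply: contrapT => /hW /eqP; apply/negP.
  by split => //; lra.
have [GH GHP] := choice loc.
pose G x := (GH x).1; pose H x := (GH x).2.
have G0 x y : 0 <= G x y by have [] := GHP x.
have H01 x y : 0 <= H x y <= 1 by have [] := GHP x.
have Hx x : H x x = 1 by have [] := GHP x.
have GHk x z : H x z != 0 -> (forall y, ((G x y)%:E <= kappa z y)%E) /\ f z - d < q (G x).
  by have [_ _ _] := GHP x; exact.
pose K := closure [set x | f x != 0].
have cK : compact K by exact: ccf_csupp.
have [x Kx|s Ks] := @finite_subcover X K (fun x => [set z | 2^-1 < H x z]) cK.
  have /cvgr_gt /(_ 2^-1) := @ccf_cont _ _ (H x) x; apply.
  rewrite Hx; lra.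
have [w wE] := @cc_sum X s (fun=> 1) H.
have wE' x : w x = \sum_(i <- s) H i x.
  by rewrite wE; apply: eq_bigr => i _; rewrite mul1r.
(* Truncating at 1/2 keeps the quotient continuous. On the support of f one has w >= 1/2, so the P i
   sum to exactly 1 there and to at most 1 elsewhere. *)
pose den x := Num.max (w x) 2^-1.
have den0 x : 0 < den x by rewrite lt_max invr_gt0 ltr0n orbT.
have cden : continuous (fun x => (den x)^-1).
  move=> x; apply: continuousV; first by rewrite gt_eqF.
  apply: (@continuous_max _ _ (fun y => w y) (fun=> 2^-1)); first exact: ccf_cont.
  exact: cst_continuous.
pose P i := toCc (fun x => H i x * (den x)^-1).
have PE i x : P i x = H i x / den x.
  rewrite /P toCcE//.
    by move=> y; apply: continuousM; [exact: ccf_cont|exact: cden].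
  have [L cL HL] := csupp_cc (H i); exists L => // y /HL ->; exact: mul0r.
have P0 i x : 0 <= P i x.
  by rewrite PE divr_ge0// ?(ltW (den0 x))//; have /andP[] := H01 i x.
have Psum x : \sum_(i <- s) P i x = w x / den x.
  by rewrite wE' mulr_suml; apply: eq_bigr => i _; rewrite PE.
have Psum_le1 x : \sum_(i <- s) P i x <= 1.
  by rewrite Psum ler_pdivrMr// mul1r /den le_max lexx.
have PsumK x : f x != 0 -> \sum_(i <- s) P i x = 1.
  move=> fx; rewrite Psum /den.
  have Kx : K x by exact: subset_closure.
  have [i Di /= Hi] := Ks x Kx.
  have wx : 2^-1 <= w x.
    apply: le_trans (ltW Hi) _; rewrite wE'.
    rewrite (big_rem i)//= lerDl sumr_ge0// => j _; by have /andP[] := H01 j x.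
  rewrite max_l// divff// gt_eqF//; lra.
have PH i x : P i x != 0 -> H i x != 0.
  by apply: contra => /eqP Hi; rewrite PE Hi mul0r.
have [v vE] := @cc_sum X s (fun i => q (G i)) P.
have qG0 i : 0 <= q (G i) by apply: pos_ge0.
have fv : p f <= p (ccL 1 v d u).
  apply: pos_le => // x; rewrite ccLE mul1r vE.
  have /andP[ux0 _] := u01 x.
  have v0 : 0 <= \sum_(i <- s) q (G i) * P i x.
    by apply: sumr_ge0 => i _; exact: mulr_ge0.
  have [->|fx] := eqVneq (f x) 0; first by rewrite addr_ge0// mulr_ge0// ltW.
  rewrite uf// mulr1 -lerBlDr -[leLHS]mulr1 -(PsumK x fx) mulr_sumr.
  apply: ler_sum => i _; have [->|Pi] := eqVneq (P i x) 0; first by rewrite !mulr0.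
  by rewrite ler_wpM2r//; have [_ /ltW] := GHk _ _ (PH _ _ Pi).
have [w' w'E] := @cc_sum X s (fun i => p (P i)) G.
have pP0 i : 0 <= p (P i) by apply: pos_ge0.
(* The finite sum of the P i (x) G i (y) lies below kappa x y. Integrated in either order it gives
   the sum of the p (P i) q (G i), which [fv] compares with p f. *)
have qw' : ((q w')%:E <= en q p)%E.
  apply: upint_ub => y; rewrite w'E.
    by apply: sumr_ge0 => i _; exact: mulr_ge0.
  have [t tE] := @cc_sum X s (fun i => G i y) P.
  have -> : \sum_(i <- s) p (P i) * G i y = p t.
    rewrite (@radon_sum _ _ _ p X s (fun i => G i y) P t)//.
    by apply: eq_bigr => i _; rewrite mulrC.
  apply: upint_ub => x; rewrite tE.
    by apply: sumr_ge0 => i _; exact: mulr_ge0.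
  rewrite ksym; have := k0 x y.
  have kP i : P i x != 0 -> ((G i y)%:E <= kappa x y)%E.
    by move=> Pi; have [] := GHk _ _ (PH _ _ Pi).
  move: kP; case: (kappa x y) => [k||]// kP; last by move=> _; rewrite leey.
  rewrite !lee_fin => k00; apply: (@le_trans _ _ (\sum_(i <- s) k * P i x)).
    apply: ler_sum => i _; have [->|Pi] := eqVneq (P i x) 0; first by rewrite !mulr0.
    by rewrite ler_wpM2r// -lee_fin kP.
  rewrite -mulr_sumr -[leRHS]mulr1; exact: ler_wpM2l.
apply: (@le_trans _ _ ((q w')%:E + (d * p u)%:E)%E); last first.
  apply: leeD => //; rewrite lee_fin /d mulrAC ler_pdivrMr ?ltr_pwDl//.
  by rewrite ler_wpM2l ?(ltW e0)//; lra.
rewrite -EFinD lee_fin; apply: le_trans fv _.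
rewrite radonL// mul1r lerD2r.
rewrite (@radon_sum _ _ _ p X s (fun i => q (G i)) P v)//.
rewrite (@radon_sum _ _ _ q X s (fun i => p (P i)) G w')//.
by rewrite le_eqVlt; apply/orP; left; apply/eqP; apply: eq_bigr => i _; rewrite mulrC.
Qed.

Lemma en_sym p q : posradon p -> posradon q -> en p q = en q p.
Proof. by move=> pp pq; apply/eqP; rewrite eq_le !en_le_sym. Qed.

Lemma en_ge0 p q : radon p -> radon q -> (0 <= en p q)%E.
Proof. by move=> rp rq; apply: upint_ge0 => // x; exact: kpot_ge0. Qed.

Lemma en_maddl p p' q : posradon p -> posradon p' -> posradon q ->
  en (madd p p') q = (en p q + en p' q)%E.
Proof.
by move=> ? ? pq; apply: upint_madd => // x; apply: kpot_ge0; exact: pos_radon.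
Qed.

Lemma en_maddr p p' q : posradon p -> posradon p' -> posradon q ->
  en q (madd p p') = (en q p + en q p')%E.
Proof.
move=> pp pp' pq; rewrite en_sym//; last exact: posradon_madd.
by rewrite en_maddl// en_sym// (en_sym pp' pq).
Qed.

Lemma en_mscall (c : R) p q : 0 <= c -> posradon p -> posradon q ->
  en (mscal c p) q = (c%:E * en p q)%E.
Proof.
by move=> ? ? ?; apply: upint_mscal => // x; apply: kpot_ge0; exact: pos_radon.
Qed.

Lemma en_mscalr (c : R) p q : 0 <= c -> posradon p -> posradon q ->
  en q (mscal c p) = (c%:E * en q p)%E.
Proof.
move=> c0 pp pq; rewrite en_sym//; last exact: posradon_mscal.
by rewrite en_mscall// en_sym.
Qed.

Lemma en_le p p' q q' : (forall f, (forall x, 0 <= f x) -> p f <= p' f) ->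
  (forall f, (forall x, 0 <= f x) -> q f <= q' f) -> (en p q <= en p' q')%E.
Proof.
move=> pp qq; apply: (@le_trans _ _ (en p' q)); first exact: upint_le_meas.
by apply: upint_mono => x; exact: upint_le_meas.
Qed.

End Potential.

(** * The pre-Hilbert space of measures of finite energy *)

Section JordanParts.
Variables (R : realType) (X : topologicalType).
Context {lcX : lch X}.
Implicit Types (f g h u v w : Cc R X) (mu nu p q sg tau : meas R X).
Implicit Types (F G : X -> \bar R) (a b c : R).

Lemma radon_mopp nu : radon nu -> radon (mopp nu).
Proof.
move=> rnu; split=> [f g h a b hE|K cK].
  by rewrite /mopp (radonE rnu hE); ring.
have [M HM] := rnu.2 K cK; exists M => f c fK fc; rewrite normrN; exact: HM.
Qed.

Lemma radon_msub mu nu : radon mu -> radon nu -> radon (msub mu nu).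
Proof.
move=> rmu rnu; split=> [f g h a b hE|K cK].
  by rewrite /msub (radonE rmu hE) (radonE rnu hE); ring.
have [M HM] := rmu.2 K cK; have [N HN] := rnu.2 K cK.
exists (M + N) => f c fK fc; rewrite mulrDl; apply: le_trans (ler_normB _ _) _.
by apply: lerD; [exact: HM|exact: HN].
Qed.

Lemma mopp_msub mu nu : mopp (msub mu nu) = msub nu mu.
Proof. by apply/funext => f; rewrite /mopp /msub opprB. Qed.

Lemma upint_mopp nu F : posradon nu -> (forall x, 0 <= F x)%E ->
  upint (mopp nu) F = 0%E.
Proof.
move=> pnu F0; apply/eqP; rewrite eq_le; apply/andP; split.
  by apply: upint_le => f f0 _; rewrite lee_fin oppr_le0 pos_ge0.
by apply: upint_ge0 => //; apply: radon_mopp; exact: pos_radon.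
Qed.

(** Here r is the common part (the infimum) of p and q; what is left of each is a Jordan part of p -
    q. *)
Lemma jordan p q : posradon p -> posradon q -> exists s s' r : meas R X,
  [/\ posradon s, posradon s' & posradon r] /\
  [/\ p = madd s r, q = madd s' r,
   forall F, upint (msub p q) F = upint s F &
   forall F, upint (msub q p) F = upint s' F].
Proof.
move=> pp pq; have rp := pos_radon pp; have rq := pos_radon pq.
have [s [ps sE sle]] := pospart (radon_msub rp rq).
have [s' [ps' s'E s'le]] := pospart (radon_msub rq rp).
have rs := pos_radon ps; have rs' := pos_radon ps'.
have s_ub (t m n : meas R X) f (M : R) : posradon t ->
    (forall F, upint (msub m n) F = upint t F) -> (forall x, 0 <= f x) ->
    (forall g, (forall x, 0 <= g x) -> (forall x, g x <= f x) -> m g - n g <= M) ->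
    t f <= M.
  move=> pt tE f0 H; rewrite -lee_fin -upint_cc// -tE; apply: upint_le => g g0 gf.
  by rewrite lee_fin; apply: H => // x; rewrite -lee_fin.
have sp f : (forall x, 0 <= f x) -> s f <= p f.
  move=> f0; apply: (s_ub s p q) => // g g0 gf.
  have pgf : p g <= p f by exact: pos_le.
  by have := pos_ge0 pq g0; lra.
(* For 0 <= g <= f one has (p - q)(f - g) <= s (f - g) <= s f, that is (q - p) g <= s f - (p - q)
   f. *)
have ss'1 f : (forall x, 0 <= f x) -> s' f <= s f - (p f - q f).
  move=> f0; apply: (s_ub s' q p) => // g g0 gf.
  have := sle (ccL 1 f (-1) g); rewrite /msub !radonL// => /(_ _).
  have fg0 x : 0 <= ccL 1 f (-1) g x by rewrite ccLE; have := gf x; lra.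
  move=> /(_ fg0).
  have : s (ccL 1 f (-1) g) <= s f.
    by apply: pos_le => // x; rewrite ccLE; have := g0 x; lra.
  by rewrite radonL//; lra.
have ss'2 f : (forall x, 0 <= f x) -> s f <= s' f - (q f - p f).
  move=> f0; apply: (s_ub s p q) => // g g0 gf.
  have := s'le (ccL 1 f (-1) g); rewrite /msub !radonL// => /(_ _).
  have fg0 x : 0 <= ccL 1 f (-1) g x by rewrite ccLE; have := gf x; lra.
  move=> /(_ fg0).
  have : s' (ccL 1 f (-1) g) <= s' f.
    by apply: pos_le => // x; rewrite ccLE; have := g0 x; lra.
  by rewrite radonL//; lra.
have ss'pos f : (forall x, 0 <= f x) -> s f - s' f = p f - q f.
  move=> f0; apply/eqP; rewrite eq_le; have := ss'1 f f0; have := ss'2 f f0.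
  by move=> ? ?; apply/andP; split; lra.
have ss' f : s f - s' f = p f - q f.
  have f1 x : 0 <= ccpos f x by rewrite ccposE le_max lexx orbT.
  have f2 x : 0 <= ccpos (ccL (-1) f 0 f) x by rewrite ccposE le_max lexx orbT.
  have fE x : f x = 1 * ccpos f x + (-1) * ccpos (ccL (-1) f 0 f) x.
    rewrite !ccposE ccLE; case: lerP => ?; case: lerP => ?; lra.
  rewrite (radonE rs fE) (radonE rs' fE) (radonE rp fE) (radonE rq fE).
  by have := ss'pos _ f1; have := ss'pos _ f2; lra.
exists s, s', (fun f => p f - s f); split; first split => //.
  apply: posradon_intro => [f g h a b hE|f f0].
    by rewrite (radonE rp hE) (radonE rs hE); ring.
  by rewrite subr_ge0 sp.
split => //; apply/funext => f; rewrite /madd; first by ring.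
by have := ss' f; lra.
Qed.

End JordanParts.

(** * The energy as a positive bilinear form *)

Section EnergySpace.
Variables (R : realType) (X : topologicalType).
Context {lcX : lch X}.
Implicit Types (f g h : Cc R X) (mu nu p q u v sg tau : meas R X) (a b c : R).
Variable kappa : X -> X -> \bar R.
Hypothesis hk : kernel_basic kappa.
Hypothesis hpd : strictly_pd kappa.
Local Notation en := (en kappa).

Definition Ep p := posradon p /\ (en p p < +oo)%E.
Definition ee p q : R := fine (en p q).

Let k0 x y : (0 <= kappa x y)%E. Proof. by have [] := hk. Qed.

Lemma finEpP nu : finEp kappa nu <-> Ep nu.
Proof.
split=> [[pnu [rnu fin]]|[pnu fin]].
  by split => //; have := fin true true; rewrite ge0_fin_numE// en_ge0.
have rnu := pos_radon pnu; split => //; split => // -[] [].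
- by rewrite ge0_fin_numE// en_ge0.
- rewrite /penergy /= upint_eq0// => x; exact: upint_mopp.
- by rewrite /penergy /= upint_mopp// => x; exact: kpot_ge0.
- rewrite /penergy /= upint_mopp// => x; rewrite upint_mopp//.
Qed.

Lemma Ep_pos p : Ep p -> posradon p. Proof. by case. Qed.
Hint Resolve Ep_pos : core.

Lemma Ep_le p q : posradon p -> Ep q ->
  (forall f, (forall x, 0 <= f x) -> p f <= q f) -> Ep p.
Proof. by move=> pp [_ qfin] pq; split => //; apply: le_lt_trans qfin; exact: en_le. Qed.

Lemma maddl_le p q f : posradon q -> (forall x, 0 <= f x) -> p f <= madd p q f.
Proof. by move=> pq f0; rewrite /madd lerDl pos_ge0. Qed.

Lemma maddr_le p q f : posradon p -> (forall x, 0 <= f x) -> q f <= madd p q f.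
Proof. by move=> pp f0; rewrite /madd lerDr pos_ge0. Qed.

(** Positive definiteness forces this: the self-energies of the Jordan parts s, s' of p - q are
    finite, so the energy of p - q is defined, and an infinite mutual energy of s and s' would make
    it -oo. The other terms involve the common part r, which lies below both p and q, and are
    bounded by a self-energy. *)
Lemma en_fin p q : Ep p -> Ep q -> (en p q < +oo)%E.
Proof.
move=> Epp Epq; have [s [s' [r [[ps ps' pr] [pE qE sE s'E]]]]] :=
  jordan (Ep_pos Epp) (Ep_pos Epq).
have sp f : (forall x, 0 <= f x) -> s f <= p f.
  by rewrite pE => f0; exact: maddl_le.
have rp f : (forall x, 0 <= f x) -> r f <= p f.
  by rewrite pE => f0; exact: maddr_le.
have s'q f : (forall x, 0 <= f x) -> s' f <= q f.
  by rewrite qE => f0; exact: maddl_le.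
have rq f : (forall x, 0 <= f x) -> r f <= q f.
  by rewrite qE => f0; exact: maddr_le.
have fle t t' w (H : Ep w) : (forall f, (forall x, 0 <= f x) -> t f <= w f) ->
    (forall f, (forall x, 0 <= f x) -> t' f <= w f) -> (en t t' < +oo)%E.
  by move=> tw t'w; apply: le_lt_trans H.2; exact: en_le.
have rs := radon_msub (pos_radon (Ep_pos Epp)) (pos_radon (Ep_pos Epq)).
have pen : [/\ penergy kappa (msub p q) (msub p q) true true = en s s,
    penergy kappa (msub p q) (msub p q) false false = en s' s',
    penergy kappa (msub p q) (msub p q) true false = en s s' &
    penergy kappa (msub p q) (msub p q) false true = en s' s].
  rewrite /penergy /= !mopp_msub !sE !s'E.
  by split; congr upint; apply/funext => x; rewrite ?sE ?s'E.
have [pen1 pen2 pen3 pen4] := pen.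
have ss'fin : (en s s' < +oo)%E.
  have ssfin : en s s \is a fin_num.
    rewrite ge0_fin_numE; [exact: (fle _ _ _ Epp sp sp)|apply: en_ge0 => //; exact: pos_radon].
  have s's'fin : en s' s' \is a fin_num.
    rewrite ge0_fin_numE; [exact: (fle _ _ _ Epq s'q s'q)|apply: en_ge0 => //; exact: pos_radon].
  have dfn : energy_defined kappa (msub p q).
    rewrite /energy_defined pen1 pen2 => -[+ _].
    by apply/eqP; rewrite -(fineK ssfin) -(fineK s's'fin) -EFinD.
  have := hpd.1 _ rs dfn; rewrite /energy /menergy pen1 pen2 pen3 pen4.
  rewrite ltey; apply: contraTneq => ->.
  have s's0 : (0 <= en s' s)%E by apply: en_ge0 => //; exact: pos_radon.
  rewrite addye; last by rewrite gt_eqF// (lt_le_trans (ltNyr 0) s's0).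
  by rewrite -(fineK ssfin) -(fineK s's'fin) -EFinD.
rewrite pE qE en_maddl ?en_maddr//; last exact: posradon_madd.
rewrite !lte_add_pinfty//.
- exact: (fle _ _ _ Epp sp rp).
- exact: (fle _ _ _ Epq rq s'q).
- exact: (fle _ _ _ Epp rp rp).
Qed.

Lemma enE p q : Ep p -> Ep q -> en p q = (ee p q)%:E.
Proof.
move=> hp hq; rewrite fineK// ge0_fin_numE ?en_fin// en_ge0//; by apply: pos_radon; auto.
Qed.

Lemma ee_ge0 p q : Ep p -> Ep q -> 0 <= ee p q.
Proof. by move=> hp hq; apply/fine_ge0/en_ge0 => //; apply: pos_radon; auto. Qed.

Lemma ee_sym p q : Ep p -> Ep q -> ee p q = ee q p.
Proof. by move=> hp hq; congr fine; apply: en_sym; auto. Qed.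

Lemma Ep_madd p q : Ep p -> Ep q -> Ep (madd p q).
Proof.
move=> hp hq; have pp := Ep_pos hp; have pq := Ep_pos hq.
split; first exact: posradon_madd.
rewrite en_maddl ?en_maddr//; last exact: posradon_madd.
by rewrite !enE// -!EFinD ltry.
Qed.

Lemma Ep_mscal c p : 0 <= c -> Ep p -> Ep (mscal c p).
Proof.
move=> c0 hp; have pp := Ep_pos hp; split; first exact: posradon_mscal.
rewrite en_mscall ?en_mscalr//; last exact: posradon_mscal.
by rewrite enE// -!EFinM ltry.
Qed.
Hint Resolve Ep_madd Ep_mscal : core.

Lemma ee_maddl p q u : Ep p -> Ep q -> Ep u -> ee (madd p q) u = ee p u + ee q u.
Proof.
by move=> hp hq hu; apply: EFin_inj; rewrite EFinD -!enE//; auto; apply: en_maddl; auto.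
Qed.

Lemma ee_maddr p q u : Ep p -> Ep q -> Ep u -> ee u (madd p q) = ee u p + ee u q.
Proof.
by move=> hp hq hu; apply: EFin_inj; rewrite EFinD -!enE//; auto; apply: en_maddr; auto.
Qed.

Lemma ee_mscall c p u : 0 <= c -> Ep p -> Ep u -> ee (mscal c p) u = c * ee p u.
Proof.
by move=> c0 hp hu; apply: EFin_inj; rewrite EFinM -!enE//; auto; apply: en_mscall; auto.
Qed.

Lemma ee_mscalr c p u : 0 <= c -> Ep p -> Ep u -> ee u (mscal c p) = c * ee u p.
Proof.
by move=> c0 hp hu; apply: EFin_inj; rewrite EFinM -!enE//; auto; apply: en_mscalr; auto.
Qed.

Lemma Ep_jordan p q : Ep p -> Ep q -> exists s s' r : meas R X,
  [/\ Ep s, Ep s' & Ep r] /\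
  [/\ p = madd s r, q = madd s' r,
   forall F, upint (msub p q) F = upint s F &
   forall F, upint (msub q p) F = upint s' F].
Proof.
move=> hp hq; have [s [s' [r [[ps ps' pr] [pE qE sE s'E]]]]] :=
  jordan (Ep_pos hp) (Ep_pos hq).
exists s, s', r; split=> //; split.
- by apply: (Ep_le ps hp) => f f0; rewrite pE; exact: maddl_le.
- by apply: (Ep_le ps' hq) => f f0; rewrite qE; exact: maddl_le.
- by apply: (Ep_le pr hp) => f f0; rewrite pE; exact: maddr_le.
Qed.

(** The common parts cancel, so the value given by the Jordan parts can be computed from any
    representations p - q and u - v. Bilinearity of the energy rests on this. *)
Lemma menergy_msub p q u v : Ep p -> Ep q -> Ep u -> Ep v ->
  menergy kappa (msub p q) (msub u v) =
    (ee p u + ee q v - ee p v - ee q u)%:E /\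
  forall s t, penergy kappa (msub p q) (msub u v) s t \is a fin_num.
Proof.
move=> hp hq hu hv.
have [s [s' [r [[hs hs' hr] [pE qE sE s'E]]]]] := Ep_jordan hp hq.
have [t [t' [w [[ht ht' hw] [uE vE tE t'E]]]]] := Ep_jordan hu hv.
have pen : [/\ penergy kappa (msub p q) (msub u v) true true = (ee s t)%:E,
    penergy kappa (msub p q) (msub u v) false false = (ee s' t')%:E,
    penergy kappa (msub p q) (msub u v) true false = (ee s t')%:E &
    penergy kappa (msub p q) (msub u v) false true = (ee s' t)%:E].
  rewrite -!enE// /penergy /= !mopp_msub !sE !s'E.
  by split; congr upint; apply/funext => x; rewrite ?tE ?t'E.
have [pen1 pen2 pen3 pen4] := pen; split.
  rewrite /menergy pen1 pen2 pen3 pen4 -!EFinD; congr EFin.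
  rewrite pE qE uE vE.
  rewrite !ee_maddl ?ee_maddr; auto.
  by ring.
by case; case; rewrite ?pen1 ?pen2 ?pen3 ?pen4.
Qed.

Lemma finE_msub p q : Ep p -> Ep q -> finE kappa (msub p q).
Proof.
move=> hp hq; split; last by have [] := menergy_msub hp hq hp hq.
by apply: radon_msub; apply: pos_radon; auto.
Qed.

Lemma finE_decomp sg : finE kappa sg -> exists p q, [/\ Ep p, Ep q & sg = msub p q].
Proof.
move=> [rs fin].
have [s [ps sE sle]] := pospart rs.
have [s' [ps' s'E s'le]] := pospart (radon_mopp rs).
have hs : Ep s.
  split => //; have := fin true true; rewrite /penergy /= sE.
  rewrite (_ : (fun x => upint sg (kappa x)) = kpot kappa s); last first.
    by apply/funext => x; rewrite sE.
  by rewrite ge0_fin_numE//; apply: en_ge0 => //; exact: pos_radon.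
have hs' : Ep s'.
  split => //; have := fin false false; rewrite /penergy /= s'E.
  rewrite (_ : (fun x => upint (mopp sg) (kappa x)) = kpot kappa s'); last first.
    by apply/funext => x; rewrite s'E.
  by rewrite ge0_fin_numE//; apply: en_ge0 => //; exact: pos_radon.
exists s, s'; split => //.
have s_ub (t m : meas R X) f (M : R) : posradon t ->
    (forall F, upint m F = upint t F) -> (forall x, 0 <= f x) ->
    (forall g, (forall x, 0 <= g x) -> (forall x, g x <= f x) -> m g <= M) ->
    t f <= M.
  move=> pt tE f0 H; rewrite -lee_fin -upint_cc// -tE; apply: upint_le => g g0 gf.
  by rewrite lee_fin; apply: H => // x; rewrite -lee_fin.
have rss := pos_radon ps; have rss' := pos_radon ps'.
have rm := radon_mopp rs.
have key f : (forall x, 0 <= f x) -> sg f = s f - s' f.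
  move=> f0.
  have h1 : s' f <= s f - sg f.
    apply: (s_ub s' (mopp sg)) => // g g0 gf.
    have fg0 x : 0 <= ccL 1 f (-1) g x by rewrite ccLE; have := gf x; lra.
    have := sle _ fg0; have : s (ccL 1 f (-1) g) <= s f.
      by apply: pos_le => // x; rewrite ccLE; have := g0 x; lra.
    by rewrite !radonL// /mopp; lra.
  have h2 : s f <= s' f + sg f.
    apply: (s_ub s sg) => // g g0 gf.
    have fg0 x : 0 <= ccL 1 f (-1) g x by rewrite ccLE; have := gf x; lra.
    have := s'le _ fg0; have : s' (ccL 1 f (-1) g) <= s' f.
      by apply: pos_le => // x; rewrite ccLE; have := g0 x; lra.
    by rewrite !radonL// /mopp; lra.
  by lra.
apply/funext => f; rewrite /msub.
have f1 x : 0 <= ccpos f x by rewrite ccposE le_max lexx orbT.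
have f2 x : 0 <= ccpos (ccL (-1) f 0 f) x by rewrite ccposE le_max lexx orbT.
have fE x : f x = 1 * ccpos f x + (-1) * ccpos (ccL (-1) f 0 f) x.
  rewrite !ccposE ccLE; case: lerP => ?; case: lerP => ?; lra.
rewrite (radonE rs fE) (radonE rss fE) (radonE rss' fE) !key//; ring.
Qed.

Definition ipE sg tau : R := fine (menergy kappa sg tau).
Definition mlin a sg b tau : meas R X := fun f => a * sg f + b * tau f.

Lemma ipE_msub p q u v : Ep p -> Ep q -> Ep u -> Ep v ->
  ipE (msub p q) (msub u v) = ee p u + ee q v - ee p v - ee q u.
Proof. by move=> hp hq hu hv; rewrite /ipE (menergy_msub hp hq hu hv).1. Qed.

Lemma menergyE sg tau : finE kappa sg -> finE kappa tau ->
  menergy kappa sg tau = (ipE sg tau)%:E.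
Proof.
move=> /finE_decomp[p [q [hp hq ->]]] /finE_decomp[u [v [hu hv ->]]].
by rewrite ipE_msub// (menergy_msub hp hq hu hv).1.
Qed.

Lemma ipE_sym sg tau : finE kappa sg -> finE kappa tau -> ipE sg tau = ipE tau sg.
Proof.
move=> /finE_decomp[p [q [hp hq ->]]] /finE_decomp[u [v [hu hv ->]]].
rewrite !ipE_msub// (ee_sym hp hu) (ee_sym hq hv) (ee_sym hp hv) (ee_sym hq hu).
ring.
Qed.

Lemma ipE_ge0 sg : finE kappa sg -> 0 <= ipE sg sg.
Proof.
move=> fs; rewrite -lee_fin -menergyE//; apply: hpd.1; first by case: fs.
have [_ fin] := fs => -[+ _].
by rewrite -(fineK (fin true true)) -(fineK (fin false false)) -EFinD.
Qed.

Lemma ipE_mlinl a sg b tau rho : finE kappa sg -> finE kappa tau -> finE kappa rho ->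
  finE kappa (mlin a sg b tau) /\
  ipE (mlin a sg b tau) rho = a * ipE sg rho + b * ipE tau rho.
Proof.
move=> /finE_decomp[p [q [hp hq ->]]] /finE_decomp[u [v [hu hv ->]]].
move=> /finE_decomp[s [t [hs ht ->]]].
(* [Ep] admits only nonnegative multiples; negative coefficients exchange the roles of p and q, or
   of u and v. *)
pose a1 := Num.max a 0; pose a2 := Num.max (- a) 0.
pose b1 := Num.max b 0; pose b2 := Num.max (- b) 0.
have [a10 a20] : 0 <= a1 /\ 0 <= a2 by rewrite !le_max lexx !orbT.
have [b10 b20] : 0 <= b1 /\ 0 <= b2 by rewrite !le_max lexx !orbT.
have aE : a = a1 - a2 by rewrite /a1 /a2; case: lerP => ?; case: lerP => ?; lra.
have bE : b = b1 - b2 by rewrite /b1 /b2; case: lerP => ?; case: lerP => ?; lra.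
pose P := madd (madd (mscal a1 p) (mscal a2 q)) (madd (mscal b1 u) (mscal b2 v)).
pose Q := madd (madd (mscal a1 q) (mscal a2 p)) (madd (mscal b1 v) (mscal b2 u)).
have hP : Ep P by rewrite /P; auto 10.
have hQ : Ep Q by rewrite /Q; auto 10.
have -> : mlin a (msub p q) b (msub u v) = msub P Q.
  by apply/funext => f; rewrite /mlin /msub /P /Q /madd /mscal aE bE; ring.
split; first exact: finE_msub.
rewrite !ipE_msub// /P /Q !ee_maddl; auto 10.
by rewrite !ee_mscall; auto; rewrite aE bE; ring.
Qed.

Lemma finE_mlin a sg b tau : finE kappa sg -> finE kappa tau ->
  finE kappa (mlin a sg b tau).
Proof. by move=> hs ht; have [] := ipE_mlinl a b hs ht hs. Qed.

Lemma ipE_linl a sg b tau rho : finE kappa sg -> finE kappa tau -> finE kappa rho ->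
  ipE (mlin a sg b tau) rho = a * ipE sg rho + b * ipE tau rho.
Proof. by move=> hs ht hr; have [] := ipE_mlinl a b hs ht hr. Qed.

Lemma ipE_linr a sg b tau rho : finE kappa sg -> finE kappa tau -> finE kappa rho ->
  ipE rho (mlin a sg b tau) = a * ipE rho sg + b * ipE rho tau.
Proof.
move=> hs ht hr; rewrite ipE_sym ?ipE_linl//; last exact: finE_mlin.
by rewrite (ipE_sym hr hs) (ipE_sym hr ht).
Qed.

Lemma ipE_quad a sg b tau : finE kappa sg -> finE kappa tau ->
  ipE (mlin a sg b tau) (mlin a sg b tau) =
    a ^+ 2 * ipE sg sg + 2 * a * b * ipE sg tau + b ^+ 2 * ipE tau tau.
Proof.
move=> hs ht; have hl := finE_mlin a b hs ht.
by rewrite ipE_linl// !ipE_linr// (ipE_sym ht hs); ring.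
Qed.

(** Positivity of the energy of s sg - tau, divided by s. It stands in for the Cauchy-Schwarz
    inequality without square roots. *)
Lemma ipE_young s sg tau : finE kappa sg -> finE kappa tau -> 0 < s ->
  2 * ipE sg tau <= s * ipE sg sg + ipE tau tau / s.
Proof.
move=> hs ht s0; have := ipE_ge0 (finE_mlin s (-1) hs ht).
rewrite ipE_quad// => H; rewrite -subr_ge0.
have -> : s * ipE sg sg + ipE tau tau / s - 2 * ipE sg tau =
    (s ^+ 2 * ipE sg sg + 2 * s * -1 * ipE sg tau + (-1) ^+ 2 * ipE tau tau) / s.
  by field; rewrite gt_eqF.
by rewrite divr_ge0// ltW.
Qed.

Lemma Ep_finE p : Ep p -> finE kappa p.
Proof. by move=> /finEpP[]. Qed.

Lemma ipE_Ep p q : Ep p -> Ep q -> ipE p q = ee p q.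
Proof.
move=> hp hq; have pp := Ep_pos hp; have pq := Ep_pos hq.
have rp := pos_radon pp.
rewrite /ipE /menergy /penergy /=.
rewrite (upint_mopp pp); last first.
  by move=> x; apply: upint_ge0 => //; apply: radon_mopp; exact: pos_radon.
rewrite (upint_mopp pp); last first.
  by move=> x; apply: upint_ge0 => //; exact: pos_radon.
rewrite (@upint_eq0 _ _ p (fun x => upint (mopp q) (kappa x)))//; last first.
  by move=> x; exact: upint_mopp.
by rewrite !adde0 oppe0 adde0.
Qed.

Lemma snorm_lt sg (r : R) : finE kappa sg -> 0 < r ->
  (snorm kappa sg < r) = (ipE sg sg < r ^+ 2).
Proof.
move=> hs r0; rewrite /snorm /energy -/(ipE sg sg).
by rewrite -[X in _ < X = _](gtr0_norm r0) -sqrtr_sqr ltr_sqrt// exprn_gt0.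
Qed.

End EnergySpace.

(** * Strong and vague convergence *)

Section PointwiseTopology.
Variables (I : Type) (V : topologicalType).

Lemma ptws_cvg (F : set_system {ptws I -> V}) (f : {ptws I -> V}) : Filter F ->
  (forall i, (fun g : {ptws I -> V} => g i) @ F --> f i) -> F --> f.
Proof.
move=> FF Ff; apply/cvg_sup => i U [/= _ [[W /= oW <- /= Wfi]]] /filterS.
by apply; apply: Ff; exact: open_nbhs_nbhs.
Qed.

End PointwiseTopology.

Section StrongVague.
Variables (R : realType) (X : topologicalType).
Context {lcX : lch X}.
Implicit Types (f g h : Cc R X) (mu nu p q u v sg tau : meas R X) (a b c : R).
Variable kappa : X -> X -> \bar R.
Hypothesis hk : kernel_basic kappa.
Hypothesis hpd : strictly_pd kappa.
Local Notation Ep := (Ep kappa).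
Local Notation ipE := (ipE kappa).
Local Notation ee := (ee kappa).

Let k0 x y : (0 <= kappa x y)%E. Proof. by have [] := hk. Qed.

Definition mdirac x : meas R X := fun f => f x.

(** Otherwise the Dirac mass at x would be a nonzero measure of zero energy. *)
Lemma kappa_diag_gt0 x : (0 < kappa x x)%E.
Proof.
rewrite ltNge; apply/negP => kx.
have pd : posradon (mdirac x).
  by apply: posradon_intro => [f g h a b hE|f f0]; [exact: hE|exact: f0].
have udirac F : (upint (mdirac x) F <= F x)%E by apply: upint_le => f _ fF; exact: fF.
have en0 : (en kappa (mdirac x) (mdirac x) <= 0)%E.
  by apply: le_trans (udirac _) _; apply: le_trans (udirac _) _.
have Ed : Ep (mdirac x) by split => //; exact: le_lt_trans en0 _.
have fd := Ep_finE hk Ed.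
have e0 : energy kappa (mdirac x) = 0%E.
  rewrite /energy (menergyE hk hpd fd fd) (ipE_Ep hk Ed Ed); congr EFin.
  apply/eqP; rewrite eq_le (ee_ge0 hk Ed Ed) andbT -lee_fin -(enE hk hpd Ed Ed).
  exact: en0.
have [f [_ fx _]] := @cc_bump R X _ setT x openT I.
have := hpd.2 _ fd e0 f; rewrite /mdirac fx => /eqP; by rewrite oner_eq0.
Qed.

(** By lower semicontinuity kappa >= E > 0 on U x U for some neighbourhood U of each point, so a
    bump H in U satisfies E q(H)^2 <= energy of q. Finitely many bumps dominate f. This is what
    makes sets of bounded energy vaguely relatively compact. *)
Lemma strong_vague_bound f (M : R) : exists C : R, forall q, Ep q -> ee q q <= M ->
  `|q f| <= C.
Proof.
have loc x : exists he : Cc R X * R, [/\ forall y, 0 <= he.1 y <= 1, he.1 x = 1,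
    0 < he.2 & forall y z, he.1 y != 0 -> he.1 z != 0 -> (he.2%:E <= kappa y z)%E].
  have [e e0 ex] : exists2 e : R, 0 < e & (e%:E < kappa x x)%E.
    have := kappa_diag_gt0 x; case: (kappa x x) => [t||]//.
    - by rewrite lte_fin => t0; exists (t / 2); rewrite ?lte_fin; lra.
    - by move=> _; exists 1; rewrite ?ltry.
  have [_ [_ klsc]] := hk.
  have [[V W] /= [Vx Wx] VW] := klsc (x, x) e%:E ex.
  have : nbhs x (V `&` W) by exact: filterI.
  rewrite nbhsE => -[U [oU Ux] UVW].
  have [h [h01 hx hU]] := @cc_bump R X _ U x oU Ux.
  exists (h, e); split => //= y z hy hz.
  have Uy : U y by apply: contrapT => /hU /eqP; apply/negP.
  have Uz : U z by apply: contrapT => /hU /eqP; apply/negP.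
  by apply: ltW; apply: (VW (y, z)); split => /=; [have [] := UVW _ Uy|have [] := UVW _ Uz].
have [HE HEP] := choice loc.
pose H x := (HE x).1; pose E x := (HE x).2.
have H01 x y : 0 <= H x y <= 1 by have [] := HEP x.
have Hx x : H x x = 1 by have [] := HEP x.
have E0 x : 0 < E x by have [] := HEP x.
have HE' x y z : H x y != 0 -> H x z != 0 -> ((E x)%:E <= kappa y z)%E.
  by have [_ _ _] := HEP x; exact.
have [c c0 fc] := cc_bounded f.
pose K := closure [set x | f x != 0].
have cK : compact K by exact: ccf_csupp.
have [x Kx|s Ks] := @finite_subcover X K (fun x => [set z | 2^-1 < H x z]) cK.
  have /cvgr_gt /(_ 2^-1) := @ccf_cont _ _ (H x) x; apply.
  rewrite Hx; lra.
(* Some H i exceeds 1/2 at each point of the support, hence the factor 2c; and q(H) <= 1 + q(H)^2 <=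
   1 + M / E. *)
exists (\sum_(i <- s) (2 * c) * (1 + M / E i)) => q hq qM.
have pq := Ep_pos hq; have rq := pos_radon pq.
have qH i : 0 <= q (H i) <= 1 + M / E i.
  have qH0 : 0 <= q (H i) by apply: pos_ge0 => // y; have /andP[] := H01 i y.
  rewrite qH0 /=.
  suff : E i * q (H i) ^+ 2 <= M.
    rewrite mulrC -ler_pdivlMr// => H1; apply: le_trans (lerD (lexx 1) H1).
    by have := sqr_ge0 (q (H i) - 1); lra.
  apply: le_trans qM; rewrite -lee_fin -(enE hk hpd hq hq).
  have -> : E i * q (H i) ^+ 2 = q (ccL (E i * q (H i)) (H i) 0 (H i)).
    by rewrite radonL//; ring.
  have EH0 y : 0 <= E i * H i y by rewrite mulr_ge0 ?(ltW (E0 i))//; have /andP[] := H01 i y.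
  apply: upint_ub => y; rewrite ccLE mul0r addr0 mulrAC; first exact: mulr_ge0.
  have [->|Hy] := eqVneq (H i y) 0.
    by rewrite mulr0 mul0r; apply: kpot_ge0.
  apply: (@le_trans _ _ (q (ccL (E i) (H i) 0 (H i)))%:E).
    rewrite lee_fin radonL// mul0r addr0 mulrAC.
    rewrite -[leRHS]mulr1 ler_wpM2l ?mulr_ge0 ?(ltW (E0 i))//.
    by have /andP[] := H01 i y.
  apply: upint_ub => z; rewrite ccLE mul0r addr0//.
  have [->|Hz] := eqVneq (H i z) 0; first by rewrite mulr0 k0.
  apply: le_trans (HE' _ _ _ Hy Hz); rewrite lee_fin -[leRHS]mulr1.
  by rewrite ler_wpM2l ?(ltW (E0 i))//; have /andP[] := H01 i z.
have [w wE] := @cc_sum R X _ X s (fun=> 2 * c) H.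
have fw x : `|f x| <= w x.
  have w0 : forall t : seq X, 0 <= \sum_(i <- t) 2 * c * H i x.
    move=> t; apply: sumr_ge0 => i _; rewrite !mulr_ge0 ?(ltW c0)//.
    by have /andP[] := H01 i x.
  rewrite wE; have [->|fx] := eqVneq (f x) 0; first by rewrite normr0.
  have Kx : K x by exact: subset_closure.
  have [i si /= Hi] := Ks x Kx.
  rewrite (big_rem i)//=; apply: le_trans (fc x) _.
  have h1 : c <= 2 * c * H i x by nra.
  by apply: le_trans h1 _; rewrite lerDl.
apply: (@le_trans _ _ (q w)).
  rewrite ler_norml; apply/andP; split.
    rewrite lerNl -mulN1r -[_ * q f]addr0 -(mul0r (q f)) -radonL//.
    apply: pos_le => // x; rewrite ccLE mul0r addr0 mulN1r; apply: le_trans (fw x).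
    by rewrite -normrN ler_norm.
  by apply: pos_le => // x; apply: le_trans (fw x); exact: ler_norm.
rewrite (@radon_sum _ _ _ q X s (fun=> 2 * c) H w)//; apply: ler_sum => i _.
by rewrite ler_wpM2l ?mulr_ge0 ?(ltW c0)//; have /andP[] := qH i.
Qed.

Lemma posradon_cvg (T : Type) (F : set_system T) (P : T -> meas R X) (lam : meas R X) :
  ProperFilter F -> F [set t | posradon (P t)] ->
  (forall f, P t f @[t --> F] --> lam f) -> posradon lam.
Proof.
move=> PF Fpos Fl; apply: posradon_intro => [f g h a b hE|f f0].
  apply: (@cvg_unique _ (@Rhausdorff R) (P t h @[t --> F])); first exact: Fl.
  have E : {near F, (fun t => a * P t f + b * P t g) =1 (fun t => P t h)}.
    by near=> t; rewrite (radonE _ hE)//; apply: pos_radon; near: t.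
  apply: cvg_trans (near_eq_cvg E) _.
  by apply: cvgD; (apply: cvgM; [exact: cvg_cst|exact: Fl]).
apply: (@closed_cvg _ _ F _ (fun t => P t f) [set r | 0 <= r] _ _ (lam f) (Fl f)).
  exact: closed_ge.
by near=> t; apply: (@pos_ge0 _ _ (P t)) => //; near: t.
Unshelve. all: by end_near. Qed.

Lemma msub_mlin p q : msub p q = mlin 1 p (-1) q.
Proof. by apply/funext => f; rewrite /mlin /msub mul1r mulN1r. Qed.

Definition cauchy_along (T : Type) (F : set_system T) (P : T -> meas R X) :=
  forall e : R, 0 < e -> exists2 A, F A & forall s t, A s -> A t ->
    ipE (msub (P s) (P t)) (msub (P s) (P t)) < e.

(** Consistency for a family indexed by T, through the image filter: the positive and negative parts
    of one vector measure can then be followed along the same filter. *)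
Lemma strong_limit (hcons : consistent kappa) (T : Type) (F : set_system T)
    (P : T -> meas R X) (lam : meas R X) : ProperFilter F ->
  F [set t | Ep (P t)] -> cauchy_along F P ->
  (forall f, P t f @[t --> F] --> lam f) ->
  Ep lam /\ forall e : R, 0 < e ->
    F [set t | ipE (msub (P t) lam) (msub (P t) lam) < e].
Proof.
move=> PF FE FC Fl.
have PFm : ProperFilter (P @ F) by exact: fmap_proper_filter.
have Fcl : cluster (P @ F) lam.
  have cv : (P @ F : set_system (meas R X)) --> lam.
    by apply: ptws_cvg => f; exact: Fl.
  rewrite cluster_cvgE /=; exists (P @ F); [exact: PFm|by split].
have plam : posradon lam.
  by apply: (posradon_cvg PF _ Fl); apply: filterS FE => t [].
have cons : forall e : R, 0 < e -> exists2 A, (P @ F) A & forall mu, A mu ->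
    finE kappa (msub mu lam) /\ snorm kappa (msub mu lam) < e.
  apply: (hcons (P @ F) PFm _ _ lam Fcl).
    by apply: (@filterS _ F _ _ _ _ FE) => t /= hE; apply/(finEpP hk).
  move=> e e0; have e20 : 0 < e ^+ 2 by rewrite exprn_gt0.
  have [A FA CA] := FC (e ^+ 2) e20.
  exists (P @` (A `&` [set t | Ep (P t)])).
    apply: (@filterS _ F _ (A `&` [set t | Ep (P t)])); last exact: filterI.
    by move=> t At; exists t.
  move=> _ _ [s [As hs] <-] [t [At ht] <-].
  pose proof (finE_msub hk hpd hs ht) as hst.
  by split => //; rewrite snorm_lt//; exact: CA.
(* Consistency yields the finite energy of P t - lam only; that of lam follows from lam = P t - (P t
   - lam). *)
have Elam : Ep lam.
  have [A FA CA] := cons 1 ltr01.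
  have [t [At ht]] := @filter_ex _ F _ _ (filterI FA FE).
  have [fin _] := CA _ At.
  apply/(finEpP hk); split => //.
  have -> : lam = mlin 1 (P t) (-1) (msub (P t) lam).
    by apply/funext => f; rewrite /mlin /msub; ring.
  by apply: (finE_mlin hk hpd) => //; exact: Ep_finE.
split => // e e0; have se0 : 0 < Num.sqrt e by rewrite sqrtr_gt0.
have [A FA CA] := cons _ se0.
apply: (@filterS _ F _ (P @^-1` A)); last exact: FA.
move=> t At; have [fin] := CA _ At.
by rewrite snorm_lt// sqr_sqrtr// ltW.
Qed.

(* The elements of almost minimal energy in a decreasing family of
   (midpoint) convex sets form a strong Cauchy filter. *)
Lemma convexify (T : Type) (mid : T -> T -> T) (P Q : T -> meas R X)
    (BB : set (set T)) (M : R) :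
  BB !=set0 -> (forall S, BB S -> S !=set0) ->
  (forall S S', BB S -> BB S' -> exists2 S'', BB S'' & S'' `<=` S `&` S') ->
  (forall S s t, BB S -> S s -> S t -> S (mid s t) /\
     P (mid s t) = mlin 2^-1 (P s) 2^-1 (P t) /\
     Q (mid s t) = mlin 2^-1 (Q s) 2^-1 (Q t)) ->
  (forall S s, BB S -> S s -> [/\ Ep (P s), Ep (Q s) &
     ee (P s) (P s) + ee (Q s) (Q s) <= M]) ->
  exists F : set_system T, [/\ ProperFilter F, BB `<=` F,
    cauchy_along F P & cauchy_along F Q].
Proof.
move=> [S0 BS0] Bn0 Bdir Bmid BE.
pose N t := ee (P t) (P t) + ee (Q t) (Q t).
pose d S := inf (N @` S).
have N0 S s : BB S -> S s -> 0 <= N s.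
  by move=> BS Ss; have [hp hq _] := BE _ _ BS Ss; apply: addr_ge0; exact: ee_ge0.
have hinf S : BB S -> has_inf (N @` S).
  move=> BS; split; first by have [s Ss] := Bn0 _ BS; exists (N s); exists s.
  by exists 0 => _ [s Ss <-]; exact: N0 Ss.
have dle S s : BB S -> S s -> d S <= N s.
  by move=> BS Ss; apply: ge_inf; [have [] := hinf S BS|exists s].
have hsup : has_sup (d @` BB).
  split; first by exists (d S0); exists S0.
  exists M => _ [S BS <-]; have [s Ss] := Bn0 _ BS.
  by apply: le_trans (dle _ _ BS Ss) _; have [] := BE _ _ BS Ss.
(* The infima d S grow as S shrinks and are bounded by M. The filter is generated by the sets of t
   in S with N t <= D + e, nonempty since d S <= D. *)
pose D := sup (d @` BB).
have dD S : BB S -> d S <= D by move=> BS; apply: sup_upper_bound => //; exists S.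
pose G (Sd : set T * R) := [set t | Sd.1 t /\ N t <= D + Sd.2].
pose F := filter_from [set Sd : set T * R | BB Sd.1 /\ 0 < Sd.2] G.
have PF : ProperFilter F.
  apply: filter_from_proper.
    apply: filter_from_filter; first by exists (S0, 1).
    move=> [S e] [S' e'] /= [BS e0] [BS' e'0].
    have [S'' BS'' sub] := Bdir _ _ BS BS'.
    exists (S'', Num.min e e') => /=; first by split => //; rewrite lt_min e0 e'0.
    move=> t [/= /sub[St S't] Nt]; split; split => //=.
      by apply: le_trans Nt _; rewrite lerD2l ge_min lexx.
    by apply: le_trans Nt _; rewrite lerD2l ge_min lexx orbT.
  move=> [S e] [/= BS e0].
  have [_ [s Ss <-] Ns] := inf_adherent e0 (hinf S BS).
  exists s; split => //=; apply: le_trans (ltW Ns) _; rewrite lerD2r; exact: dD.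
have Cauchy e : 0 < e -> exists2 A, F A & forall s t, A s -> A t ->
    ipE (msub (P s) (P t)) (msub (P s) (P t)) < e /\
    ipE (msub (Q s) (Q t)) (msub (Q s) (Q t)) < e.
  (* For s, t in a set S with d S > D - e/16, the parallelogram identity gives 1/4 of the sum of
     both squared distances <= (D + e/16) - (D - e/16), so the sum is at most e/2. *)
  move=> e0; have e16 : 0 < e / 16 by rewrite divr_gt0.
  have [_ [S BS <-] Sd] := sup_adherent e16 hsup.
  exists (G (S, e / 16)); first by exists (S, e / 16).
  move=> s t [/= Ss Ns] [/= St Nt].
  have [Sm [Pm Qm]] := Bmid _ _ _ BS Ss St.
  have [hps hqs _] := BE _ _ BS Ss; have [hpt hqt _] := BE _ _ BS St.
  have [hpm hqm _] := BE _ _ BS Sm.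
  have := dle _ _ BS Sm.
  rewrite /N -(ipE_Ep hk hpm hpm) -(ipE_Ep hk hqm hqm) Pm Qm.
  move: Ns Nt; rewrite /N -!(ipE_Ep hk)// !msub_mlin.
  have fps := Ep_finE hk hps; have fpt := Ep_finE hk hpt.
  have fqs := Ep_finE hk hqs; have fqt := Ep_finE hk hqt.
  pose proof (ipE_ge0 hk hpd (finE_mlin hk hpd 1 (-1) fps fpt)) as Bp.
  pose proof (ipE_ge0 hk hpd (finE_mlin hk hpd 1 (-1) fqs fqt)) as Bq.
  move: Bp Bq.
  rewrite !(ipE_quad hk hpd)//.
  by move: Sd; rewrite -/D; split; lra.
exists F; split => //.
- by move=> S BS; exists (S, 1) => // t [].
- by move=> e e0; have [A FA HA] := Cauchy e e0; exists A => // s t As At; have [] := HA _ _ As At.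
- by move=> e e0; have [A FA HA] := Cauchy e e0; exists A => // s t As At; have [] := HA _ _ As At.
Qed.

Lemma mass_mmul nu f c : posradon nu -> (forall x, 0 <= f x) -> 0 <= c ->
  mass (mscal c (mmul f nu)) = (c * nu f)%:E.
Proof.
move=> pnu f0 c0; have pf : posradon (mmul f nu) by exact: posradon_mmul.
rewrite /mass upint_mscal//.
rewrite EFinM; congr (_ * _)%E; apply/eqP; rewrite eq_le; apply/andP; split.
  apply: upint_le => g g0 g1; rewrite lee_fin.
  apply: (@pos_le _ _ _ nu (ccM f g)) => // x.
  by rewrite ccME -[leRHS]mulr1 ler_wpM2l// -lee_fin.
have [u u01 uf] := bump_support f.
apply: (@le_trans _ _ (mmul f nu u)%:E).
  rewrite lee_fin; apply: (@pos_le _ _ _ nu _ (ccM f u)) => // x; rewrite ccME.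
  by have [->|fx] := eqVneq (f x) 0; rewrite ?mul0r// uf// mulr1.
by apply: upint_ub => x; have /andP[] := u01 x.
Qed.

Lemma mmul_le f nu : posradon nu -> (forall x, 0 <= f x <= 1) ->
  forall g, (forall x, 0 <= g x) -> mmul f nu g <= nu g.
Proof.
move=> pnu f01 g g0; apply: (@pos_le _ _ _ nu (ccM f g)) => // x; rewrite ccME -[leRHS]mul1r.
by rewrite ler_wpM2r//; have /andP[] := f01 x.
Qed.

Lemma carried_mmul f nu A : carried nu A -> carried (mmul f nu) A.
Proof. by move=> cA g gA; apply: cA => x Ax; rewrite ccME gA// mulr0. Qed.

Lemma Ep_mmul f nu : Ep nu -> (forall x, 0 <= f x <= 1) -> Ep (mmul f nu).
Proof.
move=> hnu f01; apply: (Ep_le _ hnu).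
  by apply: posradon_mmul; [move=> x; have /andP[] := f01 x|exact: Ep_pos hnu].
by apply: mmul_le => //; exact: Ep_pos hnu.
Qed.

Lemma ee_le p p' q q' : Ep p -> Ep p' -> Ep q -> Ep q' ->
  (forall f, (forall x, 0 <= f x) -> p f <= p' f) ->
  (forall f, (forall x, 0 <= f x) -> q f <= q' f) -> ee p q <= ee p' q'.
Proof.
by move=> hp hp' hq hq' pp qq; rewrite -lee_fin -!(enE hk hpd)//; exact: en_le.
Qed.

(* Otherwise unit masses of bounded energy escape to infinity; after
   [convexify] they would converge strongly to their vague limit 0. *)
Lemma capacity_tail (hcons : consistent kappa) (A : set X) (M e : R) :
  closed A -> (capacity kappa A < +oo)%E -> 0 < e ->
  exists2 K, compact K & forall nu f, Ep nu -> carried nu A -> ee nu nu <= M ->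
    (forall x, 0 <= f x <= 1) -> (forall x, K x -> f x = 0) -> nu f <= e.
Proof.
move=> clA capA e0; apply: contrapT => H.
(* Normalizing f nu by nu f > e divides its energy by more than e^2. *)
pose M' := M / e ^+ 2.
pose C (K : set X) := [set nu | [/\ Ep nu, carried nu A, mass nu = 1%E, ee nu nu <= M' &
  forall f, (forall x, ~ K x -> f x = 0) -> nu f = 0]].
have Cn0 K : compact K -> C K !=set0.
  move=> cK; apply: contrapT => CK; apply: H; exists K => // nu f hnu cnu nuM f01 fK.
  rewrite leNgt; apply/negP => enu; apply: CK.
  have f0 x : 0 <= f x by have /andP[] := f01 x.
  have pnu := Ep_pos hnu; pose proof (Ep_mmul hnu f01) as hm.
  have nf0 : 0 < nu f by exact: lt_trans enu.
  have i0 : 0 <= (nu f)^-1 by rewrite invr_ge0 ltW.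
  exists (mscal (nu f)^-1 (mmul f nu)); split.
  - exact: (Ep_mscal hk hpd).
  - by move=> g gA; rewrite /mscal (carried_mmul f cnu gA) mulr0.
  - by rewrite mass_mmul// mulVf// gt_eqF.
  - pose proof (Ep_mscal hk hpd i0 hm) as hs.
    rewrite (ee_mscall hk hpd i0 hm hs) (ee_mscalr hk hpd i0 hm hm).
    have em : ee (mmul f nu) (mmul f nu) <= M.
      by apply: le_trans nuM; apply: ee_le => //; exact: mmul_le.
    have em0 := ee_ge0 hk hm hm.
    rewrite mulrA -expr2 exprVn mulrC ler_pdivrMr ?exprn_gt0//.
    rewrite /M' mulrAC ler_pdivlMr ?exprn_gt0//.
    have ee2 : e ^+ 2 <= nu f ^+ 2 by rewrite ler_sqr ?nnegrE ltW.
    have M0 : 0 <= M by exact: le_trans em.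
    by apply: ler_pM => //; rewrite exprn_ge0// ltW.
  - move=> g gK; rewrite /mscal /mmul [X in _ * X](radon_eq0 (pos_radon pnu)) ?mulr0// => x.
    rewrite ccME; have [Kx|/gK ->] := pselect (K x); last by rewrite mulr0.
    by rewrite fK// mul0r.
have [||||S s [K cK <-] [hs _ _ sM _]|F [PF BF CF _]] :=
  @convexify (meas R X) (fun s t => mlin 2^-1 s 2^-1 t) id id
    [set C K | K in compact] (M' + M').
- by exists (C set0); exists set0 => //; exact: compact0.
- by move=> _ [K cK <-]; exact: Cn0.
- move=> _ _ [K cK <-] [L cL <-]; exists (C (K `|` L)).
    by exists (K `|` L) => //; exact: compactU.
  move=> nu [h1 h2 h3 h4 h5]; split; split => // f fK; apply: h5 => x /not_orP[? ?].
    exact: fK.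
  exact: fK.
- move=> _ s t [K cK <-] [hs cs ms sM sK] [ht ct mt tM tK]; split => //.
  have ps := Ep_pos hs; have pt := Ep_pos ht.
  have h2 : 0 <= (2^-1 : R) by lra.
  have E2 : mlin 2^-1 s 2^-1 t = madd (mscal 2^-1 s) (mscal 2^-1 t) by [].
  pose proof (Ep_mscal hk hpd h2 hs) as hsm; pose proof (Ep_mscal hk hpd h2 ht) as htm.
  have hm : Ep (mlin 2^-1 s 2^-1 t) by rewrite E2; exact: (Ep_madd hk hpd).
  split => //.
  + by move=> f fA; rewrite /mlin cs// ct// !mulr0 addr0.
  + rewrite /mass E2 upint_madd; [|exact: Ep_pos hsm|exact: Ep_pos htm|by move=> _; exact: lee01].
    rewrite !upint_mscal//.
    move: ms mt; rewrite /mass => -> ->; rewrite -!EFinM -EFinD; congr EFin; lra.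
  + rewrite -(ipE_Ep hk hm hm).
    have fs := Ep_finE hk hs; have ft := Ep_finE hk ht.
    rewrite (ipE_quad hk hpd)//.
    pose proof (ipE_young hk hpd fs ft ltr01) as Y; move: Y.
    by rewrite divr1 !(ipE_Ep hk)//; lra.
  + by move=> f fK; rewrite /mlin sK// tK// !mulr0 addr0.
- by split => //; exact: lerD.
have FE : F [set nu | Ep (id nu)].
  apply: (@filterS _ F _ (C set0)); first by move=> nu [].
  by apply: BF; exists set0 => //; exact: compact0.
(* Each f is eventually integrated to 0, by taking for K its support; so the vague limit is 0. *)
have [f|_ F0] := @strong_limit hcons (meas R X) F id (fun=> 0) PF FE CF.
  apply: cvg_near_cst; apply: (@filterS _ F _ (C (closure [set x | f x != 0]))).
    move=> nu [_ _ _ _ nuK]; apply: nuK => x nx.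
    by apply: contrapT => /eqP fx; apply: nx; exact: subset_closure.
  apply: BF; exists (closure [set x | f x != 0]) => //; exact: (@ccf_csupp _ _ f).
have FC0 : F (C set0) by apply: BF; exists set0 => //; exact: compact0.
(* Strong convergence to 0 yields unit measures on A of arbitrarily small energy, which would make
   the capacity infinite. *)
have inf_le (r : R) : 0 < r -> (cap_inf kappa A < r%:E)%E.
  move=> r0; have [nu [/= nur [hnu cnu mnu _ _]]] := @filter_ex _ F _ _ (filterI (F0 r r0) FC0).
  have E0 : msub nu (fun=> 0) = nu by apply/funext => f; rewrite /msub subr0.
  rewrite E0 in nur; have fnu := Ep_finE hk hnu.
  apply: (@le_lt_trans _ _ (energy kappa nu)); last first.
    by rewrite /energy (menergyE hk hpd fnu fnu) lte_fin.
  apply: ereal_inf_lbound; exists nu => //; split; first exact/(finEpP hk).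
  by split => //; apply/(concentratedP (Ep_pos hnu) clA).
have inf_ge : (0 <= cap_inf kappa A)%E.
  apply: le_ereal_inf_tmp => _ [nu [/(finEpP hk) hnu _] <-].
  have fnu := Ep_finE hk hnu.
  by rewrite /energy (menergyE hk hpd fnu fnu) lee_fin; exact: (ipE_ge0 hk hpd).
move: capA inf_le inf_ge; rewrite /capacity; case: (cap_inf kappa A) => [r||].
- case: ifPn => // rn0 _ inf_le; rewrite lee_fin => r0.
  have rp : 0 < r by rewrite lt_neqAle eq_sym rn0.
  by have := inf_le r rp; rewrite lte_fin ltxx.
- by move=> _ /(_ 1 ltr01).
- by [].
Qed.

End StrongVague.

(** * Tails and energy bounds *)

Section TailsAndBounds.
Variables (R : realType) (X : topologicalType).
Context {lcX : lch X}.
Implicit Types (f g h k u w phi : Cc R X) (mu nu p q sg tau : meas R X) (a b c : R).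
Variable kappa : X -> X -> \bar R.
Hypothesis hk : kernel_basic kappa.
Hypothesis hpd : strictly_pd kappa.
Local Notation Ep := (Ep kappa).
Local Notation ipE := (ipE kappa).
Local Notation ee := (ee kappa).
Local Notation en := (en kappa).
Local Notation kpot := (kpot kappa).

Let k0 x y : (0 <= kappa x y)%E. Proof. by have [] := hk. Qed.

Lemma closed_excess (F : X -> \bar R) h (d : R) : lower_semicontinuous F ->
  closed [set x | (F x + d%:E <= (h x)%:E)%E].
Proof.
move=> lF; rewrite (_ : [set x | _] = ~` [set x | ((h x - d)%:E < F x)%E]); last first.
  apply/seteqP; split => x /=; rewrite EFinB lteBlDr// ltNge; first by move=> ->.
  by move=> /negP; rewrite negbK.
apply: open_closedC; rewrite openE => x /= hF.
have [r hr rF] : exists2 r : R, h x - d < r & (r%:E < F x)%E.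
  move: hF; case: (F x) => [t||]//.
  - rewrite lte_fin => ht; exists ((h x - d + t) / 2); rewrite ?lte_fin; lra.
  - by move=> _; exists (h x - d + 1); rewrite ?ltry//; lra.
have [V Vx VF] := lF x r rF.
have hlt : h x < r + d by lra.
have /cvgr_lt /(_ _ hlt) nh := @ccf_cont _ _ h x.
have : nbhs x (V `&` [set t | h t < r + d]) by exact: filterI.
apply: filterS => y [Vy /= hy]; apply: lt_trans (VF y Vy).
by rewrite lte_fin; lra.
Qed.

Lemma cap0_no_mass (N : set X) tau : capacity kappa N = 0%E -> Ep tau ->
  concentrated tau N -> mass tau = 1%E -> False.
Proof.
move=> capN ht ct mt.
have fin : (cap_inf kappa N < +oo)%E.
  apply: (@le_lt_trans _ _ (energy kappa tau)).
    by apply: ereal_inf_lbound; exists tau => //; split => //; exact/(finEpP hk).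
  have ft := Ep_finE hk ht.
  by rewrite /energy (menergyE hk hpd ft ft) ltry.
move: capN fin; rewrite /capacity; case: (cap_inf kappa N) => [r||]//.
case: ifPn => // rn0 [] /eqP; by rewrite invr_eq0 (negbTE rn0).
Qed.

(* The exceptional set is only controlled through closed subsets: it meets
   [A] in the union over d > 0 of the compact sets [D] below. *)
Lemma ne_upint (A N : set X) nu h (F : X -> \bar R) : closed A -> Ep nu ->
  carried nu A -> (forall x, 0 <= h x) -> lower_semicontinuous F ->
  (forall x, 0 <= F x)%E -> capacity kappa N = 0%E ->
  (forall x, A x -> ~ N x -> ((h x)%:E <= F x)%E) ->
  ((nu h)%:E <= upint nu F)%E.
Proof.
move=> clA hnu cA h0 lF F0 capN hF.
have pnu := Ep_pos hnu; have rnu := pos_radon pnu.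
have [u u01 uh] := bump_support h.
have u0 x : 0 <= u x by have /andP[] := u01 x.
have nu0 : 0 <= nu u by apply: pos_ge0.
apply/lee_addgt0Pr => e e0; pose d := e / (1 + nu u).
have d0 : 0 < d by rewrite divr_gt0// ltr_pwDl.
(* The inequality h <= F holds on A outside N, so D lies in N; being closed, it can carry a
   restriction of nu. *)
pose D := A `&` [set x | (F x + d%:E <= (h x)%:E)%E].
have clD : closed D by apply: closedI => //; exact: closed_excess.
have Dh x : D x -> h x != 0.
  move=> [_ /= Fh]; rewrite gt_eqF// -lte_fin; apply: lt_le_trans Fh.
  by apply: (@lt_le_trans _ _ d%:E); rewrite ?lte_fin// leeDr.
have DN : D `<=` N.
  move=> x [Ax /= Fh]; apply: contrapT => nNx.
  have := hF x Ax nNx; move: Fh (F0 x); case: (F x) => [t||]//.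
  by rewrite -EFinD !lee_fin; lra.
have [nuU [nuD [pU pD nuE cD UE]]] := restrict_closed pnu clD.
have Dle f : (forall x, 0 <= f x) -> nuD f <= nu f.
  by move=> f0; rewrite nuE; exact: maddr_le.
(* If nu charged D, the normalized restriction would be a unit measure of finite energy concentrated
   on N. *)
have nuDu : nuD u <= 0.
  rewrite leNgt; apply/negP => m0.
  have i0 : 0 <= (nuD u)^-1 by rewrite invr_ge0 ltW.
  have hD : Ep nuD by exact: Ep_le Dle.
  have ht : Ep (mscal (nuD u)^-1 nuD) by exact: (Ep_mscal hk hpd).
  apply: (@cap0_no_mass N _ capN ht).
    have : concentrated (mscal (nuD u)^-1 nuD) D.
      apply/(concentratedP (Ep_pos ht) clD) => f fD.
      by rewrite /mscal [X in _ * X]cD// mulr0.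
    move=> cc K cK r r0; have [V [oV [KV Vr]]] := cc K cK r r0.
    exists V; split => //; split => // x [nNx Kx]; apply: KV; split => // Dx.
    by apply: nNx; exact: DN.
  rewrite /mass upint_mscal// (_ : upint nuD _ = (nuD u)%:E).
    by rewrite -EFinM mulVf// gt_eqF.
  apply/eqP; rewrite eq_le; apply/andP; split.
    apply: upint_le => g g0 g1; rewrite lee_fin; apply: (pos_le_on pD cD) => x Dx.
    by rewrite uh ?Dh// -lee_fin.
  by apply: upint_ub => // x; rewrite lee_fin; have /andP[] := u01 x.
have nuDh : nuD h <= 0.
  have [c c0 hc] := cc_bounded h.
  apply: (@le_trans _ _ (nuD (ccL c u 0 u))).
    apply: pos_le => // x; rewrite ccLE mul0r addr0.
    have [->|hx] := eqVneq (h x) 0; first by rewrite mulr_ge0// ltW.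
    by rewrite uh// mulr1; apply: le_trans (hc x); exact: ler_norm.
  by rewrite (radonL _ _ _ _ (pos_radon pD)) mul0r addr0 pmulr_rle0.
apply: (@le_trans _ _ (nuU h)%:E).
  by rewrite lee_fin nuE /madd gerDl.
(* On A outside D one has h - d < F, so (g - d)^+ <= F; the truncation costs at most d nu(u) <=
   e. *)
rewrite UE//; apply: upint_le => g g0 gh.
apply: (@le_trans _ _ ((nu (cctr g d))%:E + (d * nu u)%:E)%E).
  rewrite -EFinD lee_fin -[nu (cctr _ _)]mul1r -radonL//.
  apply: pos_le => // x; rewrite ccLE mul1r cctrE ?(ltW d0)//.
  have [->|gx] := eqVneq (g x) 0.
    by rewrite addr_ge0// ?le_max ?lexx ?orbT// mulr_ge0// ltW.
  have hx : h x != 0.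
    apply: contraNneq gx => hx; rewrite eq_le g0 andbT -lee_fin.
    by have := gh x; rewrite /rst hx; case: ifP.
  rewrite uh// mulr1 -lerBlDr le_max lexx//.
apply: leeD; last first.
  rewrite lee_fin /d mulrAC ler_pdivrMr ?ltr_pwDl//.
  by rewrite ler_wpM2l ?(ltW e0)//; lra.
have gd0 x : 0 <= cctr g d x by rewrite cctrE ?(ltW d0)// le_max lexx orbT.
rewrite -upint_cc//; apply: (upint_le_on pnu clA cA) => // x Ax.
rewrite cctrE ?(ltW d0)//; have := gh x; rewrite /rst; case: asboolP => [nDx|_] gx.
  case: lerP => // _.
  have /negP : ~ (F x + d%:E <= (h x)%:E)%E by move=> Fh; apply: nDx.
  rewrite -ltNge -lteBlDr// => /ltW; apply: le_trans.
  by rewrite -EFinB lee_fin lerB// -lee_fin.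
rewrite (_ : Num.max _ _ = 0)//; apply/max_idPr.
by rewrite lee_fin in gx; lra.
Qed.

(** Split f at a level T. The part min (f, T) is T times a test function with values in [0, 1],
    which [capacity_tail] controls. The part (f - T)^+ vanishes on A when g <= T there; otherwise
    the growth condition with exponent r > 1 makes it small through a mutual energy. *)
Lemma g_tail (hcons : consistent kappa) (A : set X) (g : X -> R) (M e : R) :
  closed A -> (capacity kappa A < +oo)%E -> 0 < e ->
  ((exists c : R, forall x, A x -> g x <= c) \/
   (exists (r : R) (nu : meas R X), 1 < r /\ finE kappa nu /\
      exists N : set X, capacity kappa N = 0%E /\
        forall x, A x -> ~ N x -> ((g x `^ r)%:E <= pot kappa nu x)%E)) ->
  exists2 K, compact K & forall nu f, Ep nu -> carried nu A -> ee nu nu <= M ->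
    (forall x, 0 <= f x) -> (forall x, A x -> f x <= g x) ->
    (forall x, K x -> f x = 0) -> nu f <= e.
Proof.
move=> clA capA e0.
have trunc (T d : R) : 0 < T -> 0 < d -> exists2 K, compact K &
    forall nu f, Ep nu -> carried nu A -> ee nu nu <= M ->
    (forall x, 0 <= f x) -> (forall x, K x -> f x = 0) ->
    nu f - nu (cctr f T) <= d.
  move=> T0 d0; have dT : 0 < d / T by rewrite divr_gt0.
  have [K cK HK] := capacity_tail hk hpd hcons M clA capA dT.
  exists K => // nu f hnu cnu nuM f0 fK.
  have rnu := pos_radon (Ep_pos hnu).
  pose w := ccL T^-1 f (- T^-1) (cctr f T).
  have wE x : w x = Num.min (f x) T / T.
    rewrite ccLE cctrE ?(ltW T0)//.
    by case: (lerP (f x) T) => fT; case: (lerP (f x - T) 0) => ?; try lra; field; rewrite gt_eqF.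
  have wd : nu w <= d / T.
    apply: (HK nu w hnu cnu nuM) => x.
      rewrite wE divr_ge0 ?(ltW T0) ?le_min ?f0 ?(ltW T0)//=.
      by rewrite ler_pdivrMr// mul1r ge_min lexx orbT.
    by move=> Kx; rewrite wE fK// min_l ?mul0r// ltW.
  have wE2 : nu w = (nu f - nu (cctr f T)) / T by rewrite radonL//; ring.
  by move: wd; rewrite wE2 ler_pM2r// invr_gt0.
case=> [[c gc]|[r [sg [r1 [fs [N [capN Ng]]]]]]].
  pose T := Num.max c 1; have T0 : 0 < T by rewrite lt_max ltr01 orbT.
  have [K cK HK] := trunc T e T0 e0; exists K => // nu f hnu cnu nuM f0 fg fK.
  have := HK nu f hnu cnu nuM f0 fK; rewrite (cnu (cctr f T)) ?subr0// => x Ax.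
  rewrite cctrE ?(ltW T0)//; apply/max_idPr; rewrite subr_le0.
  by apply: le_trans (fg x Ax) _; apply: le_trans (gc x Ax) _; rewrite le_max lexx.
have [p [q [hp hq sgE]]] := finE_decomp hk fs.
pose C := `|M| + ee p p + 1.
have C0 : 0 < C by rewrite ltr_pwDr// addr_ge0//; exact: ee_ge0.
have CE nu : Ep nu -> ee nu nu <= M -> ee nu p <= C.
  move=> hnu nuM; have fn := Ep_finE hk hnu; have fp := Ep_finE hk hp.
  pose proof (ipE_young hk hpd fn fp ltr01) as Y; move: Y.
  rewrite divr1 !(ipE_Ep hk)// /C; have := ler_norm M; have := ee_ge0 hk hp hp.
  have := normr_ge0 M; lra.
have r10 : r - 1 != 0 by rewrite gt_eqF// subr_gt0.
have b0 : 0 < 2 * C / e by rewrite divr_gt0// mulr_gt0.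
(* Where f > T, (2C/e)(f - T) <= f^(r-1) f = f^r <= g^r, n.e. on A at most the potential of p. As C
   bounds the mutual energy with p, the integral of (f - T)^+ is at most e/2. *)
pose T := (2 * C / e) `^ ((r - 1)^-1).
have T0 : 0 < T by rewrite powR_gt0.
have TE : T `^ (r - 1) = 2 * C / e by rewrite /T -powRrM mulVf// powRr1// ltW.
have e2 : 0 < e / 2 by rewrite divr_gt0.
have [K cK HK] := trunc T (e / 2) T0 e2; exists K => // nu f hnu cnu nuM f0 fg fK.
have pnu := Ep_pos hnu; have rnu := pos_radon pnu.
pose w := ccL (2 * C / e) (cctr f T) 0 f.
have wE x : w x = 2 * C / e * Num.max (f x - T) 0.
  by rewrite ccLE mul0r addr0 cctrE// ltW.
have nuw : nu w = 2 * C / e * nu (cctr f T) by rewrite radonL// mul0r addr0.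
have pp := Ep_pos hp.
have : ((nu w)%:E <= upint nu (kpot p))%E.
  apply: (ne_upint clA hnu cnu _ _ _ capN).
  - by move=> x; rewrite wE mulr_ge0 ?(ltW b0)// le_max lexx orbT.
  - exact: (lsc_kpot hk).
  - by move=> x; apply: kpot_ge0 => //; exact: pos_radon.
  - move=> x Ax nNx; rewrite wE.
    have kp0 : (0 <= kpot p x)%E by apply: kpot_ge0 => //; exact: pos_radon.
    have [fT|Tf] := lerP (f x - T) 0; first by rewrite mulr0.
    have fx0 : 0 < f x by lra.
    apply: (@le_trans _ _ (f x `^ r)%:E).
      rewrite lee_fin -TE.
      have -> : f x `^ r = f x `^ (r - 1) * f x.
        rewrite -[X in _ = _ * X]powRr1 ?ltW// -powRD ?subrK//.
        by rewrite (gt_eqF fx0) implybT.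
      apply: ler_pM; [exact: powR_ge0|by lra| |by lra].
      by apply: ge0_ler_powR; rewrite ?nnegrE; lra.
    apply: (@le_trans _ _ (g x `^ r)%:E).
      have := fg x Ax => fgx; rewrite lee_fin.
      by apply: ge0_ler_powR; rewrite ?nnegrE; lra.
    apply: le_trans (Ng x Ax nNx) _; rewrite /pot sgE.
    apply: (@le_trans _ _ (upint (msub p q) (kappa x))).
      rewrite -[leRHS]adde0; apply: leeD => //; rewrite oppe_le0.
      apply: upint_ge0 => //.
      apply: radon_mopp; apply: radon_msub; apply: pos_radon => //; exact: Ep_pos hq.
    apply: upint_le_meas => l l0; rewrite /msub gerBl.
    by apply: pos_ge0 => //; exact: Ep_pos hq.
rewrite -/(en nu p) (enE hk hpd hnu hp) lee_fin nuw => nuC.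
have := HK nu f hnu cnu nuM f0 fK.
have : nu (cctr f T) <= e / 2.
  rewrite -(ler_pM2l b0); apply: le_trans nuC _.
  have -> : 2 * C / e * (e / 2) = C by field; rewrite gt_eqF.
  exact: CE.
by lra.
Qed.

Lemma closed_supp_pos nu : closed (supp_pos nu).
Proof.
rewrite -[supp_pos nu]setCK; apply: open_closedC; rewrite openE => x /= nx.
have [U [oU Ux nU]] : exists U, [/\ open U, U x & ~ exists f : Cc R X,
    (forall y, 0 <= f y) /\ (forall y, ~ U y -> f y = 0) /\ 0 < nu f].
  apply: contrapT => H; apply: nx => U oU Ux; apply: contrapT => nf.
  by apply: H; exists U.
have : nbhs x U by exact: open_nbhs_nbhs.
by apply: filterS => y Uy /(_ U oU Uy).
Qed.

Lemma supp_pos_sub nu D : closed D -> carried nu D -> supp_pos nu `<=` D.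
Proof.
move=> clD cD x sx; apply: contrapT => nDx.
have [f [f0 [fD]]] := sx (~` D) (closed_openC clD) nDx.
by rewrite cD ?ltxx// => y Dy; apply: fD => /=; exact.
Qed.

(* Removing from [q] its part on the set where its potential exceeds 2cm
   does not increase the distance to [p]; what remains has a potential
   bounded everywhere by the maximum principle. *)
Lemma energy_bound (hh : R) (hmax : gen_max_principle kappa hh) p q
    (Ap Am : set X) (c m : R) :
  0 <= hh -> Ep p -> Ep q -> carried p Ap -> carried q Am -> 0 <= c -> 0 <= m ->
  (forall x y, Ap x -> Am y -> (kappa x y <= c%:E)%E) ->
  (forall f, (forall x, 0 <= f x <= 1) -> p f <= m) ->
  ee p p <= ipE (msub p q) (msub p q) + 4 * hh * c * m ^+ 2.
Proof.
move=> hh0 hp hq cp cq c0 m0 kc pm.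
have pp := Ep_pos hp; have pq := Ep_pos hq.
have rp := pos_radon pp; have rq := pos_radon pq.
(* Twice the bound c m for the potential of p on [Am]. *)
pose t := 2 * c * m; have t0 : 0 <= t by rewrite !mulr_ge0.
pose U := [set x | (t%:E < kpot q x)%E].
have oU : open U by exact: ((lower_semicontinuousP _).1 (lsc_kpot hk pq)).
pose D := ~` U; have clD : closed D by exact: open_closedC.
have kp0 x : (0 <= kpot p x)%E by exact: kpot_ge0.
have kq0 x : (0 <= kpot q x)%E by exact: kpot_ge0.
have upint_bnd (F : X -> \bar R) (b : R) : 0 <= b ->
    (forall x, Ap x -> (F x <= b%:E)%E) -> (upint p F <= (b * m)%:E)%E.
  move=> b0 Fb; apply: upint_le => f f0 fF; have [u u01 uf] := bump_support f.
  rewrite lee_fin; apply: (@le_trans _ _ (p (ccL b u 0 u))).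
    apply: (pos_le_on pp cp) => x Apx; rewrite ccLE mul0r addr0.
    have /andP[ux0 _] := u01 x.
    have [->|fx] := eqVneq (f x) 0; first exact: mulr_ge0.
    rewrite uf// mulr1 -lee_fin; exact: le_trans (fF x) (Fb x Apx).
  by rewrite radonL// mul0r addr0 ler_wpM2l// pm.
have kpAm x : Am x -> (kpot p x <= (c * m)%:E)%E.
  move=> Ax; apply: upint_bnd => // y Ay.
  by have [_ [ks _]] := hk; rewrite ks; exact: kc.
pose S := ipE (msub p q) (msub p q).
have SE : S = ee p p + ee q q - 2 * ee q p.
  by rewrite /S (ipE_msub hk hpd)// (ee_sym hk hp hq); ring.
(* The right-hand side is half of [ee q q]: on U the potential of p is at most half that of q. It is
   written with S so that the contribution of U cancels against [ee q p] at the end. *)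
have stepA phi : (forall x, 0 <= phi x <= 1) -> (forall x, ~ U x -> phi x = 0) ->
    ee (mmul phi q) p <= ee q p + (S - ee p p) / 2.
  move=> phi01 phiU; have phi0 x : 0 <= phi x by have /andP[] := phi01 x.
  have hm : Ep (mmul phi q) by exact: Ep_mmul.
  have h1 : ee (mmul phi q) p <= c * m * q phi.
    rewrite -lee_fin -(enE hk hpd hm hp); apply: upint_le => f f0 fk.
    rewrite lee_fin; apply: (@le_trans _ _ (q (ccL (c * m) phi 0 phi))); last first.
      by rewrite radonL// mul0r addr0.
    apply: (pos_le_on pq cq) => x Ax; rewrite ccLE mul0r addr0 ccME mulrC.
    by rewrite ler_wpM2r// -lee_fin; exact: le_trans (fk x) (kpAm x Ax).
  have h2 : t * q phi <= ee (mmul phi q) q.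
    rewrite -lee_fin -(enE hk hpd hm hq) /en upint_mmul//; last exact: (lsc_kpot hk).
    have -> : t * q phi = q (ccL t phi 0 phi) by rewrite radonL// mul0r addr0.
    apply: upint_ub => x; rewrite ccLE mul0r addr0; first exact: mulr_ge0.
    have [->|phix] := eqVneq (phi x) 0; first by rewrite mulr0 mul0e.
    have Ux : U x by apply: contrapT => /phiU /eqP; apply/negP.
    by rewrite EFinM muleC lee_wpmul2l ?lee_fin//; exact: ltW.
  have h3 : ee (mmul phi q) q <= ee q q by apply: (ee_le hk hpd) => //; exact: mmul_le.
  have h4 : 2 * (c * m * q phi) = t * q phi by rewrite /t; ring.
  lra.
pose L := ee q p + (S - ee p p) / 2.
(* From densities to the open set U: k <= phi k + d u with phi = min (k, d) / d, which vanishes off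
   U because k does. *)
have stepB : (upint q (rst U (kpot p)) <= L%:E)%E.
  apply: upint_le => k kk0 kU.
  have [u u01 uk] := bump_support k.
  have u0 x : 0 <= u x by have /andP[] := u01 x.
  have qu0 : 0 <= q u by exact: pos_ge0.
  apply/lee_addgt0Pr => e e0; pose d := e / (1 + q u).
  have d0 : 0 < d by rewrite divr_gt0// ltr_pwDl.
  pose phi := ccL d^-1 k (- d^-1) (cctr k d).
  have phiE x : phi x = Num.min (k x) d / d.
    rewrite ccLE cctrE ?(ltW d0)//.
    by case: (lerP (k x) d) => kd; case: (lerP (k x - d) 0) => ?; try lra; field; rewrite gt_eqF.
  have phi01 x : 0 <= phi x <= 1.
    rewrite phiE divr_ge0 ?(ltW d0) ?le_min ?kk0 ?(ltW d0)//=.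
    by rewrite ler_pdivrMr// mul1r ge_min lexx orbT.
  have kU0 x : ~ U x -> k x = 0.
    move=> nUx; apply/eqP; rewrite eq_le kk0 andbT -lee_fin.
    by have := kU x; rewrite /rst; case: asboolP.
  have phiU x : ~ U x -> phi x = 0.
    by move=> /kU0 kx; rewrite phiE kx min_l ?mul0r// ltW.
  have kle x : k x <= phi x * k x + d * u x.
    have [->|kx] := eqVneq (k x) 0; first by rewrite mulr0 add0r mulr_ge0// ltW.
    rewrite uk// mulr1 phiE; case: (lerP (k x) d) => kd.
      by rewrite -[leLHS]add0r lerD// mulr_ge0// divr_ge0// ltW.
    by rewrite divff ?gt_eqF// mul1r lerDl ltW.
  apply: (@le_trans _ _ ((mmul phi q k)%:E + (d * q u)%:E)%E).
    rewrite -EFinD lee_fin -[mmul phi q k]mul1r /mmul -radonL//.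
    by apply: pos_le => // x; rewrite ccLE mul1r ccME.
  apply: leeD; last first.
    rewrite lee_fin /d mulrAC ler_pdivrMr ?ltr_pwDl//.
    by rewrite ler_wpM2l ?(ltW e0)//; lra.
  apply: (@le_trans _ _ (en (mmul phi q) p)).
    apply: upint_ub => // x; apply: le_trans (kU x) _.
    by rewrite /rst; case: ifP.
  have hm : Ep (mmul phi q) by exact: Ep_mmul.
  by rewrite (enE hk hpd hm hp) lee_fin; exact: stepA.
have [qU [qD [pU pD qE cD UE]]] := restrict_closed pq clD.
have qU_le f : (forall x, 0 <= f x) -> qU f <= q f by move=> f0; rewrite qE; exact: maddl_le.
have qD_le f : (forall x, 0 <= f x) -> qD f <= q f by move=> f0; rewrite qE; exact: maddr_le.
have hU : Ep qU by exact: Ep_le qU_le.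
have hD : Ep qD by exact: Ep_le qD_le.
have UL : ee qU p <= L.
  rewrite -lee_fin -(enE hk hpd hU hp); apply: le_trans stepB.
  apply: upint_le => f f0 fk; rewrite UE// /D setCK; apply: upint_mono => x.
  by rewrite /rst; case: ifP.
(* The maximum principle needs compact support, hence the cutoff phi. The potential of phi qD is at
   most t on D, so at most hh t everywhere, and p has mass at most m. *)
have stepD : ee qD p <= hh * t * m.
  rewrite -lee_fin -(enE hk hpd hD hp); apply: upint_le => f f0 fk.
  have [phi phi01 phif] := bump_support f.
  have phi0 x : 0 <= phi x by have /andP[] := phi01 x.
  pose tau := mmul phi qD.
  have ptau : posradon tau by exact: posradon_mmul.
  have -> : qD f = tau f.
    apply: radon_ext; first exact: pos_radon.
    move=> x; rewrite ccME; have [->|fx] := eqVneq (f x) 0; first by rewrite mulr0.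
    by rewrite phif// mul1r.
  apply: (@le_trans _ _ (en tau p)); first exact: upint_ub.
  rewrite (en_sym hk)//; apply: upint_bnd; first exact: mulr_ge0.
  move=> x _.
  have potE y : pot kappa tau y = kpot tau y.
    by rewrite /pot upint_mopp// oppe0 adde0.
  have ctau : compact (supp_pos tau).
    apply: (subclosed_compact (@closed_supp_pos tau) (@ccf_csupp _ _ phi)).
    apply: supp_pos_sub; first exact: closed_closure.
    move=> l lphi; apply: (@radon_eq0 _ _ qD (ccM phi l)); first exact: pos_radon.
    move=> y; rewrite ccME; have [->|phiy] := eqVneq (phi y) 0; first exact: mul0r.
    by rewrite lphi ?mulr0//; exact: subset_closure.
  rewrite -potE; apply: (hmax tau ptau ctau t t0) => y sy; rewrite potE.
  have Dy : D y by apply: (supp_pos_sub clD _ sy); exact: carried_mmul.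
  apply: (@le_trans _ _ (kpot q y)); last by rewrite leNgt; apply/negP.
  apply: upint_le_meas => l l0; apply: le_trans (qD_le l l0).
  exact: (mmul_le pD phi01).
have qpE : ee q p = ee qU p + ee qD p by rewrite {1}qE (ee_maddl hk hpd).
move: stepD UL; rewrite /L qpE /t => h1 h2.
have -> : 4 * hh * c * m ^+ 2 = 2 * (hh * (2 * c * m) * m) by ring.
by rewrite -/S; lra.
Qed.

Lemma ee_triangle p q : Ep p -> Ep q ->
  ee q q <= 2 * ipE (msub p q) (msub p q) + 2 * ee p p.
Proof.
move=> hp hq; have fp := Ep_finE hk hp; have fq := Ep_finE hk hq.
have l2 : 0 < (2 : R) by [].
pose proof (ipE_young hk hpd fp fq l2) as Y; move: Y.
by rewrite (ipE_msub hk hpd)// !(ipE_Ep hk)// (ee_sym hk hp hq); lra.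
Qed.

End TailsAndBounds.

(** * Vector measures on a condenser *)

Lemma esum_seq (R : realType) (I : choiceType) (a : I -> \bar R) (S : set I)
    (s : seq I) : uniq s -> (forall i, 0 <= a i)%E -> (forall i, i \notin s -> a i = 0%E) ->
  (\esum_(i in S) a i = \sum_(i <- s | i \in S) a i)%E.
Proof.
move=> us a0 as0.
have -> : (\esum_(i in S) a i = \esum_(i in S `&` [set` s]) a i)%E.
  rewrite esum_mkcondr; apply: eq_esum => i _; case: ifPn => // si.
  by apply: as0; apply: contra si => si; rewrite inE.
have fin : finite_set (S `&` [set` s]).
  by apply: sub_finite_set (finite_seq s) => i [].
rewrite esum_fset// fsbig_finite//= -[RHS]big_filter; apply: perm_big.
apply: uniq_perm; [exact: finmap.fset_uniq|exact: filter_uniq|move=> i].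
rewrite in_fset_set// mem_filter in_setI; congr (_ && _).
by apply/idP/idP; rewrite inE.
Qed.

Lemma esum_seq_le (R : realType) (I : choiceType) (a : I -> R) (s : seq I)
    (P : pred I) : uniq s -> (forall i, 0 <= a i) ->
  ((\sum_(i <- s | P i) a i)%:E <= \esum_(i in [set: I]) (a i)%:E)%E.
Proof.
move=> us a0; pose b i := if (i \in s) && P i then (a i)%:E else 0%E.
apply: (@le_trans _ _ (\esum_(i in [set: I]) b i)).
  rewrite (@esum_seq _ _ b setT s us).
  - rewrite -sumEFin big_mkcond big_seq [leRHS]big_seq_cond [leRHS]big_mkcond.
    rewrite [leLHS]big_mkcond; apply: lee_sum => i _; rewrite /b in_setT andbT.
    by case: (i \in s) => //=; case: (P i).
  - by move=> i; rewrite /b; case: ifP; rewrite ?lee_fin.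
  - by move=> i; rewrite /b => /negbTE ->.
by apply: le_esum => i _; rewrite /b; case: ifP; rewrite ?lee_fin.
Qed.

Lemma ultra_bounded_cvg (R : realType) (T : Type) (F : set_system T) (phi : T -> R)
    (C : R) : UltraFilter F -> F [set t | `|phi t| <= C] ->
  exists l : R, phi t @[t --> F] --> l.
Proof.
move=> UF FC; have PF : ProperFilter F by exact: ultra_proper.
have PFp : ProperFilter (phi @ F) by exact: fmap_proper_filter.
have [|l [_ cl]] := @segment_compact R (- C) C (phi @ F) PFp.
  apply: (@filterS _ F _ [set t | `|phi t| <= C]) => // t /= tC.
  by rewrite in_itv /= -ler_norml.
exists l => V nV; have [//|FnV] := in_ultra_setVsetC (phi @^-1` V) UF.
have [r [nVr Vr]] := cl (~` V) V FnV nV.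
by [].
Qed.

Section VectorMeasures.
Variables (R : realType) (X : topologicalType).
Context {lcX : lch X}.
Variables (I : countType) (A : I -> set X).
Hypothesis clA : forall i, closed (A i).
Hypothesis lfA : forall K : set X, compact K -> finite_set [set i | A i `&` K !=set0].
Implicit Types (f g h : Cc R X) (mu nu : vmeas R X I) (S : set I).

Lemma vm_pos mu i : is_vmeas A mu -> posradon (mu i). Proof. by move=> /(_ i)[]. Qed.

Lemma vm_carried mu i : is_vmeas A mu -> carried (mu i) (A i).
Proof. by move=> /(_ i)[pm]; move/(concentratedP pm (@clA i)). Qed.

Lemma is_vmeas_intro mu : (forall i, posradon (mu i)) ->
  (forall i, carried (mu i) (A i)) -> is_vmeas A mu.
Proof. by move=> pm cm i; split=> //; apply/(concentratedP (pm i) (@clA i)). Qed.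

(** The list depends on f but not on mu, by local finiteness. So [lsum] at f is one fixed finite
    sum, linear and vaguely continuous in mu. *)
Lemma supp_seq f : exists s : seq I,
  forall mu i, is_vmeas A mu -> i \notin s -> mu i f = 0.
Proof.
have /finite_seqP[s sE] := lfA (@ccf_csupp _ _ f).
exists s => mu i vm; apply: contraNeq => fi.
have : [set` s] i.
  rewrite -sE /=; apply: contrapT => Ai0; move/eqP: fi; apply.
  apply: (vm_carried vm) => x Ax; apply: contrapT => /eqP fx; apply: Ai0.
  by exists x; split => //; exact: subset_closure.
by [].
Qed.

Lemma lsum_seq S mu f (s : seq I) : uniq s -> (forall i, i \notin s -> mu i f = 0) ->
  lsum S mu f = \sum_(i <- s | i \in S) mu i f.
Proof.
move=> us ms; rewrite /lsum !(esum_seq _ us).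
- rewrite !sumEFin /= -sumrB; apply: eq_bigr => i _.
  by case: lerP => ?; case: lerP => ?; lra.
- by move=> i; rewrite lee_fin le_max lexx orbT.
- by move=> i /ms ->; rewrite oppr0 maxxx.
- by move=> i; rewrite lee_fin le_max lexx orbT.
- by move=> i /ms ->; rewrite maxxx.
Qed.

Lemma supp_seqs (fs : seq (Cc R X)) : exists2 s : seq I, uniq s &
  forall mu i n, is_vmeas A mu -> i \notin s -> (n < size fs)%N ->
    mu i (nth (@cc0 R X) fs n) = 0.
Proof.
elim: fs => [|f fs [s us IH]]; first by exists [::].
have [t ft] := supp_seq f; exists (undup (t ++ s)); first exact: undup_uniq.
move=> mu i [|n] vm; rewrite mem_undup mem_cat negb_or => /andP[ti si] /= nf.
  exact: ft.
exact: IH.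
Qed.

Lemma posradon_lsum S mu : is_vmeas A mu -> posradon (lsum S mu).
Proof.
move=> vm; apply: posradon_intro => [f g h a b hE|f f0].
  have [s us sE] := supp_seqs [:: f; g; h].
  rewrite (@lsum_seq S mu f s)//; last by move=> i si; exact: (sE mu i 0%N).
  rewrite (@lsum_seq S mu g s)//; last by move=> i si; exact: (sE mu i 1%N).
  rewrite (@lsum_seq S mu h s)//; last by move=> i si; exact: (sE mu i 2%N).
  rewrite !mulr_sumr -big_split; apply: eq_bigr => i _.
  exact: (radonE (pos_radon (vm_pos i vm)) hE).
have [s us sE] := supp_seqs [:: f].
rewrite (@lsum_seq S mu f s)//; last by move=> i si; exact: (sE mu i 0%N).
by apply: sumr_ge0 => i _; exact: (pos_ge0 (vm_pos i vm)).
Qed.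

Lemma carried_lsum S mu : is_vmeas A mu -> carried (lsum S mu) (\bigcup_(i in S) A i).
Proof.
move=> vm f fA; have [s us sE] := supp_seqs [:: f].
rewrite (@lsum_seq S mu f s)//; last by move=> i si; exact: (sE mu i 0%N).
rewrite big1// => i; rewrite inE => Si; apply: (vm_carried vm) => x Ax.
by apply: fA; exists i.
Qed.

Lemma lsum_ge S mu i f : is_vmeas A mu -> S i -> (forall x, 0 <= f x) ->
  mu i f <= lsum S mu f.
Proof.
move=> vm Si f0; have [s us sE] := supp_seqs [:: f].
have sE0 j : j \notin s -> mu j f = 0 by move=> js; exact: (sE mu j 0%N).
rewrite (@lsum_seq S mu f s)//.
have pj j : 0 <= mu j f by exact: (pos_ge0 (vm_pos j vm)).
have [si|/sE0 ->] := boolP (i \in s); last by apply: sumr_ge0.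
rewrite (big_rem i)//= mem_set// lerDl; exact: sumr_ge0.
Qed.

Definition vmid mu nu : vmeas R X I := fun i => mlin 2^-1 (mu i) 2^-1 (nu i).

Lemma is_vmeas_mid mu nu : is_vmeas A mu -> is_vmeas A nu -> is_vmeas A (vmid mu nu).
Proof.
move=> vm vn; have h2 : 0 <= (2^-1 : R) by rewrite invr_ge0.
apply: is_vmeas_intro => i.
  apply: posradon_intro => [f g h a b hE|f f0]; rewrite /vmid /mlin.
    rewrite (radonE (pos_radon (vm_pos i vm)) hE) (radonE (pos_radon (vm_pos i vn)) hE).
    ring.
  by rewrite addr_ge0// mulr_ge0//; [exact: (pos_ge0 (vm_pos i vm))|exact: (pos_ge0 (vm_pos i vn))].
move=> f fA; rewrite /vmid /mlin (vm_carried vm fA) (vm_carried vn fA).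
by rewrite !mulr0 addr0.
Qed.

Lemma lsum_mid S mu nu : is_vmeas A mu -> is_vmeas A nu ->
  lsum S (vmid mu nu) = mlin 2^-1 (lsum S mu) 2^-1 (lsum S nu).
Proof.
move=> vm vn; apply/funext => f; have [s us sE] := supp_seqs [:: f].
have vmn := is_vmeas_mid vm vn.
rewrite /mlin (@lsum_seq S mu f s)//; last by move=> i si; exact: (sE mu i 0%N).
rewrite (@lsum_seq S nu f s)//; last by move=> i si; exact: (sE nu i 0%N).
rewrite (@lsum_seq S (vmid mu nu) f s)//; last first.
  by move=> i si; exact: (sE (vmid mu nu) i 0%N).
by rewrite !mulr_sumr -big_split.
Qed.

Lemma lsum_cvg S (F : set_system (vmeas R X I)) (lam : vmeas R X I) f :
  Filter F -> F (is_vmeas A) -> is_vmeas A lam ->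
  (forall i h, mu i h @[mu --> F] --> lam i h) ->
  lsum S mu f @[mu --> F] --> lsum S lam f.
Proof.
move=> FF Fv vl Fl; have [s us sE] := supp_seqs [:: f].
rewrite (@lsum_seq S lam f s)//; last by move=> i si; exact: (sE lam i 0%N).
have E : {near F, (fun mu => \sum_(i <- s | i \in S) mu i f) =1 (fun mu => lsum S mu f)}.
  apply: (@filterS _ F _ (is_vmeas A)) => // mu vm.
  by rewrite (@lsum_seq S mu f s)// => i si; exact: (sE mu i 0%N).
apply: cvg_trans (near_eq_cvg E) _.
elim: {us sE E} s => [|i s IH].
  rewrite big_nil; under eq_fun do rewrite big_nil; exact: cvg_cst.
rewrite big_cons; under eq_fun do rewrite big_cons.
by case: (i \in S) => //; apply: cvgD => //; exact: Fl.
Qed.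

Lemma compact_bigcup_slice S (K : set X) : compact K ->
  compact (K `&` \bigcup_(i in S) A i).
Proof.
move=> cK; have /finite_seqP[s sE] := lfA cK.
have -> : K `&` \bigcup_(i in S) A i = \big[setU/set0]_(i <- s | i \in S) (K `&` A i).
  rewrite -bigcup_seq_cond; apply/seteqP; split => x.
    move=> [Kx [i Si Ax]]; exists i => //=; rewrite mem_set// andbT.
    by have : [set` s] i by rewrite -sE; exists x.
  by move=> [i /= /andP[_ /set_mem Si] [Kx Ax]]; split => //; exists i.
by apply: bigsetU_compact => i _; exact: compact_closedI.
Qed.

(** Measures carried by disjoint P and Q are mutually singular: a cutoff equal to 1 on K [&] P and 0
    on K [&] Q shows that p is the positive part of p - q. Hence the two sums in [Rmu] are its
    Jordan parts. *)
Lemma upint_separated (p q : meas R X) (P Q : set X) F :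
  posradon p -> posradon q -> carried p P -> carried q Q -> P `&` Q = set0 ->
  (forall K, compact K -> compact (K `&` P)) ->
  (forall K, compact K -> compact (K `&` Q)) ->
  upint (msub p q) F = upint p F.
Proof.
move=> pp pq cP cQ PQ0 KP KQ; apply/eqP; rewrite eq_le; apply/andP; split.
  by apply: upint_le_meas => f f0; rewrite /msub gerBl; exact: (pos_ge0 pq).
apply: upint_le => f f0 fF.
pose K := closure [set x | f x != 0].
have cK : compact K by exact: ccf_csupp.
have oU : open (~` (K `&` Q)).
  by apply: closed_openC; apply: compact_closed (KQ _ cK); exact: lch_hausdorff.
have sub : K `&` P `<=` ~` (K `&` Q).
  by move=> x [Kx Px] [_ Qx]; have : (P `&` Q) x by []; rewrite PQ0.
have [u [u01 uP uQ]] := @bump_compact R X _ _ _ oU (KP _ cK) sub.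
have Kf x : ~ K x -> f x = 0.
  by move=> nK; apply: contrapT => /eqP fx; apply: nK; exact: subset_closure.
have -> : p f = msub p q (ccM u f).
  rewrite /msub (cQ (ccM u f)) ?subr0.
    apply/eqP; rewrite eq_le; apply/andP; split; apply: (pos_le_on pp cP) => x Px;
      rewrite ccME; (have [Kx|/Kf ->] := pselect (K x); last by rewrite mulr0);
      by rewrite uP// mul1r.
  move=> x Qx; rewrite ccME; have [Kx|/Kf ->] := pselect (K x); last by rewrite mulr0.
  by rewrite uQ ?mul0r//; apply.
apply: upint_ub => x; rewrite ccME; have /andP[ux0 ux1] := u01 x.
  exact: mulr_ge0.
apply: le_trans (fF x); rewrite lee_fin -[leRHS]mul1r; exact: ler_wpM2r.
Qed.

(** * The normalizing integrals of g *)

Variable g : X -> R.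
Hypothesis hg : {within \bigcup_i A i, continuous g}.
Variable c0 : R.
Hypothesis c0_gt0 : 0 < c0.
Hypothesis g_ge : forall x, (\bigcup_i A i) x -> c0 <= g x.

(** The value +oo off the closed set A i makes this l.s.c. on X although g is continuous only on the
    union of the A i; [gint] thus becomes an upper integral. *)
Definition gext i x : \bar R := if `[< A i x >] then (g x)%:E else +oo%E.

Lemma g_near i x (V : set R) : A i x -> nbhs (g x) V ->
  \forall y \near x, A i y -> V (g y).
Proof.
move=> Ax nV; have Ux : (\bigcup_i A i) x by exists i.
have : \forall y \near x, (\bigcup_i A i) y -> V (g y).
  by exact: ((subspace_continuousP _ g).1 hg x Ux V nV).
by apply: filterS => y Vy Ay; apply: Vy; exists i.
Qed.

Lemma gext_ge0 i x : (0 <= gext i x)%E.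
Proof.
rewrite /gext; case: asboolP => // Ax; rewrite lee_fin; apply: le_trans (ltW c0_gt0) _.
by apply: g_ge; exists i.
Qed.

Lemma lsc_gext i : lower_semicontinuous (gext i).
Proof.
move=> x r; rewrite /gext; case: asboolP => [Ax|nAx] rg.
  exists [set y | A i y -> r < g y].
    by apply: (@g_near i x [set t | r < t]) => //; apply: lt_nbhsr; rewrite -lte_fin.
  by move=> y /= ry; case: asboolP => [/ry|_]; rewrite ?lte_fin ?ltry.
exists (~` A i).
  by apply: open_nbhs_nbhs; split => //; exact: closed_openC.
by move=> y /= nAy; case: asboolP => // _; rewrite ltry.
Qed.

Lemma gintE (nu : meas R X) i : gint A g nu i = upint nu (gext i).
Proof.
rewrite /gint /upint; congr ereal_sup; congr image; apply/seteqP; split => f [f0 fg].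
  by split => // x; rewrite /gext; case: asboolP => [/fg|]; rewrite ?lee_fin ?leey.
by split => // x Ax; have := fg x; rewrite /gext; case: asboolP.
Qed.

Lemma gint_ub (nu : meas R X) i f : (forall x, 0 <= f x) ->
  (forall x, A i x -> f x <= g x) -> ((nu f)%:E <= gint A g nu i)%E.
Proof. by move=> f0 fg; apply: ereal_sup_ubound; exists f. Qed.

Lemma gint_mass (nu : meas R X) i (r : R) f : radon nu -> gint A g nu i = r%:E ->
  (forall x, 0 <= f x <= 1) -> nu f <= r / c0.
Proof.
move=> rn gE f01; rewrite ler_pdivlMr// mulrC -lee_fin -gE.
have -> : c0 * nu f = nu (ccL c0 f 0 f) by rewrite radonL// mul0r addr0.
apply: gint_ub => x; rewrite ccLE mul0r addr0; have /andP[f0 f1] := f01 x.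
  by rewrite mulr_ge0// ltW.
move=> Ax; apply: (@le_trans _ _ c0); last by apply: g_ge; exists i.
by rewrite -[leRHS]mulr1 ler_wpM2l// ltW.
Qed.

Lemma gint_mid mu nu i (r : R) : is_vmeas A mu -> is_vmeas A nu ->
  gint A g (mu i) i = r%:E -> gint A g (nu i) i = r%:E ->
  gint A g (vmid mu nu i) i = r%:E.
Proof.
move=> vm vn; rewrite !gintE => mE nE.
have h2 : 0 <= (2^-1 : R) by rewrite invr_ge0.
have -> : vmid mu nu i = madd (mscal 2^-1 (mu i)) (mscal 2^-1 (nu i)) by [].
have pm := vm_pos i vm; have pn := vm_pos i vn.
rewrite upint_madd; [|exact: posradon_mscal|exact: posradon_mscal|exact: gext_ge0].
rewrite !upint_mscal//; try exact: gext_ge0.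
by rewrite mE nE -!EFinM -EFinD; congr EFin; lra.
Qed.

(** Provides one test function in C_c that replaces g on a compact set, independently of the
    measures passing to a vague limit. *)
Lemma g_minorant i (K : set X) (d : R) : compact K -> 0 < d -> exists f,
  [/\ forall x, 0 <= f x, forall x, A i x -> f x <= g x &
    forall x, A i x -> K x -> g x - d < f x].
Proof.
move=> cK d0; have cKA : compact (K `&` A i) by exact: compact_closedI.
have gn0 := @minorants_neq0 R X (gext i) (@gext_ge0 i).
have [x [Kx Ax]|f [f0 fg] fK] := @dini_directed R X (minorants (gext i)) (K `&` A i)
    (fun x => g x - d) cKA gn0 (@minorants_max R X _ _).
  have [|f Ff rf] := @lsc_approx R X _ (gext i) x (g x - d / 2) (@lsc_gext i) (@gext_ge0 i).
    by rewrite /gext; case: asboolP => // _; rewrite lte_fin; lra.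
  exists f => //.
  have /cvgr_gt /(_ _ rf) nf := @ccf_cont _ _ f x.
  have ng : \forall y \near x, A i y -> g y < g x + d / 2.
    apply: (@g_near i x [set t | t < g x + d / 2]) => //; apply: lt_nbhsl; lra.
  near=> y => -[Ky Ay].
  have h1 : g x - d / 2 < f y by near: y.
  have h2 : g y < g x + d / 2 by move: Ay; near: y.
  lra.
exists f; split => //.
  by move=> x Ax; have := fg x; rewrite /gext; case: asboolP.
by move=> x Ax Kx; apply: fK.
Unshelve. all: by end_near. Qed.

End VectorMeasures.

(** * The Gauss variational problem *)

Lemma half_sub_eq0 (R : realFieldType) (m b : R) : 0 <= b ->
  m <= 2^-1 * m + 2^-1 * m - 4^-1 * b -> b = 0.
Proof. by move=> b0 mb; lra. Qed.

Lemma half_sub_le (R : realFieldType) (x y b m : R) : x <= m -> y <= m -> 0 <= b ->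
  2^-1 * x + 2^-1 * y - 4^-1 * b <= m.
Proof. by move=> xm ym b0; lra. Qed.

Section GaussProblem.
Variables (R : realType) (X : topologicalType).
Context {lcX : lch X}.
Variable kappa : X -> X -> \bar R.
Hypothesis hk : kernel_basic kappa.
Hypothesis hpd : strictly_pd kappa.
Hypothesis hcons : consistent kappa.
Variable hh : R.
Hypothesis hh0 : 0 <= hh.
Hypothesis hmax : gen_max_principle kappa hh.
Variables (I : countType) (Ip : set I) (A : I -> set X).
Hypothesis clA : forall i, closed (A i).
Hypothesis lfA : forall K : set X, compact K -> finite_set [set i | A i `&` K !=set0].
Hypothesis disjA : forall i j, Ip i -> ~ Ip j -> A i `&` A j = set0.
Variable ck : R.
Hypothesis ck0 : 0 <= ck.
Hypothesis kc : forall i j x y, Ip i -> ~ Ip j -> A i x -> A j y -> (kappa x y <= ck%:E)%E.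
Variable chi : meas R X.
Hypothesis hchi : finE kappa chi.
Variable g : X -> R.
Hypothesis hg : {within \bigcup_i A i, continuous g}.
Variable c0 : R.
Hypothesis c0_gt0 : 0 < c0.
Hypothesis g_ge : forall x, (\bigcup_i A i) x -> c0 <= g x.
Hypothesis hg_growth : forall i : I,
  (exists c : R, forall x, A i x -> g x <= c) \/
  (exists (r : R) (nu : meas R X), 1 < r /\ finE kappa nu /\
     exists N : set X, capacity kappa N = 0%E /\
       forall x, A i x -> ~ N x -> ((g x `^ r)%:E <= pot kappa nu x)%E).
Variable a : I -> R.
Hypothesis ha_pos : forall i, 0 < a i.
Hypothesis ha_sum : (\esum_(i in [set: I]) (a i)%:E < +oo)%E.
Variable J : set I.
Hypothesis hIpJ : Ip `<=` J.
Hypothesis hcapJ : forall j, J j -> (capacity kappa (A j) < +oo)%E.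
Implicit Types (f h : Cc R X) (mu nu lam : vmeas R X I).
Local Notation Ep := (Ep kappa).
Local Notation ipE := (ipE kappa).
Local Notation ee := (ee kappa).
Local Notation Rmu := (Rmu Ip).
Local Notation pp mu := (lsum Ip mu).
Local Notation qq mu := (lsum (~` Ip) mu).
Local Notation W := (Ep_Aag kappa Ip A g a J).

Let Gr mu := ipE (Rmu mu) (Rmu mu) + 2 * ipE chi (Rmu mu).

Lemma upint_Rmu mu (F : X -> \bar R) : is_vmeas A mu ->
  upint (Rmu mu) F = upint (pp mu) F /\ upint (mopp (Rmu mu)) F = upint (qq mu) F.
Proof.
move=> vm.
have PQ0 : \bigcup_(i in Ip) A i `&` \bigcup_(i in ~` Ip) A i = set0.
  apply/seteqP; split => x // -[[i Ipi Ax] [j nIpj Ajx]].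
  by have : (A i `&` A j) x by []; rewrite disjA.
have pP := posradon_lsum clA lfA Ip vm; have pQ := posradon_lsum clA lfA (~` Ip) vm.
have cP := carried_lsum clA lfA (S := Ip) vm.
have cQ := carried_lsum clA lfA (S := ~` Ip) vm.
have sP K := @compact_bigcup_slice X I A clA lfA Ip K.
have sQ K := @compact_bigcup_slice X I A clA lfA (~` Ip) K.
have -> : Rmu mu = msub (pp mu) (qq mu) by [].
split; first exact: (upint_separated F (pP _) (pQ _) (cP _) (cQ _) PQ0).
rewrite mopp_msub; rewrite setIC in PQ0.
exact: (upint_separated F (pQ _) (pP _) (cQ _) (cP _) PQ0).
Qed.

Lemma Ep_parts mu : is_vmeas A mu -> finE kappa (Rmu mu) -> Ep (pp mu) /\ Ep (qq mu).
Proof.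
move=> vm [_ fin].
have pP : posradon (pp mu) by exact: posradon_lsum.
have pQ : posradon (qq mu) by exact: posradon_lsum.
have uE F := upint_Rmu F vm.
have enP : penergy kappa (Rmu mu) (Rmu mu) true true = en kappa (pp mu) (pp mu).
  rewrite /penergy /= (uE _).1; congr upint; apply/funext => x; exact: (uE _).1.
have enQ : penergy kappa (Rmu mu) (Rmu mu) false false = en kappa (qq mu) (qq mu).
  rewrite /penergy /= (uE _).2; congr upint; apply/funext => x; exact: (uE _).2.
split; split => //.
  have := fin true true; rewrite enP ge0_fin_numE//.
  by apply: en_ge0 => //; exact: pos_radon.
have := fin false false; rewrite enQ ge0_fin_numE//.
by apply: en_ge0 => //; exact: pos_radon.
Qed.

Let m := fine (\esum_(i in [set: I]) (a i)%:E) / c0.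

Lemma esum_a_fin : (fine (\esum_(i in [set: I]) (a i)%:E))%:E =
  \esum_(i in [set: I]) (a i)%:E.
Proof.
rewrite fineK// ge0_fin_numE//; apply: esum_ge0 => i _.
by rewrite lee_fin ltW.
Qed.

Lemma m_ge0 : 0 <= m.
Proof.
rewrite divr_ge0 ?(ltW c0_gt0)// fine_ge0// esum_ge0// => i _.
by rewrite lee_fin ltW.
Qed.

Lemma mass_pp mu f : W mu -> (forall x, 0 <= f x <= 1) -> pp mu f <= m.
Proof.
move=> [[vm _] gE] f01; have [s us sE] := supp_seqs clA lfA [:: f].
rewrite (@lsum_seq R X I Ip mu f s)//; last by move=> i si; exact: (sE mu i 0%N).
rewrite ler_pdivlMr// mulr_suml -lee_fin esum_a_fin.
apply: le_trans (esum_seq_le (fun i => i \in Ip) us (fun i => ltW (ha_pos i))).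
rewrite lee_fin; apply: ler_sum => i; rewrite inE => Ipi.
rewrite -ler_pdivlMr//.
exact: (gint_mass c0_gt0 g_ge (pos_radon (vm_pos i vm)) (gE i (hIpJ Ipi)) f01).
Qed.

(** The bounds needed for vague compactness: only the energy of R mu is visible in G, and
    [energy_bound] separates the two parts. *)
Lemma W_energy (C : R) : exists M : R, forall mu, W mu -> Gr mu <= C ->
  [/\ Ep (pp mu), Ep (qq mu), ee (pp mu) (pp mu) <= M, ee (qq mu) (qq mu) <= M &
    ipE (Rmu mu) (Rmu mu) <= M].
Proof.
(* S comes from |2 chi + R mu|^2 >= 0, i.e. |R mu|^2 <= 2 G(mu) + 4 |chi|^2. The final factor 4
   comes from |mu^-|^2 <= 2 |R mu|^2 + 2 |mu^+|^2. *)
pose S := 2 * C + 4 * ipE chi chi; pose M1 := 4 * hh * ck * m ^+ 2.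
pose M2 := Num.max S 0 + M1; exists (4 * M2) => mu Wmu GC.
have [[vm fR] gE] := Wmu; have [hp hq] := Ep_parts vm fR.
have h2 : 0 < (2^-1 : R) by rewrite invr_gt0.
have RS : ipE (Rmu mu) (Rmu mu) <= S.
  have l2 : 0 < (2 : R) by [].
  pose proof (ipE_ge0 hk hpd (finE_mlin hk hpd 2 1 hchi fR)) as b0; move: b0.
  by rewrite (ipE_quad hk hpd)//; move: GC; rewrite /Gr /S; lra.
have eb : ee (pp mu) (pp mu) <= ipE (Rmu mu) (Rmu mu) + M1.
  apply: (@energy_bound R X _ kappa hk hpd hh hmax _ _
    (\bigcup_(i in Ip) A i) (\bigcup_(i in ~` Ip) A i)) => //.
  - exact: carried_lsum.
  - exact: carried_lsum.
  - exact: m_ge0.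
  - by move=> x y [i Ipi Ax] [j nIpj Ay]; exact: (kc Ipi nIpj Ax Ay).
  - by move=> f f01; exact: mass_pp.
have et : ee (qq mu) (qq mu) <=
    2 * ipE (Rmu mu) (Rmu mu) + 2 * ee (pp mu) (pp mu) by exact: ee_triangle.
have R0 : 0 <= ipE (Rmu mu) (Rmu mu) by exact: ipE_ge0.
have SM : S <= Num.max S 0 by rewrite le_max lexx.
have M10 : 0 <= M1.
  by rewrite /M1 mulr_ge0 ?sqr_ge0// !mulr_ge0.
by rewrite /M2; split => //; lra.
Qed.

Lemma GchiE mu : W mu -> Gchi kappa Ip chi mu = (Gr mu)%:E.
Proof.
by move=> [[vm fR] _]; rewrite /Gchi /energy !(menergyE hk hpd).
Qed.

Lemma Gr_ge mu : W mu -> - ipE chi chi <= Gr mu.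
Proof.
move=> [[vm fR] _]; pose proof (ipE_ge0 hk hpd (finE_mlin hk hpd 1 1 hchi fR)) as b0.
by move: b0; rewrite (ipE_quad hk hpd)// /Gr; lra.
Qed.

Lemma Gchi_inf_fin : W !=set0 -> exists m0 : R,
  [/\ Gchi_inf kappa Ip A chi g a J = m0%:E, forall mu, W mu -> m0 <= Gr mu &
    forall e, 0 < e -> exists2 mu, W mu & Gr mu <= m0 + e].
Proof.
move=> [mu0 W0]; pose G := Gchi_inf kappa Ip A chi g a J.
have lb mu : W mu -> (G <= (Gr mu)%:E)%E.
  by move=> Wmu; rewrite -GchiE//; apply: ereal_inf_lbound; exists mu.
have Gfin : G \is a fin_num.
  rewrite fin_numE; apply/andP; split.
    rewrite gt_eqF//; apply: (@lt_le_trans _ _ (- ipE chi chi)%:E); first exact: ltNyr.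
    apply: le_ereal_inf_tmp => _ [mu Wmu <-]; rewrite GchiE// lee_fin; exact: Gr_ge.
  by rewrite lt_eqF//; apply: le_lt_trans (lb _ W0) (ltry _).
exists (fine G); split; first by rewrite fineK.
  by move=> mu Wmu; rewrite -lee_fin fineK// lb.
move=> e e0; have : (G < (fine G + e)%:E)%E.
  by rewrite EFinD fineK// lteDl// lte_fin.
move=> /ereal_inf_lt[_ [mu Wmu <-]]; rewrite GchiE// lte_fin => /ltW Ge.
by exists mu.
Qed.

Lemma Rmu_mid mu nu : is_vmeas A mu -> is_vmeas A nu ->
  Rmu (vmid mu nu) = mlin 2^-1 (Rmu mu) 2^-1 (Rmu nu).
Proof.
move=> vm vn; apply/funext => f.
have -> : Rmu (vmid mu nu) f = pp (vmid mu nu) f - qq (vmid mu nu) f by [].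
by rewrite !(lsum_mid clA lfA)// /mlin /Rmu; ring.
Qed.

Lemma W_mid mu nu : W mu -> W nu -> W (vmid mu nu).
Proof.
move=> [[vm fm] gm] [[vn fn] gn]; split; first split.
- exact: is_vmeas_mid.
- by rewrite Rmu_mid//; exact: finE_mlin.
- by move=> j Jj; apply: (gint_mid c0_gt0 g_ge vm vn); [exact: gm|exact: gn].
Qed.

Lemma Gr_mid mu nu : W mu -> W nu -> Gr (vmid mu nu) =
  2^-1 * Gr mu + 2^-1 * Gr nu -
  4^-1 * ipE (msub (Rmu mu) (Rmu nu)) (msub (Rmu mu) (Rmu nu)).
Proof.
move=> [[vm fm] _] [[vn fn] _].
rewrite /Gr Rmu_mid// msub_mlin !(ipE_quad hk hpd)// (ipE_linr hk hpd)//.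
move: (ipE (Rmu mu) (Rmu mu)) (ipE (Rmu mu) (Rmu nu)) (ipE (Rmu nu) (Rmu nu)) => x y z.
by move: (ipE chi (Rmu mu)) (ipE chi (Rmu nu)) => u v; field.
Qed.

Lemma Ep_component (M : R) mu i : is_vmeas A mu -> Ep (pp mu) -> Ep (qq mu) ->
  ee (pp mu) (pp mu) <= M -> ee (qq mu) (qq mu) <= M ->
  Ep (mu i) /\ ee (mu i) (mu i) <= M.
Proof.
move=> vm hp hq pM qM; have pi := vm_pos i vm.
have [Ipi|nIpi] := pselect (Ip i).
  have le f : (forall x, 0 <= f x) -> mu i f <= pp mu f by move=> f0; exact: lsum_ge.
  have hi : Ep (mu i) by exact: Ep_le le.
  by split => //; apply: le_trans pM; exact: ee_le.
have le f : (forall x, 0 <= f x) -> mu i f <= qq mu f by move=> f0; exact: lsum_ge.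
have hi : Ep (mu i) by exact: Ep_le le.
by split => //; apply: le_trans qM; exact: ee_le.
Qed.

(** Finite energy of [Rmu lam] is not claimed: existence obtains it from strong limits, compactness
    from the constancy of R mu on solutions. Testing against minorants of g gives the upper bound on
    the limit integrals; the lower bound is the absence of escaping mass. *)
Lemma vague_limit (C : R) (F : set_system (vmeas R X I)) : UltraFilter F ->
  F [set mu | W mu /\ Gr mu <= C] ->
  exists lam, [/\ F --> lam, is_vmeas A lam,
    forall j, J j -> gint A g (lam j) j = (a j)%:E &
    forall S f, lsum S mu f @[mu --> F] --> lsum S lam f].
Proof.
move=> UF FW; have PF : ProperFilter F by exact: ultra_proper.
have [M HM] := W_energy C.
have comp mu i : W mu -> Gr mu <= C -> Ep (mu i) /\ ee (mu i) (mu i) <= M.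
  move=> Wmu GC; have [hp hq pM qM _] := HM mu Wmu GC.
  by have [[vm _] _] := Wmu; exact: Ep_component.
have lim (t : I * Cc R X) : exists l : R, mu t.1 t.2 @[mu --> F] --> l.
  have [C' HC'] := strong_vague_bound hk hpd t.2 M.
  apply: (@ultra_bounded_cvg R _ F (fun mu : vmeas R X I => mu t.1 t.2) C' UF).
  apply: filterS FW => mu [Wmu GC]; have [hi iM] := comp mu t.1 Wmu GC.
  exact: HC'.
have [l lE] := choice lim.
pose lam : vmeas R X I := fun i f => l (i, f).
have Fl i f : mu i f @[mu --> F] --> lam i f by exact: (lE (i, f)).
have Fv : F (is_vmeas A) by apply: filterS FW => mu [[[]]].
have vl : is_vmeas A lam.
  apply: (is_vmeas_intro clA) => i.
    apply: (@posradon_cvg R X _ _ F (fun mu : vmeas R X I => mu i)) => //.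
    by apply: filterS Fv => mu vm; exact: vm_pos vm.
  move=> f fA; apply: (@cvg_unique _ (@Rhausdorff R) (mu i f @[mu --> F])).
    exact: Fl.
  apply: cvg_near_cst; apply: filterS Fv => mu vm.
  have cm : carried (mu i) (A i) by exact: vm_carried.
  exact: cm.
exists lam; split => //.
- apply: ptws_cvg => i; apply: ptws_cvg => f; exact: Fl.
- move=> j Jj; apply/eqP; rewrite eq_le; apply/andP; split.
    apply: ge_ereal_sup => _ [f [f0 fg] <-]; rewrite lee_fin.
    apply: (@closed_cvg _ _ F _ (fun mu : vmeas R X I => mu j f) [set r | r <= a j]
      _ _ _ (Fl j f)); first exact: closed_le.
    apply: filterS FW => mu [[_ gE] _] /=.
    by rewrite -lee_fin -(gE j Jj); exact: gint_ub.
  apply/lee_addgt0Pr => e e0; have e3 : 0 < e / 3 by rewrite divr_gt0.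
  have [K cK HK] := g_tail hk hpd hcons M (@clA j) (hcapJ Jj) e3 (hg_growth j).
  have [u [u01 uK _]] := @bump_compact R X _ setT K openT cK (@subsetT _ K).
  have u0 x : 0 <= u x by have /andP[] := u01 x.
  (* The mass of mu j is at most a j / c0, so replacing g by g - d on the support of u costs e/3.
     The other two thirds are the defect of f in the supremum [gint] and the tail outside K. *)
  pose d := e / 3 * c0 / a j.
  have d0 : 0 < d by rewrite divr_gt0// mulr_gt0.
  have [f0 [f00 f0g f0K]] :=
    g_minorant clA hg c0_gt0 g_ge j (@ccf_csupp _ _ u) d0.
  apply: (@le_trans _ _ ((lam j f0)%:E + e%:E)%E); last first.
    by apply: leeD => //; exact: gint_ub.
  rewrite -EFinD lee_fin -lerBlDr.
  apply: (@closed_cvg _ _ F _ (fun mu : vmeas R X I => mu j f0) [set r | a j - e <= r]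
    _ _ _ (Fl j f0)); first exact: closed_ge.
  apply: filterS FW => mu [Wmu GC] /=.
  have [hj jM] := comp mu j Wmu GC; have [[vm _] gE] := Wmu.
  have pj := Ep_pos hj; have rj := pos_radon pj.
  have cj : carried (mu j) (A j) by exact: vm_carried.
  have [_ [f [f_0 fg] <-]] : exists2 y, [set (mu j f)%:E | f in [set f : Cc R X |
      (forall x, 0 <= f x) /\ (forall x, A j x -> f x <= g x)]] y &
      ((a j - e / 3)%:E < y)%E.
    by apply: ereal_sup_gt; rewrite -/(gint A g (mu j) j) gE// lte_fin; lra.
  rewrite lte_fin => af.
  (* f2 = (1 - u) f vanishes on K and is a tail; f1 = u f lies on A j below f0 + d u. *)
  pose f1 := ccM u f; pose f2 := ccL 1 f (-1) f1.
  have f2E x : f2 x = (1 - u x) * f x by rewrite ccLE ccME; ring.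
  have h2 : mu j f2 <= e / 3.
    apply: (HK _ _ hj cj jM) => x; rewrite f2E; have /andP[ux0 ux1] := u01 x.
    - by rewrite mulr_ge0// subr_ge0.
    - move=> Ax; apply: le_trans (fg x Ax); rewrite -[leRHS]mul1r ler_wpM2r//; lra.
    - by move=> Kx; rewrite uK// subrr mul0r.
  have h1 : mu j f1 <= mu j (ccL 1 f0 d u).
    apply: (pos_le_on pj cj) => x Ax; rewrite ccLE ccME mul1r.
    have /andP[ux0 ux1] := u01 x.
    have [->|ux] := eqVneq (u x) 0; first by rewrite mul0r mulr0 addr0.
    have Kx : closure [set x | u x != 0] x by exact: subset_closure.
    have := f0K x Ax Kx; have := fg x Ax => fgx gf0.
    apply: (@le_trans _ _ (u x * (f0 x + d))); first by rewrite ler_wpM2l//; lra.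
    by rewrite mulrDr [u x * d]mulrC lerD2r ler_piMl.
  have h3 : mu j u <= a j / c0.
    exact: (gint_mass c0_gt0 g_ge rj (gE j Jj) u01).
  have h4 : mu j f2 = mu j f - mu j f1 by rewrite radonL//; ring.
  have h5 : mu j (ccL 1 f0 d u) = mu j f0 + d * mu j u by rewrite radonL// mul1r.
  have h6 : d * mu j u <= e / 3.
    apply: (@le_trans _ _ (d * (a j / c0))); first by rewrite ler_wpM2l// ltW.
    by rewrite le_eqVlt; apply/orP; left; apply/eqP; rewrite /d; field;
      rewrite !gt_eqF.
  by lra.
- by move=> S f; exact: lsum_cvg.
Qed.

(** With E = R mu - R lam, |E|^2 <= 2D, and the cross terms of E with R mu and chi are estimated by
    Young's inequality with parameter s: together |E|^2 + 2 |E|^2 / s <= (2 + 4/s) D. *)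
Lemma Gr_strong_near (s D : R) mu lam : 0 < s ->
  Ep (pp mu) -> Ep (qq mu) -> Ep (pp lam) -> Ep (qq lam) ->
  D = ipE (msub (pp mu) (pp lam)) (msub (pp mu) (pp lam)) +
      ipE (msub (qq mu) (qq lam)) (msub (qq mu) (qq lam)) ->
  Gr lam <= Gr mu + s * (ipE (Rmu mu) (Rmu mu) + ipE chi chi) + (2 + 4 / s) * D.
Proof.
move=> s0 hp hq hp' hq' DE.
have fR : finE kappa (Rmu mu) by exact: (finE_msub hk hpd hp hq).
have fp : finE kappa (msub (pp mu) (pp lam)) by exact: finE_msub.
have fq : finE kappa (msub (qq mu) (qq lam)) by exact: finE_msub.
pose E := mlin 1 (msub (pp mu) (pp lam)) (-1) (msub (qq mu) (qq lam)).
have fE : finE kappa E by exact: finE_mlin.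
have LE : Rmu lam = mlin 1 (Rmu mu) (-1) E.
  by apply/funext => f; rewrite /mlin /E /mlin /Rmu /msub; ring.
have ED : ipE E E <= 2 * D.
  pose proof (ipE_ge0 hk hpd (finE_mlin hk hpd 1 1 fp fq)) as b0; move: b0.
  rewrite /E DE !(ipE_quad hk hpd)//; clear DE.
  move: (ipE (msub (pp mu) (pp lam)) (msub (pp mu) (pp lam))) => x.
  move: (ipE (msub (pp mu) (pp lam)) (msub (qq mu) (qq lam))) => y.
  by move: (ipE (msub (qq mu) (qq lam)) (msub (qq mu) (qq lam))) => z; lra.
have neg sg : finE kappa sg -> - (2 * ipE sg E) <= s * ipE sg sg + ipE E E / s.
  move=> fs; pose proof (ipE_ge0 hk hpd (finE_mlin hk hpd s 1 fs fE)) as b0; move: b0.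
  rewrite (ipE_quad hk hpd)// => b0; rewrite -subr_ge0.
  have -> : s * ipE sg sg + ipE E E / s - - (2 * ipE sg E) =
      (s ^+ 2 * ipE sg sg + 2 * s * 1 * ipE sg E + 1 ^+ 2 * ipE E E) / s.
    by field; rewrite gt_eqF.
  by rewrite divr_ge0// ltW.
have n1 := neg _ fR; have n2 := neg _ hchi.
have EDs : ipE E E / s <= 2 * D / s by rewrite ler_pM2r// invr_gt0.
have -> : Gr lam = Gr mu - 2 * ipE (Rmu mu) E - 2 * ipE chi E + ipE E E.
  by rewrite /Gr LE (ipE_quad hk hpd)// (ipE_linr hk hpd)//; ring.
have -> : (2 + 4 / s) * D = 2 * D + 2 * (2 * D / s) by field; rewrite gt_eqF.
by lra.
Qed.

Lemma gauss_exists : W !=set0 ->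
  exists2 lam, W lam & Gchi kappa Ip chi lam = Gchi_inf kappa Ip A chi g a J.
Proof.
move=> Wn0; have [m0 [m0E m0le m0e]] := Gchi_inf_fin Wn0.
have [M HM] := W_energy (m0 + 1).
(* Restricting to e <= 1 lets the single energy bound M, taken at level m0 + 1, serve all these
   sets. *)
pose S (e : R) := [set mu | W mu /\ Gr mu <= m0 + e].
pose BB := [set S e | e in [set e : R | 0 < e <= 1]].
have [||||T s [e /andP[e0 e1] <-] [Ws Gs]|F [PF BF CP CQ]] :=
  @convexify R X _ kappa hk hpd (vmeas R X I) (@vmid R X I) (fun mu => pp mu)
    (fun mu => qq mu) BB (M + M).
- by exists (S 1); exists 1 => //=; rewrite ltr01 lexx.
- by move=> _ [e /andP[e0 _] <-]; have [mu Wmu Gmu] := m0e e e0; exists mu.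
- move=> _ _ [e /andP[e0 e1] <-] [e' /andP[e'0 e'1] <-]; exists (S (Num.min e e')).
    by exists (Num.min e e') => //=; rewrite lt_min e0 e'0 ge_min e1.
  move=> mu [Wmu Gmu]; split; split => //; apply: le_trans Gmu _; rewrite lerD2l.
    by rewrite ge_min lexx.
  by rewrite ge_min lexx orbT.
- move=> _ s t [e /andP[e0 e1] <-] [Ws Gs] [Wt Gt].
  have [[vs fs] _] := Ws; have [[vt ft] _] := Wt.
  split; last by rewrite !(lsum_mid clA lfA).
  split; first exact: W_mid.
  rewrite Gr_mid//.
  have b0 : 0 <= ipE (msub (Rmu s) (Rmu t)) (msub (Rmu s) (Rmu t)).
    by rewrite msub_mlin; apply: ipE_ge0 => //; exact: finE_mlin.
  exact: (half_sub_le Gs Gt b0).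
- have [|hp hq pM qM _] := HM s Ws; first by apply: le_trans Gs _; rewrite lerD2l.
  by split => //; exact: lerD.
(* Passing to an ultrafilter provides the vague limit, and the Cauchy properties of F are
   inherited. *)
have [U [UU FU]] := ultraFilterLemma PF.
have PU : ProperFilter U by exact: ultra_proper.
have US e : 0 < e -> e <= 1 -> U (S e).
  by move=> e0 e1; apply: FU; apply: BF; exists e => //=; rewrite e0 e1.
have U1 : U (S 1) by apply: US.
have [lam [Ulam vl gl Ul]] := vague_limit UU U1.
have UE : U [set mu | Ep (pp mu)] /\ U [set mu | Ep (qq mu)].
  by split; apply: filterS U1 => mu [Wmu Gmu]; have [] := HM mu Wmu Gmu.
have cau (P : vmeas R X I -> meas R X) : cauchy_along kappa F P -> cauchy_along kappa U P.
  by move=> CF e e0; have [T FT HT] := CF e e0; exists T => //; exact: FU.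
have [hp limp] := strong_limit hk hpd hcons PU UE.1 (cau _ CP) (fun f => Ul Ip f).
have [hq limq] := strong_limit hk hpd hcons PU UE.2 (cau _ CQ) (fun f => Ul (~` Ip) f).
have Wl : W lam.
  by split => //; split => //; exact: (finE_msub hk hpd hp hq).
exists lam => //; rewrite GchiE// m0E; congr EFin.
apply/eqP; rewrite eq_le m0le// andbT; apply/ler_addgt0Pr => e e0.
(* The parameters give e' <= e/4, s C = e/4 and (2 + 4/s)(2r) = e/4, together less than e. *)
pose C := Num.max (M + ipE chi chi) 0 + 1.
have C0 : 0 < C by rewrite ltr_wpDl// le_max lexx orbT.
pose s := e / 4 / C; have s0 : 0 < s by rewrite !divr_gt0.
pose r := e / 8 / (2 + 4 / s).
have q0 : 0 < 2 + 4 / s by rewrite addr_gt0// divr_gt0.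
have r0 : 0 < r by rewrite !divr_gt0.
pose e' := Num.min (e / 4) 1.
have e'0 : 0 < e' by rewrite lt_min ltr01 divr_gt0.
have e'1 : e' <= 1 by rewrite ge_min lexx orbT.
have [mu [[[Wmu Gmu] mup] muq]] :=
  @filter_ex _ U _ _ (filterI (filterI (US e' e'0 e'1) (limp r r0)) (limq r r0)).
have [|hpm hqm pM qM RM] := HM mu Wmu; first by apply: le_trans Gmu _; rewrite lerD2l.
apply: le_trans (Gr_strong_near s0 hpm hqm hp hq (erefl _)) _.
have e'4 : e' <= e / 4 by rewrite ge_min lexx.
have h1 : s * (ipE (Rmu mu) (Rmu mu) + ipE chi chi) <= e / 4.
  apply: (@le_trans _ _ (s * C)).
    rewrite ler_wpM2l ?(ltW s0)//; apply: (@le_trans _ _ (M + ipE chi chi)).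
      by rewrite lerD2r.
    apply: (@le_trans _ _ (Num.max (M + ipE chi chi) 0)); first by rewrite le_max lexx.
    by rewrite lerDl.
  by rewrite /s mulfVK// gt_eqF.
have h2 : (2 + 4 / s) * (ipE (msub (pp mu) (pp lam)) (msub (pp mu) (pp lam)) +
    ipE (msub (qq mu) (qq lam)) (msub (qq mu) (qq lam))) <= e / 4.
  apply: (@le_trans _ _ ((2 + 4 / s) * (r + r))).
    by rewrite ler_wpM2l ?(ltW q0)// lerD// ltW.
  rewrite /r le_eqVlt; apply/orP; left; apply/eqP.
  by rewrite mulrDr mulrC mulfVK ?gt_eqF//; lra.
by move: h1 h2; lra.
Qed.

Lemma solutions_compact : compact (solutions kappa Ip A chi g a J).
Proof.
rewrite compact_ultra => F UF FS; have PF : ProperFilter F by exact: ultra_proper.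
have [mu0 [W0 G0]] := filter_ex FS.
have [|m0 [m0E m0le _]] := Gchi_inf_fin; first by exists mu0.
have GS mu : solutions kappa Ip A chi g a J mu -> W mu /\ Gr mu = m0.
  move=> [Wmu]; rewrite GchiE// m0E => -[Gm]; by split.
have [_ Gr0] := GS mu0 (conj W0 G0).
(* The midpoint of two solutions is admissible, so the parallelogram term must vanish; strict
   definiteness then gives equality. *)
have same mu : solutions kappa Ip A chi g a J mu -> Rmu mu = Rmu mu0.
  move=> /GS[Wmu Gmu]; have := m0le _ (W_mid Wmu W0); rewrite Gr_mid// Gmu Gr0.
  have [[vm fm] _] := Wmu; have [[v0 f0] _] := W0.
  have fD : finE kappa (msub (Rmu mu) (Rmu mu0)).
    by rewrite msub_mlin; exact: finE_mlin.
  have b0 : 0 <= ipE (msub (Rmu mu) (Rmu mu0)) (msub (Rmu mu) (Rmu mu0)) by exact: ipE_ge0.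
  move=> bm; have bE : ipE (msub (Rmu mu) (Rmu mu0)) (msub (Rmu mu) (Rmu mu0)) = 0.
    exact: half_sub_eq0 b0 bm.
  have en0 : energy kappa (msub (Rmu mu) (Rmu mu0)) = 0%E.
    by rewrite /energy (menergyE hk hpd)// bE.
  apply/funext => f; have /eqP := hpd.2 _ fD en0 f.
  by rewrite /msub subr_eq0 => /eqP.
have FW : F [set mu | W mu /\ Gr mu <= m0].
  by apply: filterS FS => mu /GS[Wmu Gmu]; split => //; rewrite Gmu.
have [lam [Flam vl gl Fl]] := vague_limit UF FW.
(* R mu is constant along the filter, so the limit has the same R, hence finite energy and the same
   G, without strong convergence. *)
have Rl : Rmu lam = Rmu mu0.
  apply/funext => f.
  have cR : Rmu mu f @[mu --> F] --> Rmu lam f.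
    by apply: cvgB; [exact: (Fl Ip f)|exact: (Fl (~` Ip) f)].
  apply: (@cvg_unique _ (@Rhausdorff R) (Rmu mu f @[mu --> F])).
    exact: cR.
  by apply: cvg_near_cst; apply: filterS FS => mu /same ->.
exists lam; split; last exact: Flam.
split; last by rewrite -G0 /Gchi Rl.
split; last exact: gl.
by split; [exact: vl|rewrite Rl; case: W0 => -[]].
Qed.

End GaussProblem.

Theorem theorem7p1
  (R : realType) (X : topologicalType)
  (hX : hausdorff_space X) (lcX : locally_compact [set: X])
  (ncX : ~ compact [set: X])
  (kappa : X -> X -> \bar R)
  (hk : kernel_basic kappa)
  (hpd : strictly_pd kappa) (hcons : consistent kappa)
  (hoff : offdiag_cont kappa) (hinf : vanish_at_infty kappa)
  (h : R) (h1 : 1 <= h) (hmax : gen_max_principle kappa h)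
  (I : countType) (Ip : set I) (A : I -> set X)
  (hcond : condenser kappa Ip A)
  (chi : meas R X)
  (hchi_rad : radon chi)
  (hchi_bdd : mass chi \is a fin_num /\ mass (mopp chi) \is a fin_num)
  (hchi_E : finE kappa chi)
  (hchi_pos : supp_pos chi `&` \bigcup_(i in ~` Ip) A i = set0)
  (hchi_neg : supp_pos (mopp chi) `&` \bigcup_(i in Ip) A i = set0)
  (g : X -> R)
  (hg_cont : {within \bigcup_i A i, continuous g})
  (hg_inf : exists2 c : R, 0 < c & forall x, (\bigcup_i A i) x -> c <= g x)
  (hg_growth : forall i : I,
     (exists c : R, forall x, A i x -> g x <= c) \/
     (exists (r : R) (nu : meas R X), 1 < r /\ finE kappa nu /\
        exists N : set X, capacity kappa N = 0%E /\
          forall x, A i x -> ~ N x -> ((g x `^ r)%:E <= pot kappa nu x)%E))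
  (a : I -> R) (ha_pos : forall i, 0 < a i)
  (ha_sum : (\esum_(i in [set: I]) (a i)%:E < +oo)%E)
  (hGfin : (Gchi_inf kappa Ip A chi g a [set: I] < +oo)%E)
  (J : set I) (hIpJ : Ip `<=` J)
  (hcapJ : forall j, J j -> (capacity kappa (A j) < +oo)%E) :
  (exists2 lam : vmeas R X I, Ep_Aag kappa Ip A g a J lam &
      Gchi kappa Ip chi lam = Gchi_inf kappa Ip A chi g a J) /\
  compact (solutions kappa Ip A chi g a J).
Proof.
have lc : lch X by exact: Lch.
have h0 : 0 <= h by exact: le_trans h1.
have [_ [An0 [lfA [disjA [c kc]]]]] := hcond.
have clA i : closed (A i) by have [] := An0 i.
have [c0 c0_gt0 g_ge] := hg_inf.
have c10 : 0 <= Num.max c 0 by rewrite le_max lexx orbT.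
have kc1 i j x y : Ip i -> ~ Ip j -> A i x -> A j y ->
    (kappa x y <= (Num.max c 0)%:E)%E.
  move=> Ii Ij Ax Ay; apply: le_trans (kc i j x y Ii Ij Ax Ay) _.
  by rewrite lee_fin le_max lexx.
(* Finiteness of the infimum for the full index set yields an admissible vector measure, which
   satisfies in particular the constraints in J. *)
have Wn0 : Ep_Aag kappa Ip A g a J !=set0.
  have [_ [mu [Emu gE] _] _] := ereal_inf_lt hGfin.
  by exists mu; split => // j _; exact: gE.
split.
  exact: (gauss_exists hk hpd hcons h0 hmax clA lfA disjA c10 kc1 hchi_E hg_cont
    c0_gt0 g_ge hg_growth ha_pos ha_sum hIpJ hcapJ Wn0).
exact: (solutions_compact hk hpd hcons h0 hmax clA lfA disjA c10 kc1 hchi_E hg_cont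
  c0_gt0 g_ge hg_growth ha_pos ha_sum hIpJ hcapJ).
Qed.
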